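(* Let $b\ge 2$ be an integer. Consider the Diophantine equation $$P_n=b^{d}Q_m+P_k$$ in nonnegative integers $n,m,k$, where $d$ is the number of digits of $P_k$ in base $b$. This equation has only finitely many solutions; more precisely, every solution satisfies $n<4.7\cdot 10^{30}\log^3 b$.
   Context: $(P_n)_{n\ge0}$ is the Pell sequence: $P_0=0$, $P_1=1$, $P_n=2P_{n-1}+P_{n-2}$ for $n\ge2$. $(Q_n)_{n\ge0}$ is the Pell–Lucas sequence: $Q_0=2$, $Q_1=2$, $Q_n=2Q_{n-1}+Q_{n-2}$ for $n\ge2$. For a positive integer $N$, the number of digits of $N$ in base $b$ is $\lfloor \log_b N\rfloor+1$; the number $0$ (i.e. $P_0$) is taken to have $d=1$ digit. $\log$ denotes the natural logarithm. *)

(* Defs.v *)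
From Stdlib Require Import Reals.
From mathcomp Require Import ssreflect ssrnat prime.

Fixpoint pell (n : nat) : nat :=
  match n with
  | 0 => 0
  | S n' => match n' with
            | 0 => 1
            | S n'' => 2 * pell n' + pell n''
            end
  end.

Fixpoint pell_lucas (n : nat) : nat :=
  match n with
  | 0 => 2
  | S n' => match n' with
            | 0 => 2
            | S n'' => 2 * pell_lucas n' + pell_lucas n''
            end
  end.

(* Number of base-b digits of N: floor(log_b N) + 1 for N > 0, and 1 for N = 0.
   trunc_log b N is the largest e with b^e <= N (i.e. floor(log_b N)) for N > 0,
   and 0 when N = 0, so this matches the convention d(0) = 1. *)
Definition ndigits (b N : nat) : nat := trunc_log b N + 1.

(* Main.v *)
(** Write alpha = 1 + sqrt 2, let mu be the integer part of log2 b, and put c = n - m - k; by size,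
    1 <= c <= mu + 2 as soon as k > 0.

    If c < m, reduce modulo Q_m.  Since P_(x+2m) = P_x and P_(m+x) = P_(m-x) modulo Q_m up to sign,
    and since 2 P_j < Q_m for j <= m, the congruence P_n = P_k forces n = k + 2e with m | k + e.  Then
    b^d Q_m is P_e Q_(k+e) or Q_e P_(k+e), so b is even and 2^d divides P_e or P_(k+e), hence divides e
    or k + e.  As e and k are O(mu d), this bounds d and everything else.

    If m <= c, then t = n - k = m + c is O(mu), and
    d log b - k log alpha - log (sqrt 2 (alpha^t - 1) / (4 Q_m)) is at most 2^-k in absolute value.
    Such a small linear form in three logarithms is excluded by Baker's method over K = Q(sqrt 2).
    Siegel's lemma gives integers c_s such that the function
    x |-> sum_s c_s z1(s)^i z2(s)^j y(s)^x vanishes at odd integers for many (i, j), where y(s) runs over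
    the products b^s1 alpha^s2 G^s3 q^(S-s3) and z1, z2 are the coordinates of log y(s) after elimination
    of the third logarithm.  Hermite interpolation makes its value at a half-integer so small that the
    product of its conjugates, which is at least 1 when not 0, rules out all values but 0.  Square roots
    of elements of K in distinct classes modulo squares are linearly independent over K, so the relation
    splits along these classes, and y may be replaced by its square roots on one of them.  After enough
    halvings all y(s) left coincide; the relation is then a Vandermonde system in z1, and c vanishes. *)

Require Import Defs.
From Stdlib Require Import Reals Lra.
From mathcomp Require all_boot all_order all_algebra all_classical all_reals all_analysis Rstruct.
From mathcomp Require ring lra zify.

(** The split between c < m and m <= c is forced by heights. The third number [G] / q of the linear
    form depends on t and m, and Baker's method pays for its height, which is O(mu) only when m <=
    c: then m <= mu + 2 and t <= 2 mu + 4. For larger m the congruence has to do all the work. A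
    multiplicative dependence among b, alpha and [G] / q would make y non-injective. The end of the
    descent therefore works on a fiber of y, where z1 is still injective because S <= d. Everything
    stays inside a real field: square roots can become imaginary only at the conjugate embedding,
    and there bounds on moduli suffice. The cube of log b comes from the requirement k >= 2^58 be^3
    lam^2, with lam of order log b and be of order log k. The factor be^3 is charged to k^(1/3);
    what remains, k^(2/3) >= const lam^2, reads k >= const lam^3. Most parameters are powers of two,
    which reduces many comparisons to linear arithmetic on exponents. *)

Module LinearForms.
Import all_boot all_order all_algebra all_classical all_reals all_analysis.
Import ring lra zify.
Set Implicit Arguments. Unset Strict Implicit. Unset Printing Implicit Defensive.
Import Order.TTheory GRing.Theory Num.Theory numFieldNormedType.Exports.
Local Open Scope ring_scope.

(** * The field Q(sqrt 2) *)

Section QSqrt2.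
Variable R : rcfType.
Implicit Types (x y z : R) (p q : rat).

Definition s2 : R := Num.sqrt 2.

Lemma s2_sq : s2 * s2 = 2.
Proof. by rewrite -expr2 sqr_sqrtr. Qed.

Lemma s2_gt0 : 0 < s2.
Proof. by rewrite sqrtr_gt0. Qed.

Lemma rat_sqr_neq2 p : p * p != 2.
Proof.
apply/eqP => h.
have d0 : (denq p)%:~R != 0 :> rat by rewrite intr_eq0 denq_neq0.
have : (numq p)%:~R * (numq p)%:~R = 2 * (denq p)%:~R * (denq p)%:~R :> rat.
  by rewrite -{1 2}(divq_num_den p) in h; rewrite -h; field.
rewrite -!intrM -(intrM _ 2%Z) -intrM => /intr_inj /(congr1 absz).
rewrite !abszM.
have n0 : (0 < `|numq p|)%N.
  rewrite absz_gt0 numq_eq0; apply/eqP => p0; move: h; rewrite p0 mul0r => /eqP.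
  by rewrite eq_sym.
have m0 : (0 < `|denq p|)%N by rewrite absz_gt0 denq_neq0.
move: n0 m0; move: `|numq p|%N `|denq p|%N => a c a0 c0.
move=> e; have {}e : (a * a = 2 * (c * c))%N by rewrite mulnA; exact: e.
move/(congr1 (logn 2)): e; rewrite lognM // (lognM 2 (_ : 0 < 2)%N) //; last first.
  by rewrite muln_gt0 c0.
rewrite (lognM 2 c0 c0) (_ : logn 2 2 = 1%N) //; lia.
Qed.

Definition inK x := exists p q, x = ratr p + ratr q * s2.
Definition conjP x x' := exists p q, x = ratr p + ratr q * s2 /\ x' = ratr p - ratr q * s2.
(** K is only a predicate on R, so conjugation is a functional relation made total by choice.
    Outside K it takes the junk value 0, which is why the laws for sums and products assume
    [inK]. *)
Definition cj x : R := xget 0 [set x' | conjP x x']%classic.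

Lemma ratr_s2_eq0 p q : ratr p + ratr q * s2 = 0 -> p = 0 /\ q = 0.
Proof.
move=> h.
have e : ratr p * ratr p = 2 * (ratr q * ratr q) :> R.
  have -> : ratr p = - (ratr q * s2) by apply/eqP; rewrite -addr_eq0 h.
  by rewrite -s2_sq; ring.
have {e} e : p * p = 2 * (q * q).
  apply: (fmorph_inj (@ratr R)); rewrite !rmorphM e; congr (_ * _).
  by rewrite rmorph_nat.
have [q0|q0] := eqVneq q 0.
  by move: e; rewrite q0 !mulr0 => /eqP; rewrite mulf_eq0 orbb => /eqP.
have := rat_sqr_neq2 (p / q).
by rewrite mulf_div e mulfK ?eqxx // mulf_neq0.
Qed.

Lemma conjP_fun x x' x'' : conjP x x' -> conjP x x'' -> x' = x''.
Proof.
move=> [p [q [-> ->]]] [p' [q' [e ->]]].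
have /ratr_s2_eq0 [/eqP] : ratr (p - p') + ratr (q - q') * s2 = 0.
  by rewrite !rmorphB mulrBl addrACA -opprD e subrr.
by rewrite subr_eq0 => /eqP -> /eqP; rewrite subr_eq0 => /eqP ->.
Qed.

Lemma cjE p q : cj (ratr p + ratr q * s2) = ratr p - ratr q * s2.
Proof.
have h : conjP (ratr p + ratr q * s2) (ratr p - ratr q * s2) by exists p, q.
apply: (conjP_fun _ h); apply: (@xgetPex _ 0); exists (ratr p - ratr q * s2); exact: h.
Qed.

Lemma inK_rat p : inK (ratr p).
Proof. by exists p, 0; rewrite rmorph0 mul0r addr0. Qed.
Lemma cj_rat p : cj (ratr p) = ratr p.
Proof. by have := cjE p 0; rewrite rmorph0 mul0r addr0 subr0. Qed.

Lemma inK_int (n : int) : inK n%:~R.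
Proof. by rewrite -(ratr_int R); apply: inK_rat. Qed.
Lemma cj_int (n : int) : cj n%:~R = n%:~R.
Proof. by rewrite -(ratr_int R) cj_rat. Qed.

Lemma inKD x y : inK x -> inK y -> inK (x + y).
Proof. by move=> [p [q ->]] [p' [q' ->]]; exists (p + p'), (q + q'); rewrite !rmorphD /=; ring. Qed.
Lemma cjD x y : inK x -> inK y -> cj (x + y) = cj x + cj y.
Proof.
move=> [p [q ->]] [p' [q' ->]].
have -> : ratr p + ratr q * s2 + (ratr p' + ratr q' * s2) = ratr (p + p') + ratr (q + q') * s2.
  by rewrite !rmorphD /=; ring.
by rewrite !cjE !rmorphD /=; ring.
Qed.

Let mulE p q p' q' : (ratr p + ratr q * s2) * (ratr p' + ratr q' * s2)
  = ratr (p * p' + 2 * q * q') + ratr (p * q' + q * p') * s2.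
Proof.
rewrite !rmorphD !rmorphM /= rmorph_nat -s2_sq; ring.
Qed.
Lemma inKM x y : inK x -> inK y -> inK (x * y).
Proof. move=> [p [q ->]] [p' [q' ->]]; rewrite mulE; by eexists; eexists. Qed.
Lemma cjM x y : inK x -> inK y -> cj (x * y) = cj x * cj y.
Proof.
move=> [p [q ->]] [p' [q' ->]]; rewrite mulE !cjE.
rewrite !rmorphD !rmorphM /= rmorph_nat -s2_sq; ring.
Qed.

Lemma inKN x : inK x -> inK (- x).
Proof. by move=> h; rewrite -mulN1r; apply: inKM => //; apply: (inK_int (-1)). Qed.
Lemma cjN x : inK x -> cj (- x) = - cj x.
Proof.
by move=> h; rewrite -mulN1r cjM ?(cj_int (-1)) ?mulN1r //; apply: (inK_int (-1)).
Qed.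
Lemma inKB x y : inK x -> inK y -> inK (x - y).
Proof. by move=> hx hy; apply: inKD => //; apply: inKN. Qed.
Lemma cjB x y : inK x -> inK y -> cj (x - y) = cj x - cj y.
Proof. by move=> hx hy; rewrite cjD ?cjN //; apply: inKN. Qed.

Lemma inK0 : inK 0. Proof. exact: (inK_int 0). Qed.
Lemma inK1 : inK 1. Proof. exact: (inK_int 1). Qed.
Lemma cj0 : cj 0 = 0. Proof. exact: (cj_int 0). Qed.
Lemma cj1 : cj 1 = 1. Proof. exact: (cj_int 1). Qed.
Lemma inK_s2 : inK s2. Proof. by exists 0, 1; rewrite rmorph0 rmorph1 add0r mul1r. Qed.
Lemma cj_s2 : cj s2 = - s2.
Proof. by have := cjE 0 1; rewrite rmorph0 rmorph1 !add0r !mul1r. Qed.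

Lemma cj_eq0 x : inK x -> (cj x == 0) = (x == 0).
Proof.
move=> [p [q ->]]; rewrite cjE; apply/eqP/eqP => [h|/ratr_s2_eq0 [-> ->]].
  have /ratr_s2_eq0 [-> /eqP] : ratr p + ratr (- q) * s2 = 0 by rewrite rmorphN mulNr.
  by rewrite oppr_eq0 => /eqP ->; rewrite rmorph0 mul0r addr0.
by rewrite rmorph0 mul0r subr0.
Qed.

(* The norm is a rational number, so the inverse is [cj x] over a rational. *)
Lemma normK_rat x : inK x -> exists p, x * cj x = ratr p.
Proof.
move=> [p [q ->]]; rewrite cjE; exists (p * p - 2 * q * q).
by rewrite !rmorphB !rmorphM /= rmorph_nat -s2_sq; ring.
Qed.
Lemma inK_cj x : inK x -> inK (cj x).
Proof. by move=> [p [q ->]]; rewrite cjE; exists p, (- q); rewrite rmorphN mulNr. Qed.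

Lemma inKV x : inK x -> inK x^-1.
Proof.
move=> hx; have [->|x0] := eqVneq x 0; first by rewrite invr0; apply: inK0.
have [p ep] := normK_rat hx.
have c0 : cj x != 0 by rewrite cj_eq0.
have -> : x^-1 = cj x * ratr p^-1.
  have -> : ratr p^-1 = (ratr p : R)^-1 by exact: fmorphV.
  by rewrite -ep invfM mulrCA divff // mulr1.
by apply: inKM; [apply: inK_cj | apply: inK_rat].
Qed.
Lemma cjV x : inK x -> cj x^-1 = (cj x)^-1.
Proof.
move=> hx; have [->|x0] := eqVneq x 0; first by rewrite invr0 cj0 invr0.
have c0 : cj x != 0 by rewrite cj_eq0.
apply: (mulfI c0); rewrite divff // -cjM //; last exact: inKV.
by rewrite divff // cj1.
Qed.

Lemma inKX x n : inK x -> inK (x ^+ n).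
Proof.
by move=> hx; elim: n => [|n IH]; rewrite ?expr0 ?exprS; [apply: inK1|apply: inKM].
Qed.
Lemma cjX x n : inK x -> cj (x ^+ n) = cj x ^+ n.
Proof.
move=> hx; elim: n => [|n IH]; first by rewrite !expr0 cj1.
by rewrite !exprS cjM ?IH //; apply: inKX.
Qed.
Lemma inKXz x (n : int) : inK x -> inK (x ^ n).
Proof. by move=> hx; case: n => n /=; [|apply: inKV]; apply: inKX. Qed.
Lemma inK_sum I (r : seq I) (P : pred I) (F : I -> R) :
  (forall i, inK (F i)) -> inK (\sum_(i <- r | P i) F i).
Proof. by move=> h; elim/big_ind: _ => //; [apply: inK0|apply: inKD]. Qed.
Lemma inK_prod I (r : seq I) (P : pred I) (F : I -> R) :
  (forall i, inK (F i)) -> inK (\prod_(i <- r | P i) F i).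
Proof. by move=> h; elim/big_ind: _ => //; [apply: inK1|apply: inKM]. Qed.
Lemma cj_sum I (r : seq I) (P : pred I) (F : I -> R) : (forall i, inK (F i)) ->
  cj (\sum_(i <- r | P i) F i) = \sum_(i <- r | P i) cj (F i).
Proof.
move=> h; elim: r => [|i r IH]; first by rewrite !big_nil cj0.
by rewrite !big_cons; case: (P i); rewrite ?cjD ?IH //; apply: inK_sum.
Qed.

(** * Algebraic integers *)

Definition intg x := integralOver (intr : int -> R) x.

Lemma intg_int (n : int) : intg n%:~R. Proof. exact: integral_id. Qed.
Lemma intgD x y : intg x -> intg y -> intg (x + y). Proof. exact: integral_add. Qed.
Lemma intgM x y : intg x -> intg y -> intg (x * y). Proof. exact: integral_mul. Qed.
Lemma intgN x : intg x -> intg (- x). Proof. exact: integral_opp. Qed.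
Lemma intgX x n : intg x -> intg (x ^+ n).
Proof.
move=> h; elim: n => [|n IH]; first by rewrite expr0; apply: (intg_int 1).
by rewrite exprS; apply: intgM.
Qed.
Lemma intg_sum I (r : seq I) (P : pred I) (F : I -> R) :
  (forall i, intg (F i)) -> intg (\sum_(i <- r | P i) F i).
Proof. by move=> h; elim/big_ind: _ => //; [apply: (intg_int 0)|apply: intgD]. Qed.

Lemma intg_root x n : (0 < n)%N -> intg (x ^+ n) -> intg x.
Proof.
move=> n0 h; apply: (@integral_root_monic _ _ _ x ('X^n - (x ^+ n)%:P)).
- exact: monicXnsubC.
- by rewrite rootE !hornerE subrr.
- move=> c /(nthP 0) [i _ <-]; rewrite coefB coefXn coefC; apply: (@integral_sub _ _ intr).
    exact: integral_nat.
  by case: (i == 0%N) => //; apply: (intg_int 0).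
Qed.

Lemma intg_s2 : intg s2.
Proof. by apply: (@intg_root _ 2) => //; rewrite expr2 s2_sq; apply: (intg_int 2). Qed.

(** Rational root theorem: clearing denominators in a monic equation shows that the denominator
    divides a power of the numerator, to which it is coprime. *)
Lemma intg_rat_int p : intg (ratr p) -> exists n : int, ratr p = n%:~R :> R.
Proof.
move=> [f mf]; rewrite rootE => /eqP f0.
have {}f0 : (map_poly intr f).[p] = 0 :> rat.
  apply: (fmorph_inj (@ratr R)); rewrite rmorph0 -horner_map -map_poly_comp.
  rewrite -[RHS]f0; congr (horner _ _); apply: eq_map_poly => i /=; exact: ratr_int.
have sf : (0 < size f)%N by rewrite size_poly_gt0 monic_neq0.
set D := (size f).-1.
have {f0} : \sum_(i < D.+1) f`_i * numq p ^+ i * denq p ^+ (D - i) = 0.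
  apply: (@intr_inj rat); rewrite rmorph0 rmorph_sum /=.
  have d0 : (denq p)%:~R != 0 :> rat by rewrite intr_eq0 denq_neq0.
  transitivity ((denq p)%:~R ^+ D * (map_poly intr f).[p]); last by rewrite f0 mulr0.
  rewrite (@horner_coef_wide _ D.+1); last first.
    by rewrite (leq_trans (size_poly _ _)) // prednK.
  rewrite mulr_sumr; apply: eq_bigr => i _.
  have -> : p ^+ i = (numq p)%:~R ^+ i / (denq p)%:~R ^+ i.
    by rewrite -expr_div_n divq_num_den.
  have -> : (denq p)%:~R ^+ D = (denq p)%:~R ^+ (D - i) * (denq p)%:~R ^+ i :> rat.
    by rewrite -exprD subnK // leq_ord.
  rewrite coef_map !rmorphM !rmorphXn /=; field.
  by rewrite expf_neq0.
rewrite big_ord_recr /= subnn expr0 mulr1 -lead_coefE (monicP mf) mul1r => /eqP.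
rewrite addrC addr_eq0 => /eqP e.
have dv : (denq p %| numq p ^+ D)%Z.
  rewrite e rpredN; apply: rpred_sum => i _; apply: dvdz_mull.
  by rewrite -(subnSK (ltn_ord i)) exprS; apply: dvdz_mulr.
have cop : coprimez (denq p) (numq p ^+ D).
  by rewrite coprimezXr // coprimez_sym /coprimez /gcdz /=; exact: coprime_num_den.
have d1 : denq p = 1.
  move: cop; rewrite /coprimez; move/gcdz_idPl: dv => ->.
  by rewrite gtz0_abs ?denq_gt0 // => /eqP.
exists (numq p); rewrite -{1}(divq_num_den p) d1 divr1; exact: ratr_int.
Qed.

Lemma intg_cj x : inK x -> intg x -> intg (cj x).
Proof.
move=> hx [f mf]; rewrite rootE => /eqP f0; exists f => //; rewrite rootE.
have -> : (map_poly intr f).[cj x] = cj (map_poly intr f).[x].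
  rewrite !horner_coef cj_sum; last by move=> i; apply: inKM; rewrite ?coef_map; [apply: inK_int|apply: inKX].
  apply: eq_bigr => i _; rewrite coef_map cjM ?cjX ?cj_int //; [exact: inK_int|exact: inKX].
by rewrite f0 cj0.
Qed.

(** The norm is rational and integral, hence a nonzero integer. Every arithmetic lower bound in the
    transcendence argument comes from here: in the dichotomy for vanishing sums and in the final
    comparison of roots. *)
Lemma intg_norm_ge1 x : inK x -> intg x -> x != 0 -> 1 <= `|x| * `|cj x|.
Proof.
move=> hx ix x0; have [p ep] := normK_rat hx.
have [n en] : exists n : int, ratr p = n%:~R :> R.
  by apply: intg_rat_int; rewrite -ep; apply: intgM => //; apply: intg_cj.
rewrite -normrM ep en -intr_norm; have : n%:~R != 0 :> R by rewrite -en -ep mulf_neq0 ?cj_eq0.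
rewrite intr_eq0 => n0; rewrite (ler_int R 1); lia.
Qed.

End QSqrt2.

(** * Towers of square roots *)

Section Tower.
Variable R : rcfType.
Implicit Types (v rt rho : nat -> R) (eps : nat -> bool) (chi : nat -> bool).

(* An element [(a, b)] of [T r.+1] stands for a + b sqrt(v r); [tev] evaluates it, with [rt i] in place
   of sqrt(v i). *)
Fixpoint T (r : nat) : zmodType :=
  if r is r'.+1 then (T r' * T r')%type : zmodType else (R : zmodType).

Fixpoint tscale (r : nat) (c : R) : T r -> T r :=
  if r is r'.+1 then fun x => (tscale c x.1, tscale c x.2) else fun x => c * x.

Fixpoint tmul v (r : nat) : T r -> T r -> T r :=
  if r is r'.+1 then fun x y =>
    (tmul v x.1 y.1 + tscale (v r') (tmul v x.2 y.2), tmul v x.1 y.2 + tmul v x.2 y.1)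
  else fun x y => x * y.

(** The relative norm of one quadratic step, that is, the product of a + b sqrt(v r) and a - b
    sqrt(v r). *)
Definition tnorm1 v r (x : T r.+1) : T r :=
  tmul v x.1 x.1 - tscale (v r) (tmul v x.2 x.2).

Fixpoint tnorm v (r : nat) : T r -> R :=
  if r is r'.+1 then fun x => tnorm v (tnorm1 v x) else fun x => x.

Fixpoint tev rt (r : nat) : T r -> R :=
  if r is r'.+1 then fun x => tev rt x.1 + tev rt x.2 * rt r' else fun x => x.

Fixpoint tK (r : nat) : T r -> Prop :=
  if r is r'.+1 then fun x => tK x.1 /\ tK x.2 else fun x => inK x.

Fixpoint tcj (r : nat) : T r -> T r :=
  if r is r'.+1 then fun x => (tcj x.1, tcj x.2) else fun x => cj x.

(** A majorant of the modulus for every choice of square roots of modulus rho i. The conjugate of a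
    positive v i may be negative and have no real root; bounding norms by this majorant avoids
    complex numbers. *)
Fixpoint tsize rho (r : nat) : T r -> R :=
  if r is r'.+1 then fun x => tsize rho x.1 + tsize rho x.2 * rho r' else fun x => `|x|.

Fixpoint tmono (r : nat) eps (c : R) : T r :=
  if r is r'.+1 then (if eps r' then (0, tmono r' eps c) else (tmono r' eps c, 0)) else c.

(** The coefficient of the empty product of square roots, that is, the component in the trivial
    square class. *)
Fixpoint tleaf0 (r : nat) : T r -> R :=
  if r is r'.+1 then fun x => tleaf0 x.1 else fun x => x.

Lemma tevD rt r (x y : T r) : tev rt (x + y) = tev rt x + tev rt y.
Proof. by elim: r x y => [//|r IH] [a b] [c d] /=; rewrite !IH; ring. Qed.
Lemma tev0 rt r : tev rt (0 : T r) = 0.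
Proof. by elim: r => [//|r IH] /=; rewrite IH mul0r addr0. Qed.
Lemma tevN rt r (x : T r) : tev rt (- x) = - tev rt x.
Proof. by elim: r x => [//|r IH] [a b] /=; rewrite !IH; ring. Qed.
Lemma tev_sum rt r I (s : seq I) (P : pred I) (F : I -> T r) :
  tev rt (\sum_(i <- s | P i) F i) = \sum_(i <- s | P i) tev rt (F i).
Proof. by apply: big_morph; [apply: tevD|apply: tev0]. Qed.
Lemma tev_scale rt r c (x : T r) : tev rt (tscale c x) = c * tev rt x.
Proof. by elim: r x => [//|r IH] [a b] /=; rewrite !IH; ring. Qed.
Lemma tev_mul v rt r (x y : T r) : (forall i, (i < r)%N -> rt i * rt i = v i) ->
  tev rt (tmul v x y) = tev rt x * tev rt y.
Proof.
elim: r x y => [//|r IH] [a b] [c d] h /=.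
have h' i : (i < r)%N -> rt i * rt i = v i by move=> ir; apply: h; apply: ltnW.
rewrite !tevD tev_scale !IH // -(h r) //; ring.
Qed.

Lemma tev_ext rt rt' r (x : T r) : (forall i, (i < r)%N -> rt i = rt' i) -> tev rt x = tev rt' x.
Proof.
elim: r x => [//|r IH] [a b] h /=.
by rewrite (h r) // !IH // => i ir; apply: h; apply: ltnW.
Qed.

Lemma tKD r (x y : T r) : tK x -> tK y -> tK (x + y).
Proof.
elim: r x y => [|r IH] /= x y; first exact: inKD.
by move=> [? ?] [? ?]; split; apply: IH.
Qed.
Lemma tK0 r : tK (0 : T r).
Proof. by elim: r => [|r IH] /=; [apply: inK0|split]. Qed.
Lemma tKN r (x : T r) : tK x -> tK (- x).
Proof.
elim: r x => [|r IH] /= x; first exact: inKN.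
by move=> [? ?]; split; apply: IH.
Qed.
Lemma tK_sum r I (s : seq I) (P : pred I) (F : I -> T r) :
  (forall i, tK (F i)) -> tK (\sum_(i <- s | P i) F i).
Proof. by move=> h; elim/big_ind: _ => //; [apply: tK0|apply: tKD]. Qed.
Lemma tK_scale r c (x : T r) : inK c -> tK x -> tK (tscale c x).
Proof.
move=> hc; elim: r x => [|r IH] /= x; first exact: inKM.
by move=> [? ?]; split; apply: IH.
Qed.
Lemma tK_mul v r (x y : T r) : (forall i, inK (v i)) -> tK x -> tK y -> tK (tmul v x y).
Proof.
move=> hv; elim: r x y => [|r IH] /= x y; first exact: inKM.
by move=> [? ?] [? ?]; split; apply: tKD; try apply: tK_scale; auto.
Qed.
Lemma tK_mono r eps c : inK c -> tK (tmono r eps c).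
Proof. by move=> hc; elim: r => [//|r IH] /=; case: (eps r) => /=; split=> //; apply: tK0. Qed.
Lemma tK_norm1 v r (x : T r.+1) : (forall i, inK (v i)) -> tK x -> tK (tnorm1 v x).
Proof.
move=> hv [h1 h2]; apply: tKD; first exact: tK_mul.
by apply: tKN; apply: tK_scale => //; apply: tK_mul.
Qed.
Lemma tK_norm v r (x : T r) : (forall i, inK (v i)) -> tK x -> inK (tnorm v x).
Proof. by move=> hv; elim: r x => [//|r IH] x hx /=; apply/IH/tK_norm1. Qed.

Lemma tcjD r (x y : T r) : tK x -> tK y -> tcj (x + y) = tcj x + tcj y.
Proof.
elim: r x y => [|r IH] /= x y; first exact: cjD.
by move=> [? ?] [? ?]; rewrite !IH.
Qed.
Lemma tcj0 r : tcj (0 : T r) = 0.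
Proof. by elim: r => [|r IH] /=; rewrite ?cj0 ?IH. Qed.
Lemma tcjN r (x : T r) : tK x -> tcj (- x) = - tcj x.
Proof.
elim: r x => [|r IH] /= x; first exact: cjN.
by move=> [? ?]; rewrite !IH.
Qed.
Lemma tcj_sum r I (s : seq I) (P : pred I) (F : I -> T r) : (forall i, tK (F i)) ->
  tcj (\sum_(i <- s | P i) F i) = \sum_(i <- s | P i) tcj (F i).
Proof.
move=> h; elim: s => [|i s IH]; first by rewrite !big_nil tcj0.
by rewrite !big_cons; case: (P i); rewrite ?tcjD ?IH //; apply: tK_sum.
Qed.
Lemma tcj_scale r c (x : T r) : inK c -> tK x -> tcj (tscale c x) = tscale (cj c) (tcj x).
Proof.
move=> hc; elim: r x => [|r IH] /= x; first exact: cjM.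
by move=> [? ?]; rewrite !IH.
Qed.
Lemma tcj_mul v r (x y : T r) : (forall i, inK (v i)) -> tK x -> tK y ->
  tcj (tmul v x y) = tmul (fun i => cj (v i)) (tcj x) (tcj y).
Proof.
move=> hv; elim: r x y => [|r IH] /= x y; first exact: cjM.
move=> [? ?] [? ?]; have hm := tK_mul hv.
by rewrite !tcjD ?tcj_scale ?IH //; try apply: tK_scale; auto.
Qed.
Lemma cj_tnorm v r (x : T r) : (forall i, inK (v i)) -> tK x ->
  cj (tnorm v x) = tnorm (fun i => cj (v i)) (tcj x).
Proof.
move=> hv; elim: r x => [//|r IH] x hx /=; rewrite IH; last exact: tK_norm1.
move: hx => [h1 h2]; congr tnorm; rewrite /tnorm1 /=.
have hm := tK_mul hv.
rewrite tcjD ?tcjN ?tcj_scale ?tcj_mul //; auto; try apply: tKN; try apply: tK_scale; auto.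
Qed.
Lemma tcj_mono r eps c : tcj (tmono r eps c) = tmono r eps (cj c).
Proof. by elim: r => [//|r IH] /=; case: (eps r); rewrite /= IH tcj0. Qed.

(** * Upper bounds for norms in the tower *)

Section Size.
Variable rho : nat -> R.
Hypothesis rho_ge0 : forall i, 0 <= rho i.

Lemma tsize_ge0 r (x : T r) : 0 <= tsize rho x.
Proof.
elim: r x => [|r IH] x /=; first exact: normr_ge0.
by apply: addr_ge0 => //; apply: mulr_ge0.
Qed.
Lemma tsizeD r (x y : T r) : tsize rho (x + y) <= tsize rho x + tsize rho y.
Proof.
elim: r x y => [|r IH] x y /=; first exact: ler_normD.
rewrite addrACA -mulrDl lerD // ?IH //.
by apply: ler_wpM2r.
Qed.
Lemma tsize0 r : tsize rho (0 : T r) = 0.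
Proof. by elim: r => [|r IH] /=; rewrite ?normr0 // IH mul0r addr0. Qed.
Lemma tsizeN r (x : T r) : tsize rho (- x) = tsize rho x.
Proof. by elim: r x => [|r IH] x /=; rewrite ?normrN // !IH. Qed.
Lemma tsize_sum r I (s : seq I) (P : pred I) (F : I -> T r) :
  tsize rho (\sum_(i <- s | P i) F i) <= \sum_(i <- s | P i) tsize rho (F i).
Proof.
elim: s => [|i s IH]; first by rewrite !big_nil tsize0.
by rewrite !big_cons; case: (P i) => //; apply: (le_trans (tsizeD _ _)); rewrite lerD2l.
Qed.
Lemma tsize_scale r c (x : T r) : tsize rho (tscale c x) = `|c| * tsize rho x.
Proof. by elim: r x => [|r IH] x /=; rewrite ?normrM // !IH mulrDr mulrA. Qed.

Lemma tsize_mono r eps c :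
  tsize rho (tmono r eps c) = `|c| * \prod_(i < r) (if eps i then rho i else 1).
Proof.
elim: r => [|r IH] /=; first by rewrite big_ord0 mulr1.
by rewrite big_ord_recr /=; case: (eps r); rewrite /= IH tsize0 ?add0r ?mul0r ?addr0 ?mulr1 ?mulrA.
Qed.

Variable v : nat -> R.
Hypothesis vrho : forall i, `|v i| <= rho i * rho i.

Lemma tsizeM r (x y : T r) : tsize rho (tmul v x y) <= tsize rho x * tsize rho y.
Proof.
elim: r x y => [|r IH] x y /=; first by rewrite normrM.
have g := @tsize_ge0 r.
have h1 : tsize rho (tmul v x.1 y.1 + tscale (v r) (tmul v x.2 y.2)) <=
  tsize rho x.1 * tsize rho y.1 + rho r * rho r * (tsize rho x.2 * tsize rho y.2).
  apply: (le_trans (tsizeD _ _)); rewrite tsize_scale lerD //.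
  by apply: ler_pM.
have h2 : tsize rho (tmul v x.1 y.2 + tmul v x.2 y.1) <=
  tsize rho x.1 * tsize rho y.2 + tsize rho x.2 * tsize rho y.1.
  by apply: (le_trans (tsizeD _ _)); rewrite lerD.
apply: le_trans (_ : _ <= (tsize rho x.1 * tsize rho y.1 + rho r * rho r * (tsize rho x.2 * tsize rho y.2))
  + (tsize rho x.1 * tsize rho y.2 + tsize rho x.2 * tsize rho y.1) * rho r) _.
  by rewrite lerD // ler_wpM2r.
by rewrite le_eqVlt; apply/orP; left; apply/eqP; ring.
Qed.

Lemma tsize_norm1 r (x : T r.+1) : tsize rho (tnorm1 v x) <= tsize rho x ^+ 2.
Proof.
have g := @tsize_ge0 r.
apply: (le_trans (tsizeD _ _)); rewrite tsizeN tsize_scale.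
have h1 := tsizeM x.1 x.1; have h2 := tsizeM x.2 x.2.
apply: le_trans (_ : _ <= tsize rho x.1 * tsize rho x.1 + rho r * rho r * (tsize rho x.2 * tsize rho x.2)) _.
  by rewrite lerD // ler_pM.
rewrite /= expr2 mulrDl !mulrDr -!addrA lerD2l.
have := mulr_ge0 (mulr_ge0 (g x.1) (g x.2)) (rho_ge0 r).
set a := tsize rho x.1; set b := tsize rho x.2; nra.
Qed.

Lemma norm_tnorm_le r (x : T r) : `|tnorm v x| <= tsize rho x ^+ (2 ^ r).
Proof.
elim: r x => [|r IH] x /=; first by rewrite expr1.
apply: (le_trans (IH _)); rewrite expnS exprM lerXn2r ?nnegrE ?exprn_ge0 ?tsize_ge0 //.
  by rewrite addr_ge0 ?mulr_ge0 ?tsize_ge0.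
exact: tsize_norm1.
Qed.
End Size.

Definition signed rt chi : nat -> R := fun i => if chi i then - rt i else rt i.

Lemma tev_mono rt r eps c :
  tev rt (tmono r eps c) = c * \prod_(i < r) (if eps i then rt i else 1).
Proof.
elim: r => [|r IH] /=; first by rewrite big_ord0 mulr1.
by rewrite big_ord_recr /=; case: (eps r); rewrite /= IH tev0 ?add0r ?mul0r ?addr0 ?mulr1 ?mulrA.
Qed.

Lemma tleaf0D r (x y : T r) : tleaf0 (x + y) = tleaf0 x + tleaf0 y.
Proof. by elim: r x y => [//|r IH] x y /=; rewrite IH. Qed.
Lemma tleaf00 r : tleaf0 (0 : T r) = 0.
Proof. by elim: r. Qed.
Lemma tleaf0_sum r I (s : seq I) (P : pred I) (F : I -> T r) :
  tleaf0 (\sum_(i <- s | P i) F i) = \sum_(i <- s | P i) tleaf0 (F i).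
Proof. by apply: big_morph; [apply: tleaf0D|apply: tleaf00]. Qed.
Lemma tleaf0_mono r eps c :
  tleaf0 (tmono r eps c) = if [exists i : 'I_r, eps i] then 0 else c.
Proof.
elim: r => [|r IH] /=.
  by rewrite (_ : [exists i : 'I_0, eps i] = false) //; apply/existsP => -[[]].
have -> : [exists i : 'I_r.+1, eps i] = eps r || [exists i : 'I_r, eps i].
  apply/existsP/orP => [[i]|[h|/existsP [i h]]].
  - have [e|n] := eqVneq (i : nat) r; first by rewrite e; left.
    have ir : (i < r)%N by have := ltn_ord i; rewrite ltnS leq_eqVlt (negPf n).
    by move=> h; right; apply/existsP; exists (Ordinal ir).
  - by exists ord_max.
  - by exists (widen_ord (leqnSn r) i).
by case: (eps r) => /=; rewrite ?tleaf00 ?IH.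
Qed.

(** The norm is the product of the values over all 2^r sign choices of the roots: the true signs
    contribute xi, the other 2^r - 1 at most Z each. The common factor [th] will be the real power
    y(s0)^x, which turns these values into algebraic integers. *)
Lemma tnorm_sign v rt r (x : T r) (th Z xi : R) :
  (forall i, (i < r)%N -> rt i * rt i = v i) ->
  (forall chi, intg (th * tev (signed rt chi) x)) ->
  (forall chi, `|th * tev (signed rt chi) x| <= Z) -> `|th * tev rt x| <= xi ->
  intg (th ^+ (2 ^ r) * tnorm v x) /\ `|th ^+ (2 ^ r) * tnorm v x| <= xi * Z ^+ (2 ^ r).-1.
Proof.
elim: r x th Z xi => [|r IH] x th Z xi hrt hi hZ hxi /=.
  by rewrite expr1 mulr1; split=> //; have := hi (fun=> false).
have Z0 : 0 <= Z by apply: le_trans (hZ (fun=> false)).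
have hrt' i : (i < r)%N -> rt i * rt i = v i by move=> ir; apply: hrt; apply: ltnW.
(* [flip] overrides the sign of the top root only; the relative norm of x is the product of the two
   values so obtained, and lower levels do not see the change. *)
pose flip chi b : nat -> bool := fun i => if i == r then b else chi i.
have evf chi b (w : T r) : tev (signed rt (flip chi b)) w = tev (signed rt chi) w.
  apply: tev_ext => i ir; rewrite /signed /flip; case: eqP => // e.
  by move: ir; rewrite e ltnn.
have ev1 chi : th ^+ 2 * tev (signed rt chi) (tnorm1 v x) =
   (th * tev (signed rt (flip chi false)) x) * (th * tev (signed rt (flip chi true)) x).
  rewrite /tnorm1 tevD tevN tev_scale !(@tev_mul v); last first.
  - by move=> i ir; rewrite /signed; case: (chi i); rewrite ?mulrNN hrt'.
  - by move=> i ir; rewrite /signed; case: (chi i); rewrite ?mulrNN hrt'.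
  by rewrite /= !evf /signed /flip eqxx -(hrt r) //; ring.
have ev2 : th ^+ 2 * tev rt (tnorm1 v x) =
   (th * tev rt x) * (th * tev (signed rt (flip (fun=> false) true)) x).
  have := ev1 (fun=> false).
  rewrite (@tev_ext (signed rt (flip (fun=> false) false)) rt); last first.
    by move=> i _; rewrite /signed /flip; case: eqP.
  by move=> <-.
have [] := IH (tnorm1 v x) (th ^+ 2) (Z ^+ 2) (xi * Z) hrt'.
- by move=> chi; rewrite ev1; apply: intgM.
- by move=> chi; rewrite ev1 normrM expr2 ler_pM.
- by rewrite ev2 normrM ler_pM.
rewrite -exprM -expnS => h1 h2; split=> //; apply: (le_trans h2).
rewrite -exprM -mulrA -exprS; have := expn_gt0 2 r; rewrite expnS => p2.
by rewrite (_ : (2 * (2 ^ r).-1).+1 = (2 * 2 ^ r).-1)%N //; lia.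
Qed.

(** * Square classes of K and linear independence of square roots *)

Definition sqK (w : R) := exists2 k, inK k & k * k = w.

(** Independence of the classes of the v i in the vector space of K* modulo squares over the field
    with two elements. *)
Definition indep v r := forall eps, [exists i : 'I_r, eps i] ->
  ~ sqK (\prod_(i < r) (if eps i then v i else 1)).

Section Kummer.
Variables (v rt : nat -> R).
Hypothesis vK : forall i, inK (v i).

Lemma indep_recl r : indep v r.+1 -> indep v r.
Proof.
move=> h eps /existsP [i ei]; pose eps' j := if j == r then false else eps j.
have := h eps'; rewrite big_ord_recr /= /eps' eqxx mulr1.
under eq_bigr => j _ do rewrite (ltn_eqF (ltn_ord j)).
apply; apply/existsP; exists (widen_ord (leqnSn r) i) => /=.
by rewrite (ltn_eqF (ltn_ord i)).
Qed.

(* Kummer theory for square roots; the three statements are proved by a common induction, each step of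
   linear independence using inverses and square classes one level below. *)
Lemma kummer r : (forall i, (i < r)%N -> rt i * rt i = v i /\ rt i != 0) -> indep v r ->
  [/\ forall x : T r, tK x -> tev rt x = 0 -> x = 0,
      forall x : T r, tK x -> tev rt x != 0 -> exists2 y : T r, tK y & tev rt x * tev rt y = 1 &
      forall (x : T r) w, tK x -> inK w -> tev rt x * tev rt x = w ->
        exists eps, sqK (w * \prod_(i < r) (if eps i then v i else 1))].
Proof.
elim: r => [|r IH] hrt hi.
  split=> [//|x hx x0|x w hx hw e] /=.
  - by exists x^-1; [apply: inKV|rewrite divff].
  - by exists (fun=> false); rewrite big_ord0 mulr1; exists x.
have hrt' i : (i < r)%N -> rt i * rt i = v i /\ rt i != 0 by move=> ir; apply: hrt; apply: ltnW.
have hm : forall i, (i < r)%N -> rt i * rt i = v i by move=> i ir; case: (hrt' _ ir).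
have [LI INV SQ] := IH hrt' (indep_recl hi).
have [hr hr0] := hrt r (ltnSn r).
have LI' (x : T r.+1) : tK x -> tev rt x = 0 -> x = 0.
  case: x => a b [/= ha hb] e; have [b0|b0] := eqVneq (tev rt b) 0.
    by move: e; rewrite b0 mul0r addr0 => /(LI _ ha) ->; rewrite (LI _ hb b0).
  (* If b is not 0, then a / b squares to v r. By the square classes of the level below, v r is a
     product of the other v i up to a square, against independence. *)
  have [c hc ec] := INV _ hb b0.
  have e2 : tev rt (tmul v a c) * tev rt (tmul v a c) = v r.
    rewrite tev_mul // -hr.
    have -> : tev rt a = - (tev rt b * rt r) by apply/eqP; rewrite -addr_eq0 e.
    transitivity ((tev rt b * tev rt c) ^+ 2 * (rt r * rt r)); first by ring.
    by rewrite ec expr1n mul1r.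
  have [eps heps] := SQ _ _ (tK_mul vK ha hc) (vK r) e2.
  pose eps' j := if j == r then true else eps j.
  exfalso; apply: (hi eps'); first by apply/existsP; exists ord_max; rewrite /= /eps' eqxx.
  rewrite big_ord_recr /= /eps' eqxx mulrC.
  by under eq_bigr => j _ do rewrite (ltn_eqF (ltn_ord j)).
split=> //.
- move=> [a b] [ha hb] x0.
  have hn : tK (tnorm1 v ((a, b) : T r.+1)) by apply: tK_norm1.
  have en : tev rt (tnorm1 v ((a, b) : T r.+1)) =
      tev rt ((a, b) : T r.+1) * tev rt ((a, - b) : T r.+1).
    by rewrite /tnorm1 tevD tevN tev_scale !tev_mul //= tevN -hr; ring.
  have [|c hc ec] := INV _ hn.
    rewrite en mulf_neq0 //; apply/eqP => e0.
    have [a0 /eqP] := LI' ((a, - b) : T r.+1) (conj ha (tKN hb)) e0.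
    by rewrite oppr_eq0 => /eqP b0; move: x0; rewrite /= a0 b0 !tev0 mul0r addr0 eqxx.
  exists (tmul v a c, - tmul v b c).
    by split; [|apply: tKN]; apply: tK_mul.
  by rewrite -ec en /= !tevN !tev_mul //; ring.
(* When the square lies in K, linear independence kills the cross term 2ab, so the root is a or b
   sqrt(v r) and the level below gives the class. *)
- move=> [a b] w [ha hb] hw e.
  pose W : T r := tmono r (fun=> false) w.
  have eW : tev rt W = w by rewrite tev_mono big1_eq mulr1.
  have hx : tK ((tmul v a a + tscale (v r) (tmul v b b) - W, tmul v a b + tmul v a b) : T r.+1).
    split; repeat (apply: tKD || apply: tKN || apply: tK_scale || apply: tK_mul) => //.
    exact: tK_mono.
  have /(LI' _ hx) : tev rt ((tmul v a a + tscale (v r) (tmul v b b) - W, tmul v a b + tmul v a b) : T r.+1) = 0.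
    rewrite /= !tevD tevN tev_scale !tev_mul // eW -e /= -hr; ring.
  move=> [_ /(congr1 (fun y : T r => tev rt y))]; rewrite tevD tev0 tev_mul // -mulr2n => /eqP.
  rewrite mulrn_eq0 mulf_eq0 /= => /orP [/eqP a0|/eqP b0].
  + have [|eps heps] := SQ (tscale (v r) b) (w * v r) (tK_scale (vK r) hb) (inKM hw (vK r)).
      by rewrite tev_scale -e /= a0 add0r -hr; ring.
    exists (fun j => if j == r then true else eps j).
    rewrite big_ord_recr /= eqxx; under eq_bigr => j _ do rewrite (ltn_eqF (ltn_ord j)).
    by rewrite [X in w * X]mulrC mulrA.
  + have [|eps heps] := SQ a w ha hw; first by rewrite -e /= b0 mul0r addr0.
    exists (fun j => if j == r then false else eps j).
    rewrite big_ord_recr /= eqxx; under eq_bigr => j _ do rewrite (ltn_eqF (ltn_ord j)).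
    by rewrite mulr1.
Qed.

(** A relative norm could vanish only if a - b sqrt(v r) did; linear independence would then give a
    = b = 0. *)
Lemma tnorm_neq0 r (x : T r) : (forall i, (i < r)%N -> rt i * rt i = v i /\ rt i != 0) ->
  indep v r -> tK x -> tev rt x != 0 -> tnorm v x != 0.
Proof.
elim: r x => [//|r IH] [a b] hrt hi [ha hb] x0 /=.
have [LI _ _] := kummer hrt hi.
have hrt' i : (i < r)%N -> rt i * rt i = v i /\ rt i != 0 by move=> ir; apply: hrt; apply: ltnW.
have hm : forall i, (i < r)%N -> rt i * rt i = v i by move=> i ir; case: (hrt' _ ir).
have [hr _] := hrt r (ltnSn r).
apply: IH => //; [exact: indep_recl|exact: tK_norm1|].
have -> : tev rt (tnorm1 v ((a, b) : T r.+1)) =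
      tev rt ((a, b) : T r.+1) * tev rt ((a, - b) : T r.+1).
  by rewrite /tnorm1 tevD tevN tev_scale !tev_mul //= tevN -hr; ring.
rewrite mulf_neq0 //; apply/eqP => e0.
have [a0 /eqP] := LI ((a, - b) : T r.+1) (conj ha (tKN hb)) e0.
by rewrite oppr_eq0 => /eqP b0; move: x0; rewrite /= a0 b0 !tev0 mul0r addr0 eqxx.
Qed.
End Kummer.
End Tower.

(** * Hermite interpolation *)

Section L1Norm.
Variable R : realFieldType.
Implicit Types p q : {poly R}.

Definition nrm p := \sum_(i < size p) `|p`_i|.

Lemma nrm_wide p n : (size p <= n)%N -> nrm p = \sum_(i < n) `|p`_i|.
Proof.
move=> h; rewrite /nrm (big_ord_widen _ (fun i => `|p`_i|) h) big_mkcond.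
by apply: eq_bigr => i _; case: ltnP => // hi; rewrite nth_default // normr0.
Qed.

Lemma nrm_ge0 p : 0 <= nrm p.
Proof. by apply: sumr_ge0. Qed.
Lemma nrmD p q : nrm (p + q) <= nrm p + nrm q.
Proof.
pose n := maxn (size p) (size q).
rewrite (@nrm_wide (p + q) n) ?size_polyD // (@nrm_wide p n) ?leq_maxl // (@nrm_wide q n) ?leq_maxr //.
by rewrite -big_split /=; apply: ler_sum => i _; rewrite coefD ler_normD.
Qed.
Lemma nrmZ c p : nrm (c *: p) = `|c| * nrm p.
Proof.
rewrite (@nrm_wide _ (size p)) ?size_scale_leq // /nrm mulr_sumr.
by apply: eq_bigr => i _; rewrite coefZ normrM.
Qed.
Lemma nrm_cons p c : nrm (p * 'X + c%:P) = nrm p + `|c|.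
Proof.
rewrite (@nrm_wide _ (size p).+1); last first.
  apply: (leq_trans (size_polyD _ _)); rewrite geq_max (leq_trans (size_polyMleq _ _)); last by rewrite size_polyX addn2.
  by rewrite size_polyC; case: (c == 0).
rewrite big_ord_recl /= coefD coefMX coefC /= add0r addrC; congr (_ + _).
by apply: eq_bigr => i _; rewrite coefD coefMX coefC /= addr0.
Qed.
Lemma nrm0 : nrm 0 = 0.
Proof. by rewrite /nrm size_poly0 big_ord0. Qed.
Lemma nrmMX p : nrm (p * 'X) = nrm p.
Proof. by have := nrm_cons p 0; rewrite polyC0 addr0 normr0 addr0. Qed.
Lemma nrmM p q : nrm (p * q) <= nrm p * nrm q.
Proof.
elim/poly_ind: p => [|p c IH]; first by rewrite mul0r nrm0 mul0r.
rewrite nrm_cons !mulrDl -mulrA [_ * q]mulrC mulrA mul_polyC.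
by apply: (le_trans (nrmD _ _)); rewrite nrmMX nrmZ lerD2r.
Qed.
Lemma nrm1 : nrm 1 = 1.
Proof. by rewrite /nrm size_poly1 big_ord1 coef1 normr1. Qed.
Lemma nrmX p (C : R) n : nrm p <= C -> nrm (p ^+ n) <= C ^+ n.
Proof.
move=> h; elim: n => [|n IH]; first by rewrite !expr0 nrm1.
by rewrite !exprS; apply: (le_trans (nrmM _ _)); rewrite ler_pM // nrm_ge0.
Qed.
Lemma nrm_take n p : nrm (take_poly n p) <= nrm p.
Proof.
rewrite (@nrm_wide (take_poly n p) (size p)); last first.
  apply/leq_sizeP => j hj; rewrite coef_take_poly; case: (j < n)%N => //.
  by rewrite nth_default.
by apply: ler_sum => i _; rewrite coef_take_poly; case: (i < n)%N; rewrite ?normr0.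
Qed.
Lemma nrm_poly n (E : nat -> R) (C : R) : (forall i, (i < n)%N -> `|E i| <= C) ->
  nrm (\poly_(i < n) E i) <= n%:R * C.
Proof.
move=> h; rewrite (@nrm_wide _ n) ?size_poly //.
rewrite -[n in n%:R]card_ord -sum1_card natr_sum mulr_suml; apply: ler_sum => i _.
by rewrite coef_poly ltn_ord mul1r h.
Qed.
Lemma horner_nrm p n (x M : R) : (size p <= n)%N -> 1 <= M -> `|x| <= M ->
  `|p.[x]| <= nrm p * M ^+ n.
Proof.
move=> sp M1 xM; rewrite horner_coef (nrm_wide (leqnn _)) mulr_suml.
apply: (le_trans (ler_norm_sum _ _ _)); apply: ler_sum => i _.
rewrite normrM normrX ler_wpM2l // (@le_trans _ _ (M ^+ i)) //.
  by rewrite lerXn2r // nnegrE // (le_trans ler01).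
by rewrite ler_weXn2l // ltnW // (leq_trans (ltn_ord i)).
Qed.

End L1Norm.

(** * The Hermite interpolation polynomial at the nodes 0, ..., n - 1 *)

Section HermitePoly.
Variable R : realFieldType.
Variables (n t : nat) (a : nat -> nat -> R) (eta : R).
Hypothesis n_gt0 : (0 < n)%N.
Hypothesis t_gt0 : (0 < t)%N.
Hypothesis eta_ge0 : 0 <= eta.
Hypothesis a_le : forall i j, (i < n)%N -> (j < t)%N -> `|a i j| <= eta.

Definition om (i : 'I_n) : {poly R} := \prod_(j < n | j != i) ('X - j%:R%:P) ^+ t.

(* The inverse of X + c modulo X^t. *)
Definition xinv (c : R) : {poly R} := \poly_(m < t) ((-1) ^+ m * c ^- m.+1).

Lemma xinvP (c : R) : c != 0 -> exists q, ('X + c%:P) * xinv c = 1 + 'X^t * q.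
Proof.
move=> c0; exists (((-1) ^+ t.-1 * c ^- t)%:P); apply/polyP => k.
rewrite mulrDl coefD coefXM coefCM !coef_poly coefD coef1 coefMC coefXn.
have ->: (if k == 0 then 0 else if (k.-1 < t)%N then (-1) ^+ k.-1 * c ^- k.-1.+1 else 0)
  = (if k == 0%N then 0 else if (k.-1 < t)%N then (-1) ^+ k.-1 * c ^- k else 0).
  by case: k.
have [->|k0] := eqVneq k 0%N.
  rewrite t_gt0 expr0 mul1r expr1 divff // add0r eq_sym (gtn_eqF t_gt0) mul0r addr0 //.
case: k k0 => // k _ /=; rewrite add0r.
have [kt|kt] := ltnP k t.
  have [e|ne] := eqVneq k.+1 t.
    by rewrite -e ltnn mulr0 addr0 mul1r.
  have -> : (k.+1 < t)%N by rewrite ltn_neqAle ne.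
  have -> : c * ((-1) ^+ k.+1 / c ^+ k.+2) = - ((-1) ^+ k / c ^+ k.+1).
    have c1 : c ^+ k != 0 by rewrite expf_neq0.
    by rewrite !exprS; field; rewrite c0 c1.
  by rewrite mul0r subrr.
rewrite add0r ltnNge (leqW kt) mulr0 (_ : (k.+1 == t) = false) ?mul0r //.
by apply/eqP => e; move: kt; rewrite -e ltnn.
Qed.

(** Distinct integer nodes are at distance at least 1, so all coefficients c^(-m-1) of the geometric
    series are at most 1 in modulus. *)
Lemma nrm_xinv (c : R) : 1 <= `|c| -> nrm (xinv c) <= t%:R.
Proof.
move=> c1; rewrite -[t%:R]mulr1; apply: nrm_poly => i _.
rewrite normrM normrX normrN1 expr1n mul1r normrV ?unitfE; last first.
  by rewrite expf_neq0 // -normr_gt0 (lt_le_trans ltr01).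
rewrite normrX invf_le1; first by rewrite exprn_ege1.
by rewrite exprn_gt0 // (lt_le_trans ltr01).
Qed.

Definition tay (i : nat) : {poly R} := \poly_(j < t) (a i j / j`!%:R).
Definition vinv (i : 'I_n) : {poly R} := \prod_(j < n | j != i) xinv (i%:R - j%:R) ^+ t.
Definition rr (i : 'I_n) := take_poly t (tay i * vinv i).
(** In the variable X - i, [rr i] is the Taylor polynomial of the data at node i divided by [om i].
    The i-th summand thus has the prescribed derivatives at node i and vanishes to order t at the
    other nodes. *)
Definition hpoly : {poly R} := \sum_(i < n) om i * (rr i \Po ('X - i%:R%:P)).

Lemma dist1 (i j : 'I_n) : j != i -> 1 <= `|i%:R - j%:R : R|.
Proof.
move=> ji; rewrite -[i%:R]/((i%:Z)%:~R) -[j%:R]/((j%:Z)%:~R) -intrB -intr_norm (ler_int R 1).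
have : (i : nat) != j by rewrite eq_sym; exact: ji.
lia.
Qed.

Lemma one_mod_prod I (s : seq I) (P : pred I) (F G : I -> {poly R}) :
  (forall i, P i -> exists q, F i * G i = 1 + 'X^t * q) ->
  exists q, (\prod_(i <- s | P i) F i) * (\prod_(i <- s | P i) G i) = 1 + 'X^t * q.
Proof.
move=> h; elim: s => [|i s [q IH]]; first by exists 0; rewrite !big_nil mulr0 addr0 mulr1.
rewrite !big_cons; case: (boolP (P i)) => [Pi|_]; last by exists q.
have [q' e] := h _ Pi; exists (q + q' + q * 'X^t * q').
by rewrite mulrACA e IH; ring.
Qed.

Lemma one_mod_exp (F G : {poly R}) k : (exists q, F * G = 1 + 'X^t * q) ->
  exists q, F ^+ k * G ^+ k = 1 + 'X^t * q.
Proof.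
move=> h; elim: k => [|k [q IH]]; first by exists 0; rewrite !expr0 mulr0 addr0 mulr1.
have [q' e] := h; exists (q + q' + q * 'X^t * q').
by rewrite !exprS mulrACA e IH; ring.
Qed.

Lemma hpoly_mod (i : 'I_n) : exists q,
  hpoly = (tay i \Po ('X - i%:R%:P)) + ('X - i%:R%:P) ^+ t * q.
Proof.
have h1 : exists q, om i * (rr i \Po ('X - i%:R%:P)) =
    (tay i \Po ('X - i%:R%:P)) + ('X - i%:R%:P) ^+ t * q.
  have [q e] : exists q, (om i \Po ('X + i%:R%:P)) * vinv i = 1 + 'X^t * q.
    rewrite /om rmorph_prod /=; apply: one_mod_prod => j ji.
    rewrite rmorphXn /=; apply: one_mod_exp.
    rewrite rmorphB /= comp_polyX comp_polyC -addrA -polyCB; apply: xinvP.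
    by rewrite -normr_gt0 (lt_le_trans ltr01) // dist1.
  have [q' e'] : exists q', rr i = tay i * vinv i + 'X^t * q'.
    exists (- drop_poly t (tay i * vinv i)).
    by rewrite /rr -{2}(poly_take_drop t (tay i * vinv i)); ring.
  exists ((tay i * q + (om i \Po ('X + i%:R%:P)) * q') \Po ('X - i%:R%:P)).
  rewrite -{1}(comp_polyXaddC_K (om i) i%:R) -rmorphM /= e'.
  have -> : ('X - i%:R%:P) ^+ t = 'X^t \Po ('X - i%:R%:P) :> {poly R} by rewrite comp_Xn_poly.
  rewrite -comp_polyM -comp_polyD; congr (_ \Po _).
  transitivity (tay i * ((om i \Po ('X + i%:R%:P)) * vinv i) + 'X^t * ((om i \Po ('X + i%:R%:P)) * q')).
    by ring.
  by rewrite e; ring.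
have [q e] := h1.
have [q' e'] : exists q', \sum_(j < n | j != i) om j * (rr j \Po ('X - j%:R%:P)) = ('X - i%:R%:P) ^+ t * q'.
  apply: (big_ind (fun p => exists q', p = ('X - i%:R%:P) ^+ t * q')).
  - by exists 0; rewrite mulr0.
  - by move=> _ _ [x ->] [y ->]; exists (x + y); rewrite mulrDr.
  - move=> j ji; rewrite /om (bigD1 i) 1?eq_sym //= -mulrA; by eexists.
by exists (q + q'); rewrite /hpoly (bigD1 i) //= e e'; ring.
Qed.

Lemma size_om i : size (om i) = (n.-1 * t).+1.
Proof.
rewrite /om size_prod; last first.
  by move=> j _; rewrite expf_neq0 // polyXsubC_eq0.
under eq_bigr => j _ do rewrite size_exp_XsubC.
rewrite sum_nat_const; have -> : #|(fun j : 'I_n => j != i)| = n.-1.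
  have := cardC1 i; rewrite card_ord => <-; by apply: eq_card.
by rewrite mulnS -addnS addKn.
Qed.

Lemma size_hpoly : (size hpoly <= n * t)%N.
Proof.
apply: (leq_trans (size_sum _ _ _)); apply/bigmax_leqP => i _.
apply: (leq_trans (size_polyMleq _ _)); rewrite size_om.
rewrite size_comp_poly2 ?size_XsubC //.
have h : (size (rr i) <= t)%N by apply: size_take_poly.
by rewrite /= -[in leqRHS](prednK n_gt0) mulSn addnC leq_add2r.
Qed.

Lemma nrm_rr (i : 'I_n) : nrm (rr i) <= t%:R * eta * t%:R ^+ (n * t).
Proof.
have t1 : 1 <= t%:R :> R by rewrite ler1n.
apply: (le_trans (nrm_take _ _)); apply: (le_trans (nrmM _ _)).
rewrite ler_pM ?nrm_ge0 //.
  apply: nrm_poly => j jt; rewrite normrM normfV [`|j`!%:R|]ger0_norm ?ler0n //.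
  apply: le_trans (_ : _ <= eta * 1) _; last by rewrite mulr1.
  apply: ler_pM; rewrite ?invr_ge0 ?ler0n ?a_le ?ltn_ord //.
  by rewrite invf_le1 ?ler1n ?ltr0n fact_gt0.
rewrite /vinv -big_filter; set s := seq.filter _ _.
apply: le_trans (_ : _ <= (t%:R ^+ t) ^+ size s) _.
  rewrite /s; elim: (index_enum _) => [|j l IH] /=; first by rewrite big_nil nrm1 expr0.
  case: (boolP (j != i)) => [ji|_ //]; rewrite big_cons exprS.
  apply: (le_trans (nrmM _ _)); rewrite ler_pM ?nrm_ge0 //.
  by apply: nrmX; apply: nrm_xinv; apply: dist1.
rewrite -exprM ler_weXn2l // mulnC leq_mul2r; apply/orP; right.
rewrite /s size_filter (leq_trans (count_size _ _)) //.
by rewrite -[in leqRHS](card_ord n) cardE enumT.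
Qed.

(** The factors are (n+1)^((n-1)t) from [om], (n+1)^t from evaluating [rr], t^(nt) from the
    inverses, t from the Taylor coefficients and n from the number of summands. *)
Lemma hpoly_le (y : R) : -1 <= y <= n%:R ->
  `|hpoly.[y]| <= eta * (n * t)%:R * ((n.+1 * t)%:R) ^+ (n * t).
Proof.
move=> /andP [y1 y2].
have M1 : 1 <= n.+1%:R :> R by rewrite ler1n.
have yi (i : 'I_n) : `|y - i%:R| <= n.+1%:R.
  have i0 : 0 <= i%:R :> R by rewrite ler0n.
  have i1 : i%:R + 1 <= n%:R :> R by rewrite -(natrD _ _ 1) ler_nat addn1.
  by rewrite ler_norml -addn1 natrD; lra.
rewrite /hpoly horner_sum; apply: (le_trans (ler_norm_sum _ _ _)).
apply: le_trans (_ : _ <= \sum_(i < n) (n.+1%:R ^+ (n.-1 * t) * (t%:R * eta * t%:R ^+ (n * t) * n.+1%:R ^+ t))) _.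
  apply: ler_sum => i _; rewrite hornerM normrM ler_pM //.
    rewrite /om horner_prod normr_prod.
    apply: le_trans (_ : _ <= \prod_(j < n | j != i) n.+1%:R ^+ t) _.
      apply: ler_prod => j _; rewrite normr_ge0 /= horner_exp !hornerE normrX.
      by rewrite lerXn2r ?nnegrE.
    rewrite prodr_const -exprM; have -> : #|(fun j : 'I_n => j != i)| = n.-1.
      have := cardC1 i; rewrite card_ord => <-; by apply: eq_card.
    by rewrite mulnC.
  rewrite horner_comp !hornerE.
  apply: (le_trans (horner_nrm (size_take_poly _ _) M1 (yi i))).
  by rewrite ler_wpM2r ?exprn_ge0 ?ler0n // nrm_rr.
rewrite sumr_const card_ord -[_ *+ n]mulr_natl !natrM exprMn.
rewrite le_eqVlt; apply/orP; left; apply/eqP.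
have -> : n.+1%:R ^+ (n * t) = n.+1%:R ^+ (n.-1 * t) * n.+1%:R ^+ t :> R.
  by rewrite -exprD -mulSnr prednK.
ring.
Qed.

End HermitePoly.

(** * Rolle's theorem with multiplicities *)

Section Rolle.
Variable R : realType.
Implicit Types (f : nat -> R -> R) (L : seq (R * nat)).

Definition dfam f := forall i x, is_derive x (1 : R) (f i) (f i.+1 x).

(** The interval is open on the left so that each zero can serve as the new lower end for the rest
    of the list, which makes the zeros strictly increasing. *)
Fixpoint zeros f (lo hi : R) L : Prop :=
  if L is (x, m) :: L' then
    [/\ lo < x, x <= hi, (0 < m)%N, forall s, (s < m)%N -> f s x = 0 & zeros f x hi L']
  else lo <= hi.

Definition total L := (\sum_(e <- L) e.2)%N.

Lemma rolle1 f a b : dfam f -> a < b -> f 0%N a = 0 -> f 0%N b = 0 ->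
  exists2 c, a < c < b & f 1%N c = 0.
Proof.
move=> df ab fa fb; have [||//|c] := @Rolle R (f 0%N) a b ab.
- by move=> x _; have [] := df 0%N x.
- apply: continuous_subspaceT => x; apply: differentiable_continuous.
  by apply/derivable1_diffP; have [] := df 0%N x.
- by rewrite fa fb.
rewrite in_itv /= => hc hd; exists c => //.
by rewrite -(@derive_val _ _ _ _ _ _ _ hd) (@derive_val _ _ _ _ _ _ _ (df 0%N c)).
Qed.

Lemma zeros_lo f lo lo' hi x m L : lo' < x -> zeros f lo hi ((x, m) :: L) -> zeros f lo' hi ((x, m) :: L).
Proof. by move=> h []; split. Qed.

(** Every zero loses one multiplicity and every gap between neighbours yields a new zero; r zeros
    have r - 1 gaps, so exactly one is lost. *)
Lemma zeros_deriv f lo hi x m L : dfam f -> zeros f lo hi ((x, m) :: L) ->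
  exists2 L', zeros (fun i => f i.+1) lo hi L' & total L' = (total ((x, m) :: L)).-1.
Proof.
move=> df; elim: L x m lo => [|[y k] L IH] x m lo [lx xh m0 fx hL].
  case: m m0 fx => // -[|m] _ fx.
    by exists [::]; rewrite /total ?big_seq1 ?big_nil //= (le_trans (ltW lx)).
  exists [:: (x, m.+1)]; last by rewrite /total !big_seq1.
  by split=> // s hs; apply: fx.
have [xy yh k0 fy hL'] := hL.
have [c /andP [xc cy] fc] := rolle1 df xy (fx _ m0) (fy _ k0).
have [L' h1 h2] := IH y k c (zeros_lo cy hL).
have hc : zeros (fun i => f i.+1) x hi ((c, 1%N) :: L').
  by split=> //; [apply: le_trans yh; apply: ltW|case].
have tot : total ((c, 1%N) :: L') = total ((y, k) :: L).
  rewrite {1}/total big_cons -/(total L') h2 /= /total big_cons /=; lia.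
case: m m0 fx => // -[|m] _ fx.
  exists ((c, 1%N) :: L'); first by apply: zeros_lo hc; apply: lt_trans xc.
  by rewrite tot /total !big_cons.
exists ((x, m.+1) :: (c, 1%N) :: L').
  by split=> // s hs; apply: fx.
by rewrite {1}/total big_cons -/(total ((c, 1%N) :: L')) tot /total !big_cons.
Qed.

Lemma zeros_derivn f lo hi L n : dfam f -> zeros f lo hi L -> total L = n.+1 ->
  exists2 c, lo < c <= hi & f n c = 0.
Proof.
elim: n f L => [|n IH] f [|[x m] L] df hz; rewrite /total ?big_nil // => hN.
  by case: hz => h1 h2 h3 h4 _; exists x; [rewrite h1|apply: h4].
have [L' h1 h2] := zeros_deriv df hz.
by apply: (IH (fun i => f i.+1) L') => //; rewrite h2 /total hN.
Qed.

End Rolle.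

(** * The remainder of Hermite interpolation *)

Section Interpolation.
Variable R : realType.

Lemma derivn_XsubC_dvd (c : R) (q : {poly R}) t s : (s < t)%N ->
  ((('X - c%:P) ^+ t * q)^`(s)).[c] = 0.
Proof.
elim: t s q => [//|t IH] [|s] q st; first by rewrite derivn0 exprS !hornerE subrr !mul0r.
rewrite derivSn derivM.
have -> : (('X - c%:P) ^+ t.+1)^`() * q + ('X - c%:P) ^+ t.+1 * q^`() =
   ('X - c%:P) ^+ t * (q *+ t.+1 + ('X - c%:P) * q^`()).
  by rewrite deriv_exp derivXsubC /= mul1r mulrnAl mulrDr mulrnAr exprSr mulrA.
exact: IH.
Qed.

Lemma derivn_tay (a : nat -> nat -> R) t i s (c : R) : (s < t)%N ->
  ((tay t a i \Po ('X - c%:P))^`(s)).[c] = a i s.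
Proof.
move=> st; have -> : (tay t a i \Po ('X - c%:P))^`(s) = (tay t a i)^`(s) \Po ('X - c%:P).
  elim: s {st} => [|s IH]; first by rewrite !derivn0.
  by rewrite !derivnS IH deriv_comp derivXsubC mulr1.
rewrite horner_comp !hornerE subrr horner_coef0 coef_derivn addn0 coef_poly st ffactnn.
by rewrite -[_ *+ s`!]mulr_natr divfK // pnatr_eq0 -lt0n fact_gt0.
Qed.

Lemma dfam_poly (p : {poly R}) : dfam (fun i => horner p^`(i)).
Proof. by move=> i x; rewrite derivnS; apply: is_derive_poly. Qed.

Lemma dfamB (f g : nat -> R -> R) : dfam f -> dfam g -> dfam (fun i => f i \- g i).
Proof. by move=> df dg i x; apply: is_deriveB. Qed.

(* The function is its Hermite interpolation polynomial at the nodes i < n with multiplicity t, of size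
   at most the second summand, plus a remainder given by iterated Rolle. *)
Lemma hermite_bound (f : nat -> R -> R) (n t : nat) (eta D y : R) : (0 < n)%N -> (0 < t)%N ->
  dfam f -> 0 <= eta ->
  (forall i s, (i < n)%N -> (s < t)%N -> `|f s i%:R| <= eta) ->
  (forall x, -1 <= x <= n%:R -> `|f (n * t)%N x| <= D) ->
  -1 < y < n%:R ->
  `|f 0%N y| <= D * n.+1%:R ^+ (n * t) / (n * t)`!%:R
     + eta * (n * t)%:R * ((n.+1 * t)%:R) ^+ (n * t).
Proof.
move=> n0 t0 df eta0 heta hD /andP [y1 y2].
set N := (n * t)%N.
have D0 : 0 <= D.
  by apply: (le_trans _ (hD 0 _)) => //; rewrite ler0n andbT oppr_le0 ler01.
pose a i s := f s i%:R.
pose p := hpoly n t a.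
have hp : `|p.[y]| <= eta * N%:R * (n.+1 * t)%:R ^+ N.
  by apply: hpoly_le => //; rewrite (ltW y1) (ltW y2).
suff hr : `|f 0%N y - p.[y]| <= D * n.+1%:R ^+ N / N`!%:R.
  by rewrite -[f 0%N y](subrK p.[y]); apply: (le_trans (ler_normD _ _)); apply: lerD.
have rhs0 : 0 <= D * n.+1%:R ^+ N / N`!%:R.
  by rewrite divr_ge0 ?ler0n // mulr_ge0 ?exprn_ge0 ?ler0n.
have matchp i s : (i < n)%N -> (s < t)%N -> (p^`(s)).[i%:R] = f s i%:R.
  move=> hi hs; have [q e] := @hpoly_mod _ _ _ a _ n0 t0 eta0 (Ordinal hi).
  by rewrite /p e derivnD hornerD derivn_tay // derivn_XsubC_dvd // addr0.
have [/existsP [i /eqP ei]|/existsPn yi] := boolP [exists i : 'I_n, y == i%:R].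
  by rewrite ei -(matchp i 0%N) // derivn0 subrr normr0.
pose w : {poly R} := \prod_(i < n) ('X - i%:R%:P) ^+ t.
have sw : size w = N.+1.
  rewrite /w size_prod; last by move=> j _; rewrite expf_neq0 // polyXsubC_eq0.
  under eq_bigr => j _ do rewrite size_exp_XsubC.
  by rewrite sum_nat_const card_ord mulnS -addnS addKn.
have mw : w \is monic by apply: monic_prod => i _; apply: monic_exp; apply: monicXsubC.
have wy : w.[y] != 0.
  rewrite /w horner_prod; apply/prodf_neq0 => i _.
  by rewrite horner_exp !hornerE expf_neq0 // subr_eq0.
(* [ka] makes f - p - ka w vanish at y as well, giving N + 1 zeros. As p has degree below N and w is
   monic of degree N, a zero of the N-th derivative shows that ka N! is a value of the N-th
   derivative of f. *)
pose ka := (f 0%N y - p.[y]) / w.[y].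
pose P := p + ka *: w.
pose g i : R -> R := f i \- horner P^`(i).
have dg : dfam g by apply: dfamB => //; apply: dfam_poly.
have gy : g 0%N y = 0.
  by rewrite /g /= !hornerE /ka divfK // [p.[y] + _]addrC subrK subrr.
have gi i s : (i < n)%N -> (s < t)%N -> g s i%:R = 0.
  move=> hi hs; rewrite /g /= /P derivnD derivnZ hornerD hornerZ matchp //.
  have -> : w = ('X - i%:R%:P) ^+ t * \prod_(j < n | j != Ordinal hi) ('X - j%:R%:P) ^+ t.
    by rewrite /w (bigD1 (Ordinal hi)).
  by rewrite derivn_XsubC_dvd // mulr0 addr0 subrr.
pose node (i : nat) := (i%:R : R, t).
have zi l i lo : lo < i%:R -> (i + l <= n)%N -> zeros g lo n%:R [seq node j | j <- iota i l].
  elim: l i lo => [|l IH] i lo hlo hil /=.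
    by apply: ltW; apply: (lt_le_trans hlo); rewrite ler_nat; move: hil; rewrite addn0.
  have hin : (i < n)%N by apply: leq_trans hil; rewrite addnS ltnS leq_addr.
  split=> //; first by rewrite ler_nat ltnW.
  - by move=> s hs; apply: gi.
  - by apply: IH; [rewrite ltr_nat|rewrite addSnnS].
have tot i l : total [seq node j | j <- iota i l] = (l * t)%N.
  elim: l i => [|l IH] i /=; first by rewrite /total big_nil.
  by rewrite /total big_cons -/(total _) IH mulSn.
(* Adding the simple node y to the nodes >= i yields one zero more than the degree allows. *)
have ins l i lo : lo < i%:R -> lo < y -> (i + l <= n)%N ->
    exists2 L, zeros g lo n%:R L & total L = (l * t).+1.
  elim: l i lo => [|l IH] i lo hlo hy hil.
    exists [:: (y, 1%N)]; last by rewrite /total big_seq1.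
    by split=> //; [apply: ltW|case|apply: ltW].
  have hin : (i < n)%N by apply: leq_trans hil; rewrite addnS ltnS leq_addr.
  have [yl|yl] := ltP y i%:R.
    exists ((y, 1%N) :: [seq node j | j <- iota i l.+1]).
      by split=> //; [apply: ltW|case|apply: zi].
    by rewrite /total big_cons -/(total _) tot.
  have iy : i%:R < y.
    by rewrite lt_neqAle yl andbT eq_sym (yi (Ordinal hin)).
  have [L h1 h2] := IH i.+1 i%:R (ltac:(by rewrite ltr_nat)) iy (ltac:(by rewrite addSnnS)).
  exists (node i :: L).
    split=> //; first by rewrite ler_nat ltnW.
    by move=> s hs; apply: gi.
  by rewrite /total big_cons -/(total _) h2 mulSn addnS.
have [L hL1 hL2] : exists2 L, zeros g (-1) n%:R L & total L = N.+1.
  by apply: (ins n 0%N) => //; rewrite ltrN10.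
have [c /andP [c1 c2] gc] := zeros_derivn dg hL1 hL2.
have dP : P^`(N) = (ka *+ N`!)%:P.
  rewrite /P derivnD derivnZ (@derivn_poly0 _ p) ?add0r; last exact: size_hpoly.
  have -> : w^`(N) = (N`!%:R)%:P.
    have s1 : (size w^`(N) <= 1)%N.
      by apply/leq_sizeP => j hj; rewrite coef_derivn nth_default ?mul0rn // sw -addn1 leq_add2l.
    rewrite (size1_polyC s1) coef_derivn addn0 ffactnn.
    have -> : w`_N = 1 by have := monicP mw; rewrite lead_coefE sw.
    by [].
  by rewrite -mul_polyC -polyCM mulr_natr.
have e : f N c = ka *+ N`!.
  by move: gc; rewrite /g /= dP hornerC => /eqP; rewrite subr_eq0 => /eqP.
have fN0 : N`!%:R != 0 :> R by rewrite pnatr_eq0 -lt0n fact_gt0.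
have -> : f 0%N y - p.[y] = f N c * w.[y] / N`!%:R.
  rewrite e -mulr_natr /ka; field; by rewrite fN0 wy.
rewrite !normrM normfV [`|_%:R|]ger0_norm ?ler0n // ler_wpM2r ?invr_ge0 ?ler0n //.
apply: ler_pM => //; first by apply: hD; rewrite (ltW c1) c2.
rewrite /w horner_prod normr_prod.
apply: le_trans (_ : _ <= \prod_(i < n) n.+1%:R ^+ t) _.
  apply: ler_prod => j _; rewrite normr_ge0 /= horner_exp !hornerE normrX.
  rewrite lerXn2r ?nnegrE ?ler0n //.
  have i0 : 0 <= j%:R :> R by rewrite ler0n.
  have i1 : j%:R + 1 <= n%:R :> R by rewrite -(natrD _ _ 1) ler_nat addn1.
  by rewrite ler_norml -addn1 natrD; lra.
by rewrite prodr_const card_ord -exprM mulnC.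
Qed.

End Interpolation.

(** * Siegel's lemma *)

Lemma siegel (I J : finType) (A : J -> I -> int) (a : nat) :
  (0 < a)%N -> (0 < #|I|)%N -> (2 * #|J| <= #|I|)%N ->
  (forall j i, `|A j i| <= a%:Z) ->
  exists c : I -> int, [/\ exists i, c i != 0,
    forall i, `|c i| <= (2 * #|I| * a)%N%:Z & forall j, \sum_i A j i * c i = 0].
Proof.
move=> a0 M0 MJ hA; set M := #|I| in M0 MJ *; set C := (2 * M * a)%N.
have C0 : (0 < C)%N by rewrite /C !muln_gt0 M0 a0.
pose S (x : {ffun I -> 'I_C.+1}) j : int := \sum_i A j i * (x i : nat)%:Z.
have Sle x j : `|S x j| <= (M * a * C)%N%:Z.
  apply: le_trans (ler_norm_sum _ _ _) _.
  apply: le_trans (_ : _ <= \sum_(i : I) (a * C)%N%:Z) _.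
    apply: ler_sum => i _; rewrite normrM PoszM; apply: ler_pM => //.
    by rewrite ger0_norm // lez_nat -ltnS.
  by rewrite sumr_const -/M -mulr_natl natz -PoszM mulnA.
pose f x : {ffun J -> 'I_(C * C).+1} := [ffun j => inord (absz (S x j + (M * a * C)%N%:Z))].
have CC : (M * a * C + M * a * C = C * C)%N by rewrite addnn -mul2n !mulnA.
have fval x j : (f x j : nat)%:Z = S x j + (M * a * C)%N%:Z.
  move: (Sle x j); rewrite ler_norml => /andP [h1 h2].
  have h3 : 0 <= S x j + (M * a * C)%N%:Z by rewrite -lerBlDr sub0r.
  rewrite ffunE inordK; first by rewrite gez0_abs.
  by rewrite ltnS -lez_nat gez0_abs // -CC PoszD lerD2r.
(* Pigeonhole: (C+1)^#|I| vectors, while each of the #|J| shifted sums lies in 0..2MaC, and 2MaC =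
   C^2 by the choice C = 2Ma. The count uses C^2 + 1 < (C+1)^2; [maxn] covers an empty J. *)
have ninj : ~ injective f.
  move=> /leq_card; rewrite !card_ffun !card_ord leqNgt => /negP; apply.
  apply: leq_trans (_ : C.+1 ^ (maxn 1 (2 * #|J|)) <= _)%N; last first.
    by rewrite leq_pexp2l // geq_max M0 MJ.
  case: (#|J|) => [|k]; first by rewrite muln0 expn0 expn1 ltnS.
  have -> : maxn 1 (2 * k.+1) = (2 * k.+1)%N by apply/maxn_idPr; rewrite muln_gt0.
  rewrite expnM ltn_exp2r //; lia.
have [x [x' [xx' e]]] : exists x x', x <> x' /\ f x = f x'.
  apply: contrapT => h; apply: ninj => x x' e; apply: contrapT => n.
  by apply: h; exists x, x'.
exists (fun i => (x i : nat)%:Z - (x' i : nat)%:Z); split.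
- apply: contrapT => h; apply: xx'; apply/ffunP => i; apply/val_inj/eqP.
  rewrite -eqz_nat -subr_eq0; apply/negPn/negP => n; apply: h; by exists i.
- move=> i; have := ltn_ord (x i); have := ltn_ord (x' i); rewrite !ltnS -/C.
  move: (x i : nat) (x' i : nat) => p q; lia.
- move=> j; under eq_bigr => i _ do rewrite mulrBr.
  rewrite sumrB -/(S x j) -/(S x' j); apply/eqP; rewrite subr_eq0.
  by rewrite -(inj_eq (addIr (M * a * C)%N%:Z)) -!fval e.
Qed.

(** * Square classes *)

Section SquareClasses.
Variables (R : realType) (I : finType) (y : I -> R).
Hypothesis y_gt0 : forall s, 0 < y s.
Hypothesis yK : forall s, inK (y s).
Hypothesis y_intg : forall s, intg (y s).
Hypothesis rank3 : forall (s0 : I) (f : nat -> I), exists n : nat -> int,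
  (exists2 i, (i < 4)%N & ~~ (2 %| n i)%Z) /\ \prod_(i < 4) (y (f i) / y s0) ^ (n i) = 1.

Lemma exprI_pos n (a b : R) : (0 < n)%N -> 0 < a -> 0 < b -> a ^+ n = b ^+ n -> a = b.
Proof.
move=> n0 a0 b0 /eqP e; apply/eqP; rewrite -(@eqrXn2 _ n) ?ltW //.
Qed.

Definition root_of J (s0 s : I) (u : R) := [/\ inK u, 0 < u & u ^+ (2 ^ J) = y s / y s0].

(** The relation passes from the ratios to their 2^J-th roots because these are positive. Reduced
    modulo 2, its exponents, one of them odd, exhibit a nonempty product of the u i that is a square
    in K. *)
Lemma no_indep4 J s0 (f : nat -> I) (u : nat -> R) :
  (forall i, root_of J s0 (f i) (u i)) -> ~ indep u 4.
Proof.
move=> hu; have [n [[i0 i04 odd_i0] e]] := rank3 s0 f.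
have uK i : inK (u i) by case: (hu i).
have u0 i : 0 < u i by case: (hu i).
have {}e : \prod_(i < 4) u i ^ n i = 1.
  apply: (@exprI_pos (2 ^ J)); rewrite ?expn_gt0 ?ltr01 //.
    by apply: prodr_gt0 => i _; apply: exprz_gt0.
  rewrite expr1n -[RHS]e -prodrXl; apply: eq_bigr => i _.
  by have [_ _ <-] := hu i; rewrite !exprnP exprzAC.
move=> /(_ (fun i => ~~ (2 %| n i)%Z)); apply.
  by apply/existsP; exists (Ordinal i04).
exists (\prod_(i < 4) u i ^ (- (n i %/ 2)%Z)).
  by apply: inK_prod => i; apply: inKXz.
set P := \prod_(i < 4) _; transitivity (P * P * \prod_(i < 4) u i ^ n i).
  by rewrite e mulr1.
rewrite /P -!big_split /=; apply: eq_bigr => i _.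
have ui : u i != 0 by rewrite gt_eqF.
rewrite -!expfzDr //.
have -> : - (n i %/ 2)%Z - (n i %/ 2)%Z + n i = (n i %% 2)%Z.
  by rewrite {3}(divz_eq (n i) 2); ring.
case: (boolP (2 %| n i)%Z) => [/dvdz_mod0P -> //|/dvdz_mod0P h].
suff -> : (n i %% 2)%Z = 1 by [].
have := modz_ge0 (n i) (isT : 2 != 0 :> int); have := ltz_mod (n i) (isT : 2 != 0 :> int).
move: h; move: (n i %% 2)%Z => [[|[|k]]|k] //.
Qed.

(** The v i are a maximal independent family among the u s. It has at most three members by
    [no_indep4], and by maximality every u s lies in its span modulo squares. *)
Lemma max_indep J (E : {set I}) s0 (u : I -> R) : s0 \in E ->
  (forall s, s \in E -> root_of J s0 s (u s)) ->
  exists r (v : nat -> R), [/\ (r <= 3)%N, forall i, inK (v i) /\ 0 < v i, indep v r &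
    forall s, s \in E -> exists eps : nat -> bool, sqK (u s * \prod_(i < r) (if eps i then v i else 1))].
Proof.
move=> s0E hu.
pose P r := exists f : nat -> I, (forall i, f i \in E) /\ indep (fun i => u (f i)) r.
have P0 : P 0%N by exists (fun=> s0); split=> // eps /existsP [[]].
have P4 : ~ P 4%N.
  move=> [f [fE hf]]; apply: (@no_indep4 J s0 f (fun i => u (f i))) => // i.
  exact: hu.
have [r [r3 [f [fE hf]] nP]] : exists r, [/\ (r <= 3)%N, P r & ~ P r.+1].
  have [P1|?] := pselect (P 1%N); last by exists 0%N.
  have [P2|?] := pselect (P 2%N); last by exists 1%N.
  have [P3|?] := pselect (P 3%N); last by exists 2%N.
  by exists 3%N.
exists r, (fun i => u (f i)); split=> //.
  by move=> i; have [] := hu _ (fE i).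
move=> s sE; apply: contrapT => hn; apply: nP.
exists (fun i => if i == r then s else f i); split=> [i|eps he].
  by case: eqP.
rewrite big_ord_recr /= eqxx.
under eq_bigr => j _ do rewrite (ltn_eqF (ltn_ord j)).
case er : (eps r).
  by move=> h; apply: hn; exists eps; rewrite mulrC.
rewrite mulr1; apply: hf; move: he => /existsP [i ei]; apply/existsP.
have ir : (i < r)%N.
  have := ltn_ord i; rewrite ltnS leq_eqVlt => /orP [/eqP e|//].
  by move: ei; rewrite e er.
by exists (Ordinal ir).
Qed.

Lemma powR_natX (a x : R) n : 0 <= a -> (a `^ x) ^+ n = a `^ (x * n%:R).
Proof. by move=> a0; rewrite powRrM powR_mulrn // powR_ge0. Qed.

Lemma powR_frac (a : R) k n : 0 <= a -> (0 < n)%N -> (a `^ (k%:R / n%:R)) ^+ n = a ^+ k.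
Proof.
move=> a0 n0; rewrite powR_natX // divfK ?powR_mulrn //.
by rewrite pnatr_eq0 -lt0n.
Qed.

Section Class.
Variables (J : nat) (E : {set I}) (s0 : I) (C : I -> int) (nu : nat) (Z : R).
Hypothesis s0E : s0 \in E.
Hypothesis E_root : forall s, s \in E -> exists u, root_of J s0 s u.
Hypothesis nu_odd : odd nu.
Let x : R := nu%:R / (2 ^ J.+1)%:R.
Hypothesis Z1 : 1 <= Z.
Hypothesis Z_y : \sum_(s in E) `|(C s)%:~R| * y s `^ x <= Z.
Hypothesis Z_cj : \sum_(s in E) `|(C s)%:~R| * `|cj (y s)| `^ x <= Z.
Let xi := \sum_(s in E) (C s)%:~R * y s `^ x.

Lemma intg_powR s : intg (y s `^ x).
Proof.
apply: (@intg_root _ _ (2 ^ J.+1)); first by rewrite expn_gt0.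
by rewrite powR_frac ?expn_gt0 ?ltW //; apply: intgX.
Qed.

(** Each y(s)^x is [th] = y(s0)^x times an element of K times a product of the roots sqrt(v i), so
    xi / th is the value of a tower element [el]. If xi is not 0, the norm inequality applies. If it
    is 0, all components of [el] vanish, and the trivial one collects exactly those s for which u s
    is a square, that is, whose ratio to y s0 is a 2^(J+1)-th power. *)
Lemma class_dichotomy :
  (xi != 0 -> 1 <= `|xi| * Z ^+ 15) /\
  (xi = 0 -> \sum_(s in E | `[< exists k, root_of J.+1 s0 s k >]) (C s)%:~R * y s `^ x = 0).
Proof.
have [u hu] : exists u : I -> R, forall s, s \in E -> root_of J s0 s (u s).
  have h s : exists u, s \in E -> root_of J s0 s u.
    by case: (boolP (s \in E)) => [/E_root [w hw]|_]; [exists w|exists 0].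
  by exists (fun s => projT1 (cid (h s))) => s; exact: (projT2 (cid (h s))).
have [r [v [r3 vK0 vi hv]]] := max_indep s0E hu.
have vK i : inK (v i) by case: (vK0 i).
have v0 i : 0 < v i by case: (vK0 i).
pose vp (eps : nat -> bool) := \prod_(i < r) (if eps i then v i else 1) : R.
have vpK eps : inK (vp eps) by apply: inK_prod => i; case: ifP => _ //; apply: inK1.
have vp0 eps : 0 < vp eps by apply: prodr_gt0 => i _; case: ifP.
have [k [eps hk]] : exists (k : I -> R) (eps : I -> nat -> bool), forall s, s \in E ->
    [/\ inK (k s), 0 < k s & u s = k s ^+ 2 * vp (eps s)].
  have h s : exists ke : R * (nat -> bool), s \in E ->
      [/\ inK ke.1, 0 < ke.1 & u s = ke.1 ^+ 2 * vp ke.2].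
    case: (boolP (s \in E)) => sE; last by exists (0, xpred0).
    have [uK u0 _] := hu _ sE.
    have [eps [k kK ke]] := hv _ sE.
    have k0 : k != 0.
      apply/eqP => k0; move: ke; rewrite k0 mul0r -/(vp eps) => /esym/eqP.
      by rewrite mulf_eq0 !gt_eqF.
    exists (`|k| / vp eps, eps) => _ /=; split.
    - apply: inKM; last by apply: inKV.
      by case: (ler0P k) => _ //; apply: inKN.
    - by rewrite divr_gt0 // normr_gt0.
    - rewrite expr_div_n real_normK ?num_real // expr2 ke -/(vp eps).
      by field; rewrite gt_eqF.
  exists (fun s => (projT1 (cid (h s))).1), (fun s => (projT1 (cid (h s))).2) => s.
  exact: (projT2 (cid (h s))).
pose rt i := Num.sqrt (v i).
have rt2 i : rt i * rt i = v i by rewrite -expr2 sqr_sqrtr // ltW.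
have rt0 i : 0 < rt i by rewrite sqrtr_gt0.
have hrt i : (i < r)%N -> rt i * rt i = v i /\ rt i != 0 by rewrite rt2 gt_eqF.
have hrt' i : (i < r)%N -> rt i * rt i = v i by rewrite rt2.
pose rp (eps : nat -> bool) := \prod_(i < r) (if eps i then rt i else 1) : R.
have rp2 eps' : rp eps' ^+ 2 = vp eps'.
  rewrite expr2 -big_split /=; apply: eq_bigr => i _.
  by case: ifP => _; rewrite ?mulr1 // rt2.
pose nu' := nu./2.
have nuE : nu = (2 * nu').+1 by rewrite -[LHS]odd_double_half nu_odd mul2n.
pose cf s := (C s)%:~R * (k s ^+ nu * vp (eps s) ^+ nu').
have kE s : s \in E -> inK (k s) by move=> /hk [].
(* Extended by 0 outside E, since the closure lemmas for sums ask for every index to give an element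
   of K. *)
pose cf' s := if s \in E then cf s else 0.
have cfK s : inK (cf' s).
  rewrite /cf'; case: ifP => sE; last exact: inK0.
  apply: inKM; first exact: inK_int.
  by apply: inKM; apply: inKX => //; apply: kE.
pose el : T R r := \sum_(s in E) tmono r (eps s) (cf' s).
have elK : tK el by apply: tK_sum => s; apply: tK_mono.
pose th := y s0 `^ x.
have th0 : 0 < th by apply: powR_gt0.
have p2 : (0 < 2 ^ J.+1)%N by rewrite expn_gt0.
have powE s : s \in E -> y s `^ x = th * (k s ^+ nu * vp (eps s) ^+ nu' * rp (eps s)).
  move=> sE; have [_ k0 uE] := hk _ sE; have [_ u0 uJ] := hu _ sE.
  have rp0 : 0 < rp (eps s) by apply: prodr_gt0 => i _; case: ifP.
  apply: (@exprI_pos (2 ^ J.+1)) => //; first exact: powR_gt0.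
    by rewrite !mulr_gt0 ?exprn_gt0.
  rewrite exprMn !powR_frac ?ltW //.
  have -> : k s ^+ nu * vp (eps s) ^+ nu' * rp (eps s) = (k s * rp (eps s)) ^+ nu.
    rewrite exprMn -mulrA; congr (_ * _).
    by rewrite nuE exprS exprM rp2 mulrC.
  rewrite -exprM mulnC exprM expnS exprM [(k s * rp (eps s)) ^+ 2]exprMn rp2 -uE uJ.
  by rewrite -exprMn mulrC divfK // gt_eqF.
have evE chi : th * tev (signed rt chi) el =
    \sum_(s in E) (C s)%:~R * (\prod_(i < r) (if eps s i && chi i then -1 else 1)) * y s `^ x.
  rewrite /el tev_sum mulr_sumr; apply: eq_bigr => s sE.
  rewrite tev_mono /cf' sE powE // /cf.
  have -> : \prod_(i < r) (if eps s i then signed rt chi i else 1) =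
     (\prod_(i < r) (if eps s i && chi i then -1 else 1)) * rp (eps s).
    rewrite -big_split /=; apply: eq_bigr => i _; rewrite /signed.
    by case: (eps s i); case: (chi i); rewrite /= ?mulN1r ?mul1r.
  by ring.
have ev1 : th * tev rt el = xi.
  have := evE (fun=> false); rewrite (@tev_ext _ (signed rt (fun=> false)) rt) // => ->.
  apply: eq_bigr => s sE; rewrite big1 ?mulr1 // => i _.
  by rewrite andbF.
have sgn1 s chi : `|\prod_(i < r) (if eps s i && chi i then -1 else 1 : R)| = 1.
  by rewrite normr_prod big1 // => i _; case: ifP; rewrite ?normrN1 ?normr1.
split=> [xi0|xi0].
- have tev0' : tev rt el != 0 by move: xi0; rewrite -ev1; apply: contraNneq => ->; rewrite mulr0.
  have n0 := tnorm_neq0 vK hrt vi elK tev0'.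
  have [|||Oi Ole] := @tnorm_sign _ v rt r el th Z `|xi| hrt'.
  + move=> chi; rewrite evE; apply: intg_sum => s; apply: intgM; last exact: intg_powR.
    apply: intgM; first exact: intg_int.
    elim/big_ind: _ => [||i _]; [exact: (intg_int _ 1)|exact: intgM|].
    by case: ifP => _; [exact: (intg_int _ (-1))|exact: (intg_int _ 1)].
  + move=> chi; rewrite evE; apply: le_trans Z_y; apply: (le_trans (ler_norm_sum _ _ _)).
    apply: ler_sum => s _; rewrite !normrM sgn1 mulr1.
    by rewrite [`|_ `^ _|]ger0_norm // powR_ge0.
  + by rewrite ev1.
  set N := tnorm v el in n0 Oi Ole.
  have NK : inK N by apply: tK_norm.
  (* [th] itself is only a root of an element of K. Raising to the power [P] brings the quantity
     into K, where the norm inequality holds; the root is taken again at the end. *)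
  pose P := (2 ^ J.+1)%N.
  have Oe : (th ^+ (2 ^ r) * N) ^+ P = y s0 ^+ (nu * 2 ^ r) * N ^+ P.
    by rewrite exprMn -exprM mulnC exprM powR_frac ?ltW // -exprM.
  have OK : inK ((th ^+ (2 ^ r) * N) ^+ P).
    by rewrite Oe; apply: inKM; apply: inKX.
  have := intg_norm_ge1 OK (intgX _ Oi).
  rewrite expf_neq0; last by rewrite mulf_neq0 // expf_neq0 // (gt_eqF th0).
  move=> /(_ isT).
  rewrite {2}Oe cjM; try by apply: inKX.
  rewrite !cjX // => hge1.
  pose rho i := Num.sqrt `|cj (v i)|.
  have rho0 i : 0 <= rho i by apply: sqrtr_ge0.
  have rho2 i : rho i * rho i = `|cj (v i)| by rewrite -expr2 sqr_sqrtr.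
  pose rhp (eps : nat -> bool) := \prod_(i < r) (if eps i then rho i else 1) : R.
  have rhp2 eps' : rhp eps' ^+ 2 = `|cj (vp eps')|.
    rewrite expr2 -big_split /= /vp.
    elim: (index_enum _) => [|i l IH]; first by rewrite !big_nil cj1 normr1.
    rewrite !big_cons cjM ?normrM ?IH; first by case: ifP => _; rewrite ?rho2 // mulr1 cj1 normr1.
    - by case: ifP => _ //; apply: inK1.
    - by apply: inK_prod => j; case: ifP => _ //; apply: inK1.
  have cy0 : 0 < `|cj (y s0)| by rewrite normr_gt0 cj_eq0 ?gt_eqF.
  have cjN : `|cj N| <= tsize rho (tcj el) ^+ (2 ^ r).
    by rewrite /N cj_tnorm // norm_tnorm_le // => i; rewrite rho2.
  have szle : `|cj (y s0)| `^ x * tsize rho (tcj el) <= Z.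
    apply: le_trans Z_cj; rewrite /el tcj_sum; last by move=> s; apply: tK_mono.
    apply: le_trans (_ : _ <= `|cj (y s0)| `^ x * \sum_(s in E) tsize rho (tcj (tmono r (eps s) (cf' s)))) _.
      by rewrite ler_wpM2l ?powR_ge0 // tsize_sum.
    rewrite mulr_sumr; apply: ler_sum => s sE.
    rewrite tcj_mono tsize_mono // /cf' sE /cf -/(rhp (eps s)).
    have [kK k0 uE] := hk _ sE; have [uK u0 uJ] := hu _ sE.
    have -> : cj ((C s)%:~R * (k s ^+ nu * vp (eps s) ^+ nu')) =
        (C s)%:~R * (cj (k s) ^+ nu * cj (vp (eps s)) ^+ nu').
      have h1 : inK (k s ^+ nu) by apply: inKX.
      have h2 : inK (vp (eps s) ^+ nu') by apply: inKX.
      rewrite cjM ?cj_int; [|exact: inK_int|exact: inKM].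
      by rewrite cjM // !cjX.
    rewrite !normrM !normrX -rhp2 -exprM.
    have -> : `|cj (y s)| `^ x = `|cj (y s0)| `^ x * (`|cj (k s)| * rhp (eps s)) ^+ nu.
      have ck0 : 0 < `|cj (k s)| by rewrite normr_gt0 cj_eq0 // gt_eqF.
      have rhp0 : 0 < rhp (eps s).
        apply: prodr_gt0 => i _; case: ifP => // _.
        by rewrite /rho sqrtr_gt0 normr_gt0 cj_eq0 // gt_eqF.
      have cys : 0 < `|cj (y s)| by rewrite normr_gt0 cj_eq0 ?gt_eqF.
      apply: (@exprI_pos P); rewrite ?expn_gt0 //; first exact: powR_gt0.
        by rewrite mulr_gt0 ?powR_gt0 // exprn_gt0 // mulr_gt0.
      rewrite exprMn !powR_frac ?ltW // -exprM mulnC exprM.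
      have -> : (`|cj (k s)| * rhp (eps s)) ^+ P = `|cj (y s)| / `|cj (y s0)|.
        rewrite /P expnS exprM [(_ * rhp _) ^+ 2]exprMn rhp2 -normrX -normrM -cjX // -cjM //; last exact: inKX.
        rewrite -uE -normrX -cjX // uJ cjM //; last exact: inKV.
        by rewrite cjV // normrM normfV.
      by rewrite -exprMn mulrC divfK // gt_eqF.
    rewrite exprMn.
    have -> : rhp (eps s) ^+ nu = rhp (eps s) * rhp (eps s) ^+ (2 * nu') by rewrite -exprS -nuE.
    by rewrite le_eqVlt; apply/orP; left; apply/eqP; ring.
  have Z0 : 0 <= Z by apply: le_trans Z1.
  have h2 : `|cj (y s0)| ^+ (nu * 2 ^ r) * `|cj N| ^+ P <= (Z ^+ (2 ^ r)) ^+ P.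
    have -> : `|cj (y s0)| ^+ (nu * 2 ^ r) = ((`|cj (y s0)| `^ x) ^+ (2 ^ r)) ^+ P.
      by rewrite -[RHS]exprM [X in _ = _ ^+ X]mulnC [RHS]exprM powR_frac ?normr_ge0 // exprM.
    rewrite -exprMn lerXn2r ?nnegrE ?mulr_ge0 ?exprn_ge0 ?powR_ge0 //.
    apply: le_trans (_ : _ <= (`|cj (y s0)| `^ x * tsize rho (tcj el)) ^+ (2 ^ r)) _.
      by rewrite exprMn ler_wpM2l // exprn_ge0 ?powR_ge0.
    by rewrite lerXn2r ?nnegrE ?mulr_ge0 ?powR_ge0 ?tsize_ge0.
  have h3 : 1 <= ((`|xi| * Z ^+ (2 ^ r).-1) * Z ^+ (2 ^ r)) ^+ P.
    apply: (le_trans hge1); rewrite [leRHS]exprMn; apply: ler_pM => //.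
    - by rewrite normrX lerXn2r ?nnegrE // mulr_ge0 // exprn_ge0.
    - by rewrite normrM !normrX.
  have {h3} h4 : 1 <= `|xi| * Z ^+ (2 ^ r).-1 * Z ^+ (2 ^ r).
    by rewrite -(@ler_pXn2r _ P) ?expn_gt0 ?nnegrE ?expr1n // !mulr_ge0 ?exprn_ge0.
  apply: (le_trans h4); rewrite -mulrA -exprD ler_wpM2l // ler_weXn2l //.
  (* At most 7 factors Z come from the other signs over the identity and 8 from all signs over the
     conjugate embedding. *)
  have r8 : (2 ^ r <= 2 ^ 3)%N by rewrite leq_exp2l.
  by apply: (@leq_trans (7 + 8)) => //; rewrite leq_add // -ltnS prednK ?expn_gt0.
- have {}xi0 : tev rt el = 0.
    by apply/eqP; move/eqP: xi0; rewrite -ev1 mulf_eq0 gt_eqF.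
  have [LI _ _] := kummer vK hrt vi.
  have /(congr1 (fun z : T R r => tleaf0 z)) := LI _ elK xi0.
  rewrite tleaf00 /el tleaf0_sum => /(congr1 (fun z => th * z)); rewrite mulr0 => e0.
  rewrite -[RHS]e0 mulr_sumr big_mkcondr /=; apply: eq_bigr => s sE;
  rewrite tleaf0_mono /cf' sE /cf.
  have [kK k0 uE] := hk _ sE; have [uK u0 uJ] := hu _ sE.
  case: ifP => [/asboolP [q [qK q0 qE]]|/asboolP nq].
    case: ifP => [he|/existsPn he].
      (* Here u s is also q^2, so the nonempty product vp(eps s) would be the square of q / k s. *)
      exfalso; apply: (vi _ he); exists (q / k s); first by apply: inKM => //; apply: inKV.
      have qu : q ^+ 2 = u s.
        apply: (@exprI_pos (2 ^ J)); rewrite ?expn_gt0 ?exprn_gt0 //.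
        by rewrite -exprM -expnS qE uJ.
      rewrite -/(vp (eps s)) -expr2 expr_div_n qu uE; field; by rewrite gt_eqF.
    rewrite powE //; have -> : vp (eps s) = 1.
      by apply: big1 => i _; rewrite (negPf (he i)).
    have -> : rp (eps s) = 1 by apply: big1 => i _; rewrite (negPf (he i)).
    by rewrite expr1n !mulr1; ring.
  case: ifP => [_|/existsPn he]; first by rewrite mulr0.
  exfalso; apply: nq; exists (k s); split=> //.
  have e1 : vp (eps s) = 1 by apply: big1 => i _; rewrite (negPf (he i)).
  by rewrite expnS exprM -uJ uE e1 mulr1.
Qed.

End Class.
End SquareClasses.

(** * The descent *)

Lemma Posz_exp m n : (m ^ n)%N%:Z = m%:Z ^+ n.
Proof. by elim: n => [//|n IH]; rewrite expnS PoszM IH exprS. Qed.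

Section NatFacts.
Variables (i j sg t t0 m X1 p : nat).

Lemma TJ_le : (i + j < t0 + t)%N -> (t <= t0)%N -> (i + j <= 3 * t0)%N. Proof. lia. Qed.
Lemma TJ_lt : (i + j < t0 + t)%N -> (sg < t)%N -> (i + j + sg < t0 + 2 * t)%N. Proof. lia. Qed.
Lemma node_lt : (m < p * X1)%N -> ((2 * m).+1 < p * (2 * X1))%N. Proof. lia. Qed.
Lemma node_mul : (p * X1 * 2 = p * (2 * X1))%N. Proof. lia. Qed.
Lemma node_mul4 : (2 * p * (2 * X1) <= p * X1 * 4)%N. Proof. lia. Qed.
Lemma node_count : (0 < p)%N -> (2 * (p * X1).+1 <= (2 * X1).+2 * p)%N. Proof. nia. Qed.
End NatFacts.

Section Prelim.
Variable R : realType.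

Lemma is_derive_affexp (K p w v : R) :
  is_derive v (1:R) (fun v => K * expR ((2 * v + 1) / p * w)) (K * (2 / p * w) * expR ((2 * v + 1) / p * w)).
Proof.
have h1 : is_derive v (1:R) (fun v => (2 * v + 1) / p * w) (2 / p * w).
  have -> : (fun v0 : R => (2 * v0 + 1) / p * w) = (fun v0 : R => (2 / p * w) *: v0 + w / p).
    by apply/funext => u; rewrite /GRing.scale /=; ring.
  by apply: is_derive_eq; rewrite addr0 /GRing.scale /= mulr1.
have h2 := @is_derive1_comp R expR _ v _ _ (is_derive_expR _) h1.
have h3 := @is_deriveZ _ _ _ _ K v 1 _ h2.
by apply: (is_derive_eq (df := _) h3); rewrite /GRing.scale /=; ring.
Qed.
Lemma is_derive_bigsum (T : Type) (r : seq T) (P : pred T) (F : T -> R -> R) (dF : T -> R) (x : R) :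
  (forall s, is_derive x (1:R) (F s) (dF s)) ->
  is_derive x (1:R) (fun v => \sum_(s <- r | P s) F s v) (\sum_(s <- r | P s) dF s).
Proof.
move=> h; elim: r => [|s r IH].
  have -> : (fun v : R => \sum_(s <- [::] | P s) F s v) = cst 0.
    by apply/funext => v; rewrite big_nil.
  by rewrite big_nil; apply: is_derive_cst.
rewrite big_cons.
have -> : (fun v => \sum_(s <- s :: r | P s) F s v) =
  (if P s then F s \+ (fun v => \sum_(s <- r | P s) F s v) else (fun v => \sum_(s <- r | P s) F s v)).
  by apply/funext => v; rewrite big_cons; case: (P s).
by case: (P s) => //; apply: is_deriveD.
Qed.
End Prelim.

Section Prelim2.
Variable R : realType.

Lemma powR_le_expn (u v x : R) n : 0 <= u -> u <= v -> 1 <= v -> 0 <= x <= n%:R -> u `^ x <= v ^+ n.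
Proof.
move=> u0 uv v1 /andP [x0 xn]; have v0 : 0 <= v by apply: le_trans v1.
apply: (le_trans (ge0_ler_powR x0 u0 v0 uv)).
by rewrite -powR_mulrn //; apply: ler_powR.
Qed.

Lemma powRE_gt0 (u x : R) : 0 < u -> u `^ x = expR (x * ln u).
Proof. by move=> u0; rewrite /powR gt_eqF. Qed.

Lemma expR_near1 (u : R) : `|u| <= 2^-1 -> `|expR u - 1| <= 2 * `|u|.
Proof.
move=> hu; have h1 := expR_ge1Dx u; have h2 := expR_ge1Dx (- u).
have e : expR u * expR (- u) = 1 by rewrite expRxMexpNx_1.
have p := expR_gt0 u.
have hu' : - 2^-1 <= u <= 2^-1 by rewrite -ler_norml.
have [u0|u0] := ger0P u; rewrite ler_norml; move: u0 hu' => u0 /andP [g1 g2].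
  by apply/andP; split; nra.
by apply/andP; split; nra.
Qed.

End Prelim2.

Section Descent.
Variables (R : realType) (I : finType) (y : I -> R) (z1 z2 : I -> int).
Variables (l a k0 : R) (e : I -> R) (e0 : R) (beta H2 X1 Jm : nat).
Let X := (2 * X1)%N.
Let t0 := (2 ^ Jm)%N.
Let T0 := (3 * t0)%N.
Let M := #|I|.
(* [Zb] bounds the conjugates of the sums to be extrapolated, [Small] the extrapolated sums themselves.
   The exponent 15 in [num] below counts the conjugates other than the identity over the compositum of
   K with three square roots: 2 * 2^3 - 1. *)
Definition coefA := (2 ^ (2 * T0 * beta) * 2 ^ (H2 * X))%N.
Definition coefC := (2 * M * coefA)%N.
Definition Zb := (2 * M * coefC * 2 ^ (T0 * beta) * 2 ^ (H2 * X.+1))%N.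
Let N := (X1 * t0)%N.
Let W := H2.+1.
Definition Small : R := Zb%:R * (W * X.+2)%:R ^+ N / N`!%:R +
  Zb%:R * X%:R * e0 * (((2 * W) ^ t0 * N * ((X1 * t0).+1 * t0) ^ N)%:R + 1).

Hypothesis yZ : forall s, exists p q : int, y s = p%:~R + q%:~R * s2 R.
Hypothesis y_ge1 : forall s, 1 <= y s.
Hypothesis y_le : forall s, y s <= 2 ^+ H2.
Hypothesis cy_le : forall s, `|cj (y s)| <= 2 ^+ H2.
Hypothesis z1_le : forall s, `|z1 s| <= (2 ^ beta)%N%:Z.
Hypothesis z2_le : forall s, `|z2 s| <= (2 ^ beta)%N%:Z.
Hypothesis lnE : forall s, ln (y s) = l * (z1 s)%:~R + a * (z2 s)%:~R + k0 + e s.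
Hypothesis e_le : forall s, `|e s| <= e0.
Hypothesis e0_le : X.+2%:R * e0 <= 2^-1.
Hypothesis rank3 : forall (s0 : I) (f : nat -> I), exists n : nat -> int,
  (exists2 i, (i < 4)%N & ~~ (2 %| n i)%Z) /\ \prod_(i < 4) (y (f i) / y s0) ^ (n i) = 1.
Hypothesis fiber : forall E : {set I}, (forall s s', s \in E -> s' \in E -> y s = y s') ->
  (#|E| <= t0)%N /\ {in E &, injective z1}.
Hypothesis X1_gt0 : (0 < X1)%N.
Hypothesis H2_gt0 : (0 < H2)%N.
Hypothesis I_gt0 : (0 < M)%N.
Hypothesis siegel_le : (4 * (T0 * T0 * X1) <= M)%N.
Hypothesis t0_ge : (16 * H2 <= t0)%N.
Hypothesis num : Small * Zb%:R ^+ 15 < 1.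

Let y_gt0 s : 0 < y s. Proof. exact: lt_le_trans (y_ge1 s). Qed.
Let yK s : inK (y s).
Proof.
by have [p [q ->]] := yZ s; apply: inKD; [apply: inK_int|apply: inKM; [apply: inK_int|apply: inK_s2]].
Qed.
Let y_intg s : intg (y s).
Proof.
by have [p [q ->]] := yZ s; apply: intgD; [apply: intg_int|apply: intgM; [apply: intg_int|apply: intg_s2]].
Qed.

Lemma Z2_pow (x : R) n : (exists p q : int, x = p%:~R + q%:~R * s2 R) ->
  exists p q : int, x ^+ n = p%:~R + q%:~R * s2 R.
Proof.
move=> [p [q ->]]; elim: n => [|n [p' [q' IH]]].
  by exists 1, 0; rewrite expr0 mul0r addr0.
exists (p * p' + 2 * q * q'), (p * q' + q * p').
rewrite exprS IH !intrD !intrM.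
transitivity (p%:~R * p'%:~R + q%:~R * q'%:~R * (s2 R * s2 R) + (p%:~R * q'%:~R + q%:~R * p'%:~R) * s2 R).
  by ring.
by rewrite s2_sq; ring.
Qed.

Lemma Z2_coef_le (p q : int) (D : nat) (x : R) : x = p%:~R + q%:~R * s2 R ->
  `|x| <= D%:R -> `|cj x| <= D%:R -> `|p| <= D%:Z /\ `|q| <= D%:Z.
Proof.
move=> ex hx hc.
have cx : cj x = p%:~R - q%:~R * s2 R.
  by rewrite ex -(ratr_int R p) -(ratr_int R q) cjE.
have ep : p%:~R = (x + cj x) / 2 by rewrite cx ex; lra.
have eq : q%:~R * s2 R = (x - cj x) / 2 by rewrite cx ex; lra.
have s1 : 1 <= s2 R by rewrite -(@ler_pXn2r _ 2) ?nnegrE ?ltW ?s2_gt0 // expr1n expr2 s2_sq; lra.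
have DE : D%:R = (D%:Z)%:~R :> R by [].
split; rewrite -(ler_int R) intr_norm -DE.
  rewrite ep; move: hx hc; rewrite !ler_norml => /andP [? ?] /andP [? ?]; lra.
apply: le_trans (_ : _ <= `|q%:~R * s2 R|) _.
  by rewrite normrM ler_peMr // (le_trans s1) // ler_norm.
rewrite eq; move: hx hc; rewrite !ler_norml => /andP [? ?] /andP [? ?]; lra.
Qed.

(** An equation in Z[sqrt 2] is two integer equations, hence the [bool] in J. With X1 odd exponents
    below X there are 2 T0^2 X1 of them, at most half the number of unknowns by [siegel_le]. *)
Lemma exists_coef : exists c : I -> int, [/\ exists s, c s != 0,
   forall s, `|c s| <= coefC%:Z &
   forall i j nu, (i < T0)%N -> (j < T0)%N -> odd nu -> (nu < X)%N ->
     \sum_s (c s * z1 s ^+ i * z2 s ^+ j)%:~R * y s ^+ nu = 0].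
Proof.
have [P hP] : exists P : nat -> I -> int * int, forall nu s, y s ^+ nu = (P nu s).1%:~R + (P nu s).2%:~R * s2 R.
  have h nu s : exists pq : int * int, y s ^+ nu = pq.1%:~R + pq.2%:~R * s2 R.
    by have [p [q ->]] := Z2_pow nu (yZ s); exists (p, q).
  by exists (fun nu s => projT1 (cid (h nu s))) => nu s; exact: (projT2 (cid (h nu s))).
pose J := ('I_T0 * 'I_T0 * 'I_X1 * bool)%type.
pose A (x : J) (s : I) : int := let: (i, j, m, b) := x in
  z1 s ^+ i * z2 s ^+ j * (if b then (P (2 * m).+1 s).2 else (P (2 * m).+1 s).1).
have A0 : (0 < coefA)%N by rewrite /coefA muln_gt0 !expn_gt0.
have JM : (2 * #|{: J}| <= #|I|)%N.
  rewrite !card_prod !card_ord card_bool; apply: leq_trans siegel_le; lia.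
have hA x s : `|A x s| <= coefA%:Z.
  case: x => [[[i j] m] b]; rewrite /A !normrM /coefA PoszM.
  have nuX : ((2 * m).+1 <= X)%N by rewrite /X ltn_mul2l ltn_ord.
  have hy : `|y s ^+ (2 * m).+1| <= (2 ^ (H2 * X))%N%:R.
    rewrite normrX natrX exprM ger0_norm; last by rewrite ltW.
    apply: le_trans (_ : _ <= (2 ^+ H2) ^+ (2 * m).+1) _.
      by rewrite lerXn2r ?nnegrE ?exprn_ge0 ?y_le // ltW.
    by rewrite ler_weXn2l // exprn_ege1 // ler1n.
  have hcy : `|cj (y s ^+ (2 * m).+1)| <= (2 ^ (H2 * X))%N%:R.
    rewrite cjX // normrX natrX exprM.
    apply: le_trans (_ : _ <= (2 ^+ H2) ^+ (2 * m).+1) _.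
      by rewrite lerXn2r ?nnegrE ?exprn_ge0 ?cy_le.
    by rewrite ler_weXn2l // exprn_ege1 // ler1n.
  have [h1 h2] := Z2_coef_le (hP _ _) hy hcy.
  apply: ler_pM => //; last by case: (b).
  rewrite !normrX.
  apply: le_trans (_ : _ <= ((2 ^ beta)%N%:Z) ^+ T0 * ((2 ^ beta)%N%:Z) ^+ T0) _.
    have b1 : 1 <= (2 ^ beta)%N%:Z by rewrite lez_nat expn_gt0.
    apply: ler_pM; rewrite ?exprn_ge0 //.
      apply: le_trans (_ : _ <= ((2 ^ beta)%N%:Z) ^+ i) _; first by rewrite lerXn2r ?nnegrE // z1_le.
      by rewrite ler_weXn2l // ltnW.
    apply: le_trans (_ : _ <= ((2 ^ beta)%N%:Z) ^+ j) _; first by rewrite lerXn2r ?nnegrE // z2_le.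
    by rewrite ler_weXn2l // ltnW.
  by rewrite -exprD -Posz_exp -expnM addnn -mul2n mulnC.
have [c [c1 c2 c3]] := siegel A0 I_gt0 JM hA.
exists c; split=> // i j nu hi hj nuo nuX.
have m1 : (nu./2 < X1)%N.
  move: nuX; rewrite -[nu in (nu < _)%N]odd_double_half nuo add1n -mul2n /X => h.
  by rewrite -(ltn_pmul2l (m := 2)) // ltnW.
have em : (2 * nu./2).+1 = nu by rewrite -[RHS]odd_double_half nuo mul2n.
have h1 := c3 (Ordinal hi, Ordinal hj, Ordinal m1, false).
have h2 := c3 (Ordinal hi, Ordinal hj, Ordinal m1, true).
transitivity ((\sum_s A (Ordinal hi, Ordinal hj, Ordinal m1, false) s * c s)%:~R +
   (\sum_s A (Ordinal hi, Ordinal hj, Ordinal m1, true) s * c s)%:~R * s2 R); last first.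
  by rewrite h1 h2 mul0r addr0.
rewrite !rmorph_sum mulr_suml -big_split /=; apply: eq_bigr => s _.
by rewrite em hP !intrM; ring.
Qed.

(** * Extrapolation from one level to the next *)

Section Coefs.
Variable c : I -> int.
Hypothesis c_le : forall s, `|c s| <= coefC%:Z.

Let Cs i j s : R := (c s * z1 s ^+ i * z2 s ^+ j)%:~R.
Let x_ J nu : R := nu%:R / (2 ^ J)%:R.
(** The orders still available at level J, from T0 = 3 t0 at J = 0 down to t0 + 2 at J = Jm. Level J
    spends t = 2^(Jm-J) of them as multiplicity at n = 2^J X1 nodes, so n t = N throughout, and
    enough orders remain for the final Vandermonde argument. *)
Let TJ J := (t0 + 2 * 2 ^ (Jm - J))%N.

(* After J halvings the relations hold at the odd multiples of 2^-J, on a set E over which the ratios of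
   the y s are 2^J-th powers in K. *)
Definition Inv J (E : {set I}) := [/\ exists2 s, s \in E & c s != 0,
  forall s s', s \in E -> s' \in E -> exists u, root_of y J s s' u &
  forall i j nu, (i + j < TJ J)%N -> odd nu -> (nu < 2 ^ J * X)%N ->
    \sum_(s in E) Cs i j s * y s `^ x_ J nu = 0].

Lemma x_bounds J nu : (nu <= 2 ^ J * X)%N -> 0 <= x_ J nu <= X%:R.
Proof.
move=> h; rewrite /x_ divr_ge0 //= ler_pdivrMr ?ltr0n ?expn_gt0 //.
by rewrite -natrM ler_nat mulnC.
Qed.

Lemma Cs_le i j s : (i + j <= T0)%N -> `|Cs i j s| <= (coefC * 2 ^ (T0 * beta))%N%:R.
Proof.
move=> h; rewrite /Cs -intr_norm -[(_ * _)%N%:R]/((_%:Z)%:~R) ler_int !normrM !normrX PoszM -mulrA.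
apply: ler_pM => //.
have b1 : 1 <= (2 ^ beta)%N%:Z by rewrite lez_nat expn_gt0.
apply: le_trans (_ : _ <= ((2 ^ beta)%N%:Z) ^+ i * ((2 ^ beta)%N%:Z) ^+ j) _.
  by apply: ler_pM => //; rewrite lerXn2r ?nnegrE // ?z1_le ?z2_le.
rewrite -exprD mulnC expnM (Posz_exp (2 ^ beta)) ler_weXn2l //.
Qed.

Lemma y_pow_le s x : 0 <= x <= X%:R -> y s `^ x <= 2 ^+ (H2 * X).
Proof.
by move=> hx; rewrite exprM; apply: powR_le_expn => //; rewrite ?(ltW (y_gt0 s)) ?exprn_ege1 ?ler1n.
Qed.
Lemma cy_pow_le s x : 0 <= x <= X%:R -> `|cj (y s)| `^ x <= 2 ^+ (H2 * X).
Proof.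
by move=> hx; rewrite exprM; apply: powR_le_expn => //; rewrite exprn_ege1 // ler1n.
Qed.

Lemma sum_le_Zb (E : {set I}) (F G : I -> R) : (forall s, 0 <= F s <= (coefC * 2 ^ (T0 * beta))%N%:R) ->
  (forall s, 0 <= G s <= 2 * 2 ^+ (H2 * X.+1)) -> \sum_(s in E) F s * G s <= Zb%:R.
Proof.
move=> hF hG.
apply: le_trans (_ : _ <= \sum_(s in E) ((coefC * 2 ^ (T0 * beta))%N%:R * (2 * 2 ^+ (H2 * X.+1)))) _.
  by apply: ler_sum => s _; have /andP [f1 f2] := hF s; have /andP [g1 g2] := hG s; apply: ler_pM.
rewrite sumr_const -[_ *+ #|E|]mulr_natl.
apply: le_trans (_ : _ <= M%:R * ((coefC * 2 ^ (T0 * beta))%N%:R * (2 * 2 ^+ (H2 * X.+1)))) _.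
  by rewrite ler_wpM2r ?mulr_ge0 ?exprn_ge0 // ler_nat max_card.
rewrite /Zb !natrM !natrX le_eqVlt; apply/orP; left; apply/eqP; ring.
Qed.

Lemma Zb_ge1 : 1 <= Zb%:R :> R.
Proof.
rewrite ler1n /Zb /coefC /coefA !muln_gt0 !expn_gt0 /=.
by rewrite I_gt0.
Qed.

Let wb s : R := ln (y s) - e s.

Lemma wbE s : wb s = l * (z1 s)%:~R + a * (z2 s)%:~R + k0.
Proof. by rewrite /wb lnE addrK. Qed.

Lemma e0_ge0 : 0 <= e0.
Proof.
have /card_gt0P [s _] := I_gt0.
exact: le_trans (e_le s).
Qed.

Lemma e0_le_half : e0 <= 2^-1.
Proof.
apply: le_trans e0_le; rewrite ler_peMl ?e0_ge0 //.
by rewrite ler1n.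
Qed.

Lemma ln_y_bounds s : 0 <= ln (y s) <= H2%:R.
Proof.
rewrite ln_ge0 //=; apply: le_trans (_ : _ <= ln (2 ^+ H2)) _.
  by rewrite ler_ln ?posrE ?y_le // exprn_gt0.
rewrite lnXn // -[ln 2 *+ H2]mulr_natr ler_piMl // (_ : 2 = 1 + 1) //.
by apply: le_ln1Dx; lra.
Qed.

Lemma wb_le s : `|wb s| <= W%:R.
Proof.
have /andP [h1 h2] := ln_y_bounds s.
have := le_trans (e_le s) e0_le_half; rewrite !ler_norml => /andP [h3 h4].
rewrite /wb /W -addn1 natrD; apply/andP; split; lra.
Qed.

(* The derivatives of the auxiliary function only involve vanishing sums, as [wb] is a linear form in
   z1, z2, 1. *)
Lemma wb_sum (E : {set I}) (x : R) T : (forall i j, (i + j < T)%N -> \sum_(s in E) Cs i j s * y s `^ x = 0) ->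
  forall sg i j, (i + j + sg < T)%N -> \sum_(s in E) Cs i j s * wb s ^+ sg * y s `^ x = 0.
Proof.
move=> h; elim=> [|sg IH] i j hij.
  by under eq_bigr => s _ do rewrite expr0 mulr1; apply: h; rewrite addn0 in hij.
have h1 := IH i.+1 j; have h2 := IH i j.+1; have h3 := IH i j.
rewrite addSnnS addnS addSn -addnS in h1; rewrite !addnS addSn -addnS in h2.
move/(_ hij) in h1; move/(_ hij) in h2.
have {}h3 := h3 (ltn_trans (ltnSn _) (leq_trans (eq_leq (esym (f_equal S (addnS _ _)))) hij)).
transitivity (l * (\sum_(s in E) Cs i.+1 j s * wb s ^+ sg * y s `^ x)
  + a * (\sum_(s in E) Cs i j.+1 s * wb s ^+ sg * y s `^ x)
  + k0 * (\sum_(s in E) Cs i j s * wb s ^+ sg * y s `^ x)); last first.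
  by rewrite h1 h2 h3 !mulr0 !addr0.
rewrite !mulr_sumr -!big_split /=; apply: eq_bigr => s _.
rewrite (exprS (wb s) sg) {1}wbE /Cs !exprS !intrM; ring.
Qed.

Lemma exp_wb_le s x : -1 <= x <= X.+1%:R -> expR (x * wb s) <= 2 * 2 ^+ (H2 * X.+1).
Proof.
move=> /andP [x1 x2].
have /andP [h1 h2] := ln_y_bounds s.
have h5 := le_trans (e_le s) e0_le_half.
have he := e_le s.
have hXe : X.+1%:R * e0 <= 2^-1.
  by apply: le_trans e0_le; rewrite ler_wpM2r ?e0_ge0 // ler_nat.
have X0 : 1 <= X.+1%:R :> R by rewrite ler1n.
have hw : x * wb s <= X.+1%:R * ln (y s) + X.+1%:R * e0.
  rewrite /wb mulrBr; apply: lerD.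
    by rewrite ler_wpM2r.
  apply: (le_trans (ler_norm _)); rewrite normrN normrM; apply: ler_pM => //.
  by rewrite ler_norml x2 (le_trans _ x1) // lerN2.
apply: le_trans (_ : _ <= expR (X.+1%:R * ln (y s) + X.+1%:R * e0)) _; first by rewrite ler_expR.
rewrite expRD mulrC; apply: ler_pM; rewrite ?expR_ge0 //.
  have := @expR_near1 R (X.+1%:R * e0); rewrite ger0_norm ?mulr_ge0 ?e0_ge0 // => /(_ hXe).
  rewrite ler_norml => /andP [_]; lra.
rewrite -powRE_gt0 // powR_mulrn ?(ltW (y_gt0 s)) // exprM.
by rewrite lerXn2r ?nnegrE ?exprn_ge0 ?(ltW (y_gt0 s)).
Qed.

Lemma pow_diff_le s x : 0 <= x <= X%:R ->
  `|expR (x * wb s) - y s `^ x| <= 2 * 2 ^+ (H2 * X.+1) * (X%:R * e0).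
Proof.
move=> /andP [x0 xX].
have he := e_le s.
have hXe : X%:R * e0 <= 2^-1.
  by apply: le_trans e0_le; rewrite ler_wpM2r ?e0_ge0 // ler_nat -addn2 leq_addr.
have xe : `|x * e s| <= X%:R * e0.
  by rewrite normrM; apply: ler_pM => //; rewrite ger0_norm.
have -> : expR (x * wb s) = y s `^ x * expR (- (x * e s)).
  by rewrite powRE_gt0 // -expRD /wb; congr expR; ring.
rewrite -{2}[y s `^ x]mulr1 -mulrBr normrM [2 * _ * _]mulrAC mulrC.
apply: ler_pM => //.
  have := @expR_near1 R (- (x * e s)); rewrite normrN => /(_ (le_trans xe hXe)) h.
  by apply: (le_trans h); rewrite ler_wpM2l.
rewrite ger0_norm ?powR_ge0 //; apply: le_trans (y_pow_le s _) _; first by rewrite x0.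
by rewrite ler_weXn2l ?ler1n // leq_mul2l leqnSn orbT.
Qed.

Lemma analytic_step J (E : {set I}) i j nu : (J < Jm)%N -> Inv J E ->
  (i + j < TJ J.+1)%N -> odd nu -> (nu < 2 ^ J.+1 * X)%N ->
  `|\sum_(s in E) Cs i j s * y s `^ x_ J.+1 nu| <= Small.
Proof.
move=> JJ [_ _ van] hij nuo nuX.
set n := (2 ^ J * X1)%N; set t := (2 ^ (Jm - J))%N.
have tE : t = (2 * 2 ^ (Jm - J.+1))%N by rewrite -expnS subnSK.
have n0 : (0 < n)%N by rewrite muln_gt0 expn_gt0.
have tp : (0 < t)%N by rewrite expn_gt0.
have ntN : (n * t)%N = N.
  by rewrite /n /t /N /t0 -mulnA mulnCA -expnD subnKC // ltnW.
have hijT : (i + j <= T0)%N.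
  by apply: (@TJ_le _ _ t); [rewrite tE|rewrite leq_exp2l // leq_subr].
pose P : R := (2 ^ J)%:R.
have P1 : 1 <= P by rewrite ler1n expn_gt0.
have P0 : P != 0 by rewrite gt_eqF // (lt_le_trans ltr01).
pose h : R := 2 / P.
have h0 : 0 <= h by rewrite divr_ge0 // (le_trans ler01).
have h2 : h <= 2 by rewrite ler_pdivrMr ?(lt_le_trans ltr01) // ler_peMr.
(* Under x = (2v + 1) / P the odd multiples of 1 / P become the nodes v = 0, 1, ..., n - 1, and h =
   2 / P is dx/dv. *)
pose f sg (v : R) := \sum_(s in E) Cs i j s * (h * wb s) ^+ sg * expR ((2 * v + 1) / P * wb s).
have df : dfam f.
  move=> sg v; apply: (@is_derive_bigsum R _ _ _
    (fun s v => Cs i j s * (h * wb s) ^+ sg * expR ((2 * v + 1) / P * wb s))) => s.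
  have hd := @is_derive_affexp R (Cs i j s * (h * wb s) ^+ sg) P (wb s) v.
  by apply: (is_derive_eq hd); rewrite exprSr mulrA.
have CZ s : 0 <= `|Cs i j s| <= (coefC * 2 ^ (T0 * beta))%N%:R by rewrite normr_ge0 Cs_le.
have hw s sg : `|(h * wb s) ^+ sg| <= (h * W%:R) ^+ sg.
  rewrite normrX; apply: lerXn2r; rewrite ?nnegrE ?(mulr_ge0 h0) //.
  by rewrite normrM [`|h|]ger0_norm // ler_wpM2l // wb_le.
(* At a node the exact sum vanishes, so only the error of replacing y^x by exp(x wb) remains, of
   relative size X e0. The factor (2W)^t0 covers the powers of h wb. *)
pose eta := Zb%:R * (X%:R * e0) * ((2 * W) ^ t0)%N%:R.
have eta0 : 0 <= eta by rewrite !mulr_ge0 ?e0_ge0.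
pose D := Zb%:R * (h * W%:R) ^+ N.
have W1 : (1 : R) <= (2 * W)%N%:R by rewrite ler1n.
have hW : (h * W%:R) <= (2 * W)%N%:R by rewrite natrM ler_wpM2r.
have heta m sg : (m < n)%N -> (sg < t)%N -> `|f sg m%:R| <= eta.
  move=> mn st; have nuJ : ((2 * m).+1 < 2 ^ J * X)%N by apply: node_lt.
  have xx : x_ J (2 * m).+1 = (2 * m%:R + 1) / P by rewrite /x_ /P -addn1 natrD natrM.
  have hx := @x_bounds J (2 * m).+1 (ltnW nuJ).
  have van0 : \sum_(s in E) Cs i j s * wb s ^+ sg * y s `^ x_ J (2 * m).+1 = 0.
    apply: (@wb_sum E _ (TJ J)) => [i' j' hij'|].
      by apply: van => //=; rewrite oddM.
    by rewrite /TJ -/t; apply: TJ_lt; rewrite // tE.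
  have -> : f sg m%:R = \sum_(s in E) Cs i j s * (h * wb s) ^+ sg *
      (expR (x_ J (2 * m).+1 * wb s) - y s `^ x_ J (2 * m).+1).
    under [RHS]eq_bigr => s _ do rewrite mulrBr.
    rewrite sumrB [X in _ - X](_ : _ = h ^+ sg * \sum_(s in E) Cs i j s * wb s ^+ sg * y s `^ x_ J (2 * m).+1).
      by rewrite van0 mulr0 subr0 /f xx.
    by rewrite mulr_sumr; apply: eq_bigr => s _; rewrite exprMn; ring.
  apply: (le_trans (ler_norm_sum _ _ _)).
  apply: le_trans (_ : _ <= \sum_(s in E) (`|Cs i j s| * (2 * 2 ^+ (H2 * X.+1))) * (X%:R * e0 * ((2 * W) ^ t0)%N%:R)) _.
    apply: ler_sum => s _; rewrite !normrM.
    rewrite [X in _ <= X](_ : _ = `|Cs i j s| * ((2 * W) ^ t0)%N%:R * (2 * 2 ^+ (H2 * X.+1) * (X%:R * e0))); last by ring.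
    apply: ler_pM; rewrite ?mulr_ge0 //; last exact: pow_diff_le.
    rewrite ler_wpM2l //; apply: (le_trans (hw s sg)); rewrite natrX.
    apply: le_trans (_ : _ <= (2 * W)%N%:R ^+ sg) _.
      by apply: lerXn2r; rewrite ?nnegrE ?(mulr_ge0 h0).
    rewrite ler_weXn2l //; apply: leq_trans (ltnW st) _.
    by rewrite leq_exp2l // leq_subr.
  rewrite -mulr_suml [X in _ <= X](_ : eta = Zb%:R * (X%:R * e0 * ((2 * W) ^ t0)%N%:R)); last by rewrite /eta; ring.
  rewrite ler_wpM2r ?mulr_ge0 ?e0_ge0 //.
  by apply: sum_le_Zb => // s; rewrite lexx mulr_ge0 // exprn_ge0.
have hD v : -1 <= v <= n%:R -> `|f (n * t)%N v| <= D.
  move=> /andP [v1 v2]; rewrite ntN.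
  have hx : -1 <= (2 * v + 1) / P <= X.+1%:R.
    have PX : n%:R * 2 = P * X%:R :> R by rewrite /P /n /X -!natrM node_mul.
    rewrite ler_pdivlMr ?ler_pdivrMr ?(lt_le_trans ltr01) // mulrC -addn1 natrD.
    by apply/andP; split; nra.
  apply: (le_trans (ler_norm_sum _ _ _)).
  apply: le_trans (_ : _ <= \sum_(s in E) (`|Cs i j s| * (2 * 2 ^+ (H2 * X.+1))) * (h * W%:R) ^+ N) _.
    apply: ler_sum => s _; rewrite !normrM.
    rewrite [X in _ <= X](_ : _ = `|Cs i j s| * (h * W%:R) ^+ N * (2 * 2 ^+ (H2 * X.+1))); last by ring.
    apply: ler_pM; rewrite ?mulr_ge0 //; first by rewrite ler_wpM2l.
    by rewrite ger0_norm ?expR_ge0 // exp_wb_le.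
  rewrite -mulr_suml ler_wpM2r ?exprn_ge0 ?(mulr_ge0 h0) //.
  by apply: sum_le_Zb => // s; rewrite lexx mulr_ge0 // exprn_ge0.
(* The solution of (2v + 1) / P = nu / 2^(J+1). *)
pose v : R := nu%:R / 4 - 1 / 2.
have vn : -1 < v < n%:R.
  have nu0 : 0 <= nu%:R :> R by [].
  have : nu%:R < n%:R * 4 :> R.
    rewrite -natrM ltr_nat; apply: leq_trans nuX _.
    by rewrite /n /X expnS node_mul4.
  by rewrite /v => hnu; apply/andP; split; lra.
have xv : x_ J.+1 nu = (2 * v + 1) / P.
  by rewrite /x_ /v expnS natrM -/P; field.
have hx := @x_bounds J.+1 nu (ltnW nuX).
have := hermite_bound n0 tp df eta0 heta hD vn.
rewrite ntN => main.
have f0 : `|\sum_(s in E) Cs i j s * y s `^ x_ J.+1 nu - f 0%N v| <= Zb%:R * (X%:R * e0).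
  rewrite /f -sumrB; apply: (le_trans (ler_norm_sum _ _ _)).
  apply: le_trans (_ : _ <= \sum_(s in E) (`|Cs i j s| * (2 * 2 ^+ (H2 * X.+1))) * (X%:R * e0)) _.
    apply: ler_sum => s _; rewrite expr0 mulr1 -xv -mulrBr normrM -mulrA ler_wpM2l //.
    by rewrite distrC pow_diff_le.
  rewrite -mulr_suml ler_wpM2r ?mulr_ge0 ?e0_ge0 //.
  by apply: sum_le_Zb => // s; rewrite lexx mulr_ge0 // exprn_ge0.
rewrite -[\sum_(s in E) _](subrK (f 0%N v)).
apply: (le_trans (ler_normD _ _)); apply: (le_trans (lerD f0 main)).
rewrite /Small addrCA; apply: lerD.
  (* Here h (n + 1) = 2 (P X1 + 1) / P is at most X + 2, whence the base W (X + 2) in [Small]. *)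
  rewrite ler_wpM2r ?invr_ge0 // /D -mulrA ler_wpM2l // -exprMn.
  apply: lerXn2r; [by rewrite nnegrE (mulr_ge0 (mulr_ge0 h0 _))|by rewrite nnegrE|].
  rewrite natrM [h * _]mulrC -mulrA ler_wpM2l //.
  rewrite /h mulrAC ler_pdivrMr ?(lt_le_trans ltr01) // /n /X -!natrM ler_nat.
  by apply: node_count; rewrite expn_gt0.
rewrite mulrDr mulr1 [X in X <= _]addrC; apply: lerD; last by rewrite mulrA.
rewrite [X in _ <= X](_ : _ = eta * (N * ((X1 * t0).+1 * t0) ^ N)%N%:R); last first.
  by rewrite /eta -mulnA natrM; ring.
rewrite -mulrA ler_wpM2l // -natrX -natrM ler_nat leq_mul2l; apply/orP; right.
rewrite leq_exp2r; last by rewrite muln_gt0 X1_gt0 expn_gt0.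
apply: leq_mul; last by rewrite leq_exp2l // leq_subr.
by rewrite ltnS /n mulnC leq_mul2l leq_exp2l // ltnW ?orbT.
Qed.

Lemma level_step J E : (J < Jm)%N -> Inv J E -> exists E', Inv J.+1 E'.
Proof.
move=> JJ hE; have [[s0 s0E cs0] cls van] := hE.
(* The class kept is that of an s0 with c s0 nonzero, so the surviving relation is never trivial. *)
exists [set s in E | `[< exists k, root_of y J.+1 s0 s k >]]; split.
- exists s0 => //; rewrite inE s0E; apply/asboolP; exists 1; split; rewrite ?ltr01 //.
    exact: inK1.
  by rewrite expr1n divff // gt_eqF.
- move=> s s'; rewrite !inE => /andP [_ /asboolP [k [kK kp ek]]] /andP [_ /asboolP [k' [kK' kp' ek']]].
  exists (k' / k); split; [by apply: inKM => //; apply: inKV|by rewrite divr_gt0|].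
  rewrite expr_div_n ek ek'; field; by rewrite !gt_eqF.
- move=> i j nu hij nuo nuX.
  have ana := analytic_step JJ hE hij nuo nuX.
  have hijT : (i + j <= T0)%N.
    apply: (@TJ_le _ _ (2 * 2 ^ (Jm - J.+1))); first by [].
    by rewrite -expnS subnSK // leq_exp2l // leq_subr.
  have hx := x_bounds (ltnW nuX).
  have pw : (2 : R) ^+ (H2 * X) <= 2 * 2 ^+ (H2 * X.+1).
    rewrite -exprS ler_weXn2l ?ler1n // (leq_trans _ (leqnSn _)) //.
    by rewrite leq_mul2l leqnSn orbT.
  have [|||h1 h2] := @class_dichotomy R I y y_gt0 yK y_intg rank3 J E s0
     (fun s => c s * z1 s ^+ i * z2 s ^+ j) nu Zb%:R s0E _ nuo Zb_ge1.
  + by move=> s sE; apply: cls.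
  + apply: sum_le_Zb => s; first by rewrite normr_ge0 Cs_le.
    by rewrite powR_ge0 /= (le_trans _ pw) // y_pow_le.
  + apply: sum_le_Zb => s; first by rewrite normr_ge0 Cs_le.
    by rewrite powR_ge0 /= (le_trans _ pw) // cy_pow_le.
  rewrite -[RHS]h2.
    by apply: eq_bigl => s; rewrite inE.
  apply/eqP/negPn/negP => /h1; apply/negP; rewrite -ltNge; apply: le_lt_trans num.
  by rewrite ler_wpM2r // exprn_ge0.
Qed.

Lemma level_all E : Inv 0 E -> exists E', Inv Jm E'.
Proof.
move=> h0; suff : forall J, (J <= Jm)%N -> exists E', Inv J E' by apply.
elim=> [|J IH] hJ; first by exists E.
by have [E' h] := IH (ltnW hJ); apply: level_step h.
Qed.

(** As t0 >= 16 H2 and (17/16)^16 >= 2, the t0-th roots of y lie in [1, 17/16] and those of the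
    conjugates are at most 17/16. The t0-th power of the difference of the two roots is an integer
    of K; it is at most 16^-t0 in modulus and its conjugate at most (17/8)^t0. The product is below
    1, so the difference is 0. *)
Lemma small_height s s' u : root_of y Jm s s' u -> y s = y s'.
Proof.
move=> [uK u0 ue].
have tp : (0 < t0)%N by rewrite expn_gt0.
have bern : 2 ^+ H2 <= (17 / 16 : R) ^+ t0.
  apply: le_trans (_ : _ <= (17 / 16 : R) ^+ (16 * H2)) _; last first.
    by rewrite ler_weXn2l //; lra.
  have h16 : 2 <= (17 / 16 : R) ^+ (2 * 2 * 2 * 2) by rewrite !exprM !expr2; lra.
  by rewrite exprM; apply: lerXn2r; rewrite ?nnegrE ?exprn_ge0 // (le_trans _ h16).
pose r s := y s `^ (1%:R / t0%:R).
have rE v : r v ^+ t0 = y v by rewrite powR_frac // ?expr1 // ltW.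
have r0 v : 0 < r v by apply: powR_gt0.
have r1 v : 1 <= r v by rewrite -(@ler_pXn2r _ t0) ?nnegrE ?(ltW (r0 v)) // rE expr1n.
have r2 v : r v <= 17 / 16.
  rewrite -(@ler_pXn2r _ t0) ?nnegrE ?(ltW (r0 v)) //.
  by rewrite rE; apply: le_trans bern.
have ru : r s' = r s * u.
  apply: (@exprI_pos _ t0); rewrite // ?mulr_gt0 // exprMn !rE ue mulrC divfK //.
  by rewrite gt_eqF.
have ri v : intg (r v) by apply: (@intg_root _ _ t0) => //; rewrite rE.
apply: contrapT => ne.
have u1 : u - 1 != 0.
  by rewrite subr_eq0; apply/eqP => u1; apply: ne; rewrite -!rE ru u1 mulr1.
have xK : inK ((r s' - r s) ^+ t0).
  have -> : (r s' - r s) ^+ t0 = y s * (u - 1) ^+ t0.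
    by rewrite ru -{2}[r s]mulr1 -mulrBr exprMn rE.
  by apply: inKM => //; apply: inKX; apply: inKB => //; apply: inK1.
have xi : intg ((r s' - r s) ^+ t0) by apply: intgX; apply: intgD => //; apply: intgN.
have x0 : (r s' - r s) ^+ t0 != 0.
  by rewrite expf_neq0 // ru -{2}[r s]mulr1 -mulrBr mulf_neq0 // gt_eqF.
have := intg_norm_ge1 xK xi x0; apply/negP; rewrite -ltNge.
have -> : cj ((r s' - r s) ^+ t0) = cj (y s) * (cj u - 1) ^+ t0.
  rewrite ru -{2}[r s]mulr1 -mulrBr exprMn rE cjM //; last first.
    by apply: inKX; apply: inKB => //; apply: inK1.
  by rewrite cjX ?cjB ?cj1 //; [apply: inK1|apply: inKB => //; apply: inK1].
pose q v := `|cj (y v)| `^ (1%:R / t0%:R).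
have qE v : q v ^+ t0 = `|cj (y v)| by rewrite powR_frac // expr1.
have q0 v : 0 <= q v by apply: powR_ge0.
have q2 v : q v <= 17 / 16.
  rewrite -(@ler_pXn2r _ t0) ?nnegrE //.
  by rewrite qE; apply: le_trans bern.
have qu : q s' = q s * `|cj u|.
  have cy : `|cj (y s)| != 0 by rewrite normr_eq0 cj_eq0 // gt_eqF.
  have e1 : q s' ^+ t0 = (q s * `|cj u|) ^+ t0.
    rewrite exprMn !qE -normrX -cjX // ue cjM //; last exact: inKV.
    by rewrite cjV // normrM normfV mulrC divfK.
  by apply/eqP; rewrite -(@eqrXn2 _ t0) ?mulr_ge0 // e1.
rewrite normrM !normrX -qE -!exprMn.
have lt1 : `|r s' - r s| * (q s * `|cj u - 1|) < 1.
  apply: le_lt_trans (_ : 16^-1 * (q s' + q s) < 1); last first.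
    have := q2 s; have := q2 s'; lra.
  apply: ler_pM; rewrite ?mulr_ge0 //.
    rewrite ler_norml; have := r1 s; have := r1 s'; have := r2 s; have := r2 s'; lra.
  rewrite qu -{3}[q s]mulr1 -mulrDr ler_wpM2l //.
  by apply: (le_trans (ler_normB _ _)); rewrite normr1.
by rewrite exprn_ilt1 ?mulr_ge0 // -lt0n.
Qed.

Lemma no_Inv_last E : ~ Inv Jm E.
Proof.
move=> [[s0 s0E cs0] cls van].
have eqy s s' : s \in E -> s' \in E -> y s = y s'.
  by move=> sE sE'; have [u /small_height] := cls s s' sE sE'.
have [Et inj] := fiber eqy.
have mom i : (i <= t0)%N -> \sum_(s in E) (c s * z1 s ^+ i)%:~R = 0 :> R.
  move=> it; have h : (i + 0 < TJ Jm)%N.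
    by rewrite addn0 /TJ subnn expn0 muln1 addn2 ltnS (leq_trans it).
  have nuX : (1 < 2 ^ Jm * X)%N.
    apply: leq_trans (_ : 1 * X <= _)%N; first by rewrite mul1n /X -[2%N]muln1 leq_mul2l X1_gt0.
    by rewrite leq_mul2r expn_gt0 orbT.
  have := van i 0%N 1%N h isT nuX.
  have yp : y s0 `^ x_ Jm 1 != 0 by rewrite gt_eqF // powR_gt0.
  move=> e1; apply: (mulIf yp); rewrite mul0r -[RHS]e1 mulr_suml; apply: eq_bigr => s sE.
  by rewrite /Cs expr0 mulr1 (eqy s s0).
(* In place of a Vandermonde determinant, the moments are combined with the coefficients of a
   polynomial vanishing at every z1 s except z1 s0; its degree is below #|E| <= t0. *)
pose p : {poly R} := \prod_(s in E :\ s0) ('X - (z1 s)%:~R%:P).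
have sp : size p = #|E|.
  rewrite /p size_prod; last by move=> s _; rewrite polyXsubC_eq0.
  under eq_bigr => s _ do rewrite size_XsubC.
  rewrite sum_nat_const (cardsD1 s0 E) s0E muln2 -addnn -addnS addKn add1n //.
have : \sum_(s in E) (c s)%:~R * p.[(z1 s)%:~R] = 0.
  under eq_bigr => s _ do rewrite horner_coef mulr_sumr.
  rewrite exchange_big /= big1 // => i _.
  transitivity (p`_i * \sum_(s in E) (c s * z1 s ^+ i)%:~R); last first.
    by rewrite mom ?mulr0 // (leq_trans _ Et) // -sp ltnW.
  by rewrite mulr_sumr; apply: eq_bigr => s _; rewrite intrM rmorphXn /=; ring.
rewrite (bigD1 s0) //= big1 ?addr0 => [|s /andP [sE ss0]]; last first.
  by rewrite /p (bigD1 s) ?inE ?ss0 //= hornerM hornerXsubC subrr mul0r mulr0.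
move/eqP; rewrite mulf_eq0 intr_eq0 (negPf cs0) /= /p horner_prod => /eqP h.
have : \prod_(s in E :\ s0) ('X - (z1 s)%:~R%:P).[(z1 s0)%:~R] != 0 :> R.
  apply/prodf_neq0 => s; rewrite !inE => /andP [ss0 sE].
  rewrite !hornerE subr_eq0 eqr_int; apply/eqP => e1.
  by move: ss0; rewrite (inj _ _ s0E sE e1) eqxx.
by rewrite h eqxx.
Qed.

End Coefs.

Theorem descent : False.
Proof.
have [c [[s0 cs0] c_le van]] := exists_coef.
have h0 : Inv c 0 [set: I].
  split; first by exists s0.
  - move=> s s' _ _; exists (y s' / y s); split; rewrite ?expr1 ?divr_gt0 //.
    by apply: inKM => //; apply: inKV.
  - move=> i j nu hij nuo; rewrite mul1n => nuX.
    have T0E : (t0 + 2 * 2 ^ (Jm - 0) = T0)%N by rewrite subn0.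
    rewrite T0E in hij.
    have iT : (i < T0)%N by apply: leq_ltn_trans hij; rewrite leq_addr.
    have jT : (j < T0)%N by apply: leq_ltn_trans hij; rewrite leq_addl.
    rewrite -[RHS](van i j nu iT jT nuo nuX); apply: eq_big => [s|s _]; first by rewrite inE.
    by rewrite expn0 divr1 powR_mulrn // ltW.
have [E' hE'] := level_all c_le h0.
exact: no_Inv_last hE'.
Qed.

End Descent.

(** * Choice of parameters *)

(** A 4 by 3 matrix has a nonzero rational left kernel vector. Its denominators are cleared and the
    vector is halved until an entry is odd; [main] does this by descent on a fixed nonzero entry. *)
Lemma int_relation (A : 'M[int]_(4, 3)) : exists n : nat -> int,
  (exists2 i, (i < 4)%N & ~~ (2 %| n i)%Z) /\ forall j, \sum_(i < 4) n i * A i j = 0.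
Proof.
pose B : 'M[rat]_(4, 3) := map_mx intr A.
have [i0 u0] : exists i, row i (kermx B) != 0.
  apply/existsP; apply: contraTT (isT : true) => /existsPn h.
  have : kermx B = 0 by apply/row_matrixP => i; rewrite row0; apply/eqP; have := h i; rewrite negbK.
  move/eqP; rewrite -mxrank_eq0 mxrank_ker subn_eq0 => h4.
  by have := leq_trans h4 (rank_leq_col B).
set u := row i0 _ in u0.
have uB : u *m B = 0 by apply/sub_kermxP; apply: row_sub.
pose dn := \prod_(i < 4) denq (u 0 i).
have dn0 : dn != 0 by apply/prodf_neq0 => i _; apply: denq_neq0.
have [n1 hn1] : exists n : 'I_4 -> int, forall i, (n i)%:~R = dn%:~R * u 0 i.
  have h i : exists n : int, n%:~R = dn%:~R * u 0 i.
    exists (numq (u 0 i) * \prod_(j < 4 | j != i) denq (u 0 j)).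
    have -> : dn = denq (u 0 i) * \prod_(j < 4 | j != i) denq (u 0 j) by rewrite /dn (bigD1 i).
    rewrite !intrM -[X in _ = _ * X](divq_num_den (u 0 i)); field.
    by rewrite intr_eq0 denq_neq0.
  by exists (fun i => projT1 (cid (h i))) => i; exact: (projT2 (cid (h i))).
have rel1 j : \sum_(i < 4) n1 i * A i j = 0.
  apply: (@intr_inj rat); rewrite rmorph_sum rmorph0 /=.
  transitivity (dn%:~R * (u *m B) 0 j); last by rewrite uB mxE mulr0.
  by rewrite mxE mulr_sumr; apply: eq_bigr => i _; rewrite intrM hn1 !mxE mulrA.
have [i1 ni1] : exists i, n1 i != 0.
  have [j uj] : exists j, u 0 j != 0.
    apply/existsP; apply: contraNT u0 => /existsPn h; apply/eqP/rowP => j.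
    by have := h j; rewrite negbK => /eqP ->; rewrite mxE.
  by exists j; rewrite -(intr_eq0 rat) hn1 mulf_neq0 // intr_eq0.
have main : forall (m : nat) (n : 'I_4 -> int), (`|n i1| <= m)%N -> n i1 != 0 ->
    (forall j, \sum_(i < 4) n i * A i j = 0) ->
    exists n' : 'I_4 -> int, (exists i, ~~ (2 %| n' i)%Z) /\ forall j, \sum_(i < 4) n' i * A i j = 0.
  elim=> [|m IH] n hm n0 rel; first by move: n0; rewrite -absz_eq0 -leqn0 hm.
  have [/existsP [i hi]|/existsPn hall] := boolP [exists i, ~~ (2 %| n i)%Z].
    by exists n; split=> //; exists i.
  have hd i : n i = (n i %/ 2)%Z * 2 by apply/esym/divzK; have := hall i; rewrite negbK.
  apply: (IH (fun i => n i %/ 2)%Z).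
  - move: hm n0; rewrite (hd i1); move: (n i1 %/ 2)%Z => w.
    by rewrite mulzK // abszM /=; lia.
  - by apply: contraNneq n0 => h; rewrite (hd i1) h mul0r.
  - move=> j; apply: (mulfI (isT : 2 != 0 :> int)); rewrite mulr0 -[RHS](rel j) mulr_sumr.
    by apply: eq_bigr => i _; rewrite [in RHS](hd i); ring.
have [n [[i hi] hrel]] := main _ _ (leqnn _) ni1 rel1.
exists (fun i => n (inord i)); split.
  by exists i => //; rewrite inord_val.
by move=> j; rewrite -[RHS](hrel j); apply: eq_bigr => i' _; rewrite inord_val.
Qed.

(** * Numerical conditions of the descent *)

Section Numerics.
Variable R : realType.

(** n^n / n! is one term of the exponential series at n, hence at most e^n; the crude e <= 4 is
    enough. *)
Lemma fact_lower (n : nat) : n%:R ^+ n / n`!%:R <= (4 : R) ^+ n.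
Proof.
case: n => [|n]; first by rewrite !expr0 fact0 divr1.
have h1 : expR 2^-1 <= 2 :> R.
  have h2 := @expR_ge1Dx R (- 2^-1).
  have h3 := @expRxMexpNx_1 R 2^-1.
  have h4 := @expR_gt0 R 2^-1.
  nra.
have h5 : expR 1 <= 4 :> R.
  have -> : (1 : R) = 2^-1 + 2^-1 by field.
  have h4 := @expR_gt0 R 2^-1.
  by rewrite expRD; nra.
apply: le_trans (_ : _ <= expR (n.+1%:R)) _.
  apply: le_trans (expR_ge1Dxn _ (ler0n _ _)); by rewrite ler_wpDl.
rewrite -[n.+1%:R]mulr1 expRM_natl lerXn2r ?nnegrE ?expR_ge0 //.
Qed.

Lemma Zb_le (I : finType) (beta H2 X1 Jm m : nat) : (#|I| <= 2 ^ m)%N ->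
  (Zb I beta H2 X1 Jm <= 2 ^ (2 + 2 * m + 9 * 2 ^ Jm * beta + H2 * (4 * X1 + 1)))%N.
Proof.
move=> hM; rewrite /Zb /coefC /coefA; move: (2 ^ Jm)%N => t0.
have -> : (2 + 2 * m + 9 * t0 * beta + H2 * (4 * X1 + 1) =
  (1 + m + (1 + m + (2 * (3 * t0) * beta + H2 * (2 * X1))) + (3 * t0 * beta) + H2 * (2 * X1).+1))%N.
  by rewrite -addn1; ring.
rewrite !expnD !expn1; do 2 apply: leq_mul => //.
by apply: leq_mul; apply: leq_mul => //; apply: leq_mul.
Qed.

(** Each of the two terms of [Small], multiplied by Zb^15, is at most 1/4. For the first, Zb^16 <=
    2^(5N-2), while the remainder gains 128^-N and loses at most 4^N from N^N / N!, in all 2^(-5N).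
    The second is beaten by the size of V. *)
Lemma num_ok (I : finType) (beta H2 X1 Jm m V : nat) (e0 : R) :
  let t0 := (2 ^ Jm)%N in let N := (X1 * t0)%N in
  (#|I| <= 2 ^ m)%N -> 0 <= e0 <= 2 ^- V -> (0 < N)%N ->
  (16 * (2 + 2 * m + 9 * t0 * beta + H2 * (4 * X1 + 1)) + 2 <= 5 * N)%N ->
  (128 * (H2.+1 * (2 * X1).+2) <= N)%N ->
  (2 * X1 <= 2 ^ beta)%N -> (2 * H2.+1 <= 2 ^ beta)%N -> (N <= 2 ^ beta)%N ->
  ((X1 * t0).+1 * t0 <= 2 ^ (2 * beta))%N ->
  (5 * N + beta + (beta * t0 + beta + 2 * beta * N) + 3 <= V)%N ->
  Small I e0 beta H2 X1 Jm * (Zb I beta H2 X1 Jm)%:R ^+ 15 < 1.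
Proof.
move=> t0 N hM /andP [e00 e0V] N0 h1 h2 hX hW hN hP hV.
have Zle := Zb_le beta H2 X1 Jm hM.
set Z : R := (Zb I beta H2 X1 Jm)%:R.
have Z0 : 0 <= Z by [].
have Z16 : Z ^+ 16 <= 2 ^+ (5 * N - 2).
  apply: le_trans (_ : _ <= (2 ^+ (2 + 2 * m + 9 * t0 * beta + H2 * (4 * X1 + 1))) ^+ 16) _.
    by apply: lerXn2r; rewrite ?nnegrE ?exprn_ge0 // -natrX ler_nat.
  rewrite -exprM ler_weXn2l ?ler1n // mulnC.
  by rewrite -(leq_add2r 2) subnK // (leq_trans _ h1) // leq_addl.
have p5 : (2 <= 5 * N)%N by apply: leq_trans h1; rewrite leq_addl.
have two k : 0 < (2 : R) ^+ k by apply: exprn_gt0.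
have t1 : Z ^+ 16 * ((H2.+1 * (2 * X1).+2)%:R ^+ N / N`!%:R) <= 4^-1.
  have q1 : (H2.+1 * (2 * X1).+2)%:R ^+ N / N`!%:R <= (2 ^+ (5 * N))^-1 :> R.
    have NR : 0 < N%:R :> R by rewrite ltr0n.
    apply: le_trans (_ : _ <= ((H2.+1 * (2 * X1).+2)%:R / N%:R) ^+ N * (N%:R ^+ N / N`!%:R)) _.
      rewrite expr_div_n mulrA divfK // expf_neq0 // gt_eqF //.
    apply: le_trans (_ : _ <= (128^-1) ^+ N * 4 ^+ N) _.
      apply: ler_pM; rewrite ?exprn_ge0 ?divr_ge0 ?exprn_ge0 //; last exact: fact_lower.
      apply: lerXn2r; rewrite ?nnegrE ?divr_ge0 ?invr_ge0 //.
      by rewrite ler_pdivrMr // mulrC ler_pdivlMr // mulrC -natrM ler_nat.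
    rewrite -exprMn exprM -exprVn lerXn2r ?nnegrE ?mulr_ge0 ?invr_ge0 ?exprn_ge0 //.
    by rewrite !exprS expr0; lra.
  apply: le_trans (_ : _ <= 2 ^+ (5 * N - 2) * (2 ^+ (5 * N))^-1) _.
    by apply: ler_pM; rewrite ?exprn_ge0 ?divr_ge0 ?exprn_ge0.
  rewrite -[in X in _ / X](subnK p5) exprD invfM mulrA divff ?mul1r ?gt_eqF //.
  by rewrite !exprS expr0; lra.
set big := ((2 * H2.+1) ^ t0 * N * ((X1 * t0).+1 * t0) ^ N)%N.
have bigle : (big <= 2 ^ (beta * t0 + beta + 2 * beta * N))%N.
  rewrite !expnD; apply: leq_mul; last by rewrite expnM leq_exp2r.
  by apply: leq_mul => //; rewrite expnM leq_exp2r // expn_gt0.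
have t2 : Z ^+ 16 * ((2 * X1)%:R * e0 * (big%:R + 1)) <= 4^-1.
  apply: le_trans (_ : _ <= 2 ^+ (5 * N - 2) * (2 ^+ beta * 2 ^- V * 2 ^+ (beta * t0 + beta + 2 * beta * N).+1)) _.
    apply: ler_pM; rewrite ?exprn_ge0 // ?mulr_ge0 ?addr_ge0 //.
    apply: ler_pM; rewrite ?mulr_ge0 ?addr_ge0 //.
      by apply: ler_pM => //; rewrite -natrX ler_nat.
    rewrite exprSr mulr_natr mulr2n; apply: lerD.
      by rewrite -natrX ler_nat.
    by apply: exprn_ege1; rewrite ler1n.
  rewrite mulrAC [_ * 2 ^- V]mulrC mulrCA -!exprD.
  rewrite mulrC ler_pdivrMr // ler_pdivlMl //.
  have -> : (4 : R) = 2 ^+ 2 by rewrite !exprS expr0; lra.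
  rewrite -exprD ler_weXn2l ?ler1n //; apply: leq_trans hV.
  by move: p5; move: (5 * N)%N => n5 p5; lia.
rewrite /Small -/t0 -/N -/big -/Z.
have -> : (Z * (H2.+1 * (2 * X1).+2)%:R ^+ N / N`!%:R + Z * (2 * X1)%:R * e0 * (big%:R + 1)) * Z ^+ 15
  = Z ^+ 16 * ((H2.+1 * (2 * X1).+2)%:R ^+ N / N`!%:R) + Z ^+ 16 * ((2 * X1)%:R * e0 * (big%:R + 1)).
  by rewrite (exprS Z 15); ring.
by apply: le_lt_trans (lerD t1 t2) _; lra.
Qed.
End Numerics.

Section ArithFacts.
Local Open Scope nat_scope.

Lemma arith_siegel a x : 4 * (3 * a * (3 * a) * x) = 36 * (a * a * x).
Proof. lia. Qed.

(** In units of b'h' the leading terms cost 16 (9 * 512 + 128) = 75776 against 5 * 32 * 512 = 81920;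
    the margin pays for the rest. The factor 32 in X1 is what makes 16 * 9 < 5 * 32. *)
Lemma arith_exp b' m' h' : 1024 <= h' -> 0 < b' -> m' <= b' ->
  16 * (2 + 2 * m' + 9 * (512 * h') * b' + h' * (4 * (32 * b') + 1)) + 2 <= 5 * (32 * b' * (512 * h')).
Proof.
move=> h1 h2 h3; have h4 : h' <= b' * h' by rewrite leq_pmull.
have h5 : 1024 * b' <= b' * h' by rewrite mulnC leq_mul2l h1 orbT.
have -> : 9 * (512 * h') * b' = 4608 * (b' * h') by lia.
have -> : h' * (4 * (32 * b') + 1) = 128 * (b' * h') + h' by lia.
have -> : 5 * (32 * b' * (512 * h')) = (80 * 1024) * (b' * h') by lia.
move: (b' * h') h4 h5 => p h4 h5; lia.
Qed.

Lemma arith_gain b' h' : 1024 <= h' -> 0 < b' ->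
  128 * (h'.+1 * (2 * (32 * b')).+2) <= 32 * b' * (512 * h').
Proof.
move=> h1 h2; have h4 : h' <= b' * h' by rewrite leq_pmull.
have h5 : 1024 * b' <= b' * h' by rewrite mulnC leq_mul2l h1 orbT.
have -> : 128 * (h'.+1 * (2 * (32 * b')).+2) = 128 * (64 * (b' * h') + 64 * b' + 2 * h' + 2) by lia.
have -> : 32 * b' * (512 * h') = (16 * 1024) * (b' * h') by lia.
move: (b' * h') h4 h5 => p h4 h5; lia.
Qed.

Lemma arith_V b' h' k : 8 <= b' -> 1024 <= h' -> 8 * (b' * (32 * b' * (512 * h'))) <= k ->
  5 * (32 * b' * (512 * h')) + b' + (b' * (512 * h') + b' + 2 * b' * (32 * b' * (512 * h'))) + 3 <= k - b'.
Proof.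
move=> h0 h1.
have h4 : b' <= b' * h' by rewrite leq_pmulr // (leq_trans _ h1).
have h5 : 8 * (b' * h') <= b' * (b' * h') by rewrite leq_mul2r h0 orbT.
have -> : 8 * (b' * (32 * b' * (512 * h'))) = (128 * 1024) * (b' * (b' * h')) by lia.
have -> : 5 * (32 * b' * (512 * h')) = (80 * 1024) * (b' * h') by lia.
have -> : b' * (512 * h') = 512 * (b' * h') by lia.
have -> : 2 * b' * (32 * b' * (512 * h')) = (32 * 1024) * (b' * (b' * h')) by lia.
move: (b' * (b' * h')) h5 => q; move: (b' * h') h4 => p; lia.
Qed.
End ArithFacts.

Section ParamFacts.
Local Open Scope nat_scope.
Variables (jb jl : nat).
(** With lam = 2^jl: S = 2^37 be lam, H = 2^41 be lam^2 = 16 S lam, t0 = 2^Jm = 2^9 H, X1 = 2^5 be,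
    and 2^m = S^3 lam counts the exponent triples. The 37 makes 2^m equal to 64 t0^2 X1, just above
    the 36 t0^2 X1 that Siegel's lemma asks for. *)
Let be := 2 ^ jb.
Let S := 2 ^ (37 + jb + jl).
Let H := 2 ^ (41 + jb + 2 * jl).
Let Jm := 50 + jb + 2 * jl.
Let X1 := 2 ^ (5 + jb).
Let m := 111 + 3 * jb + 4 * jl.
Hypothesis mbe : m <= be.

Lemma param_t0 : 2 ^ Jm = 2 ^ 9 * H.
Proof. by rewrite /H -expnD; congr (2 ^ _); rewrite /Jm; lia. Qed.
Lemma param_card : S * (S * 2 ^ jl) * S = 2 ^ m.
Proof. by rewrite /S -!expnD; congr (2 ^ _); rewrite /m; lia. Qed.
Lemma param_H : 16 * (S * 2 ^ jl) = H.
Proof. by rewrite (_ : 16 = 2 ^ 4) // /S /H -!expnD; congr (2 ^ _); lia. Qed.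
Lemma param_X1 : X1 = 32 * be.
Proof. by rewrite /X1 expnD. Qed.
Lemma param_N : X1 * 2 ^ Jm = 2 ^ (55 + 2 * jb + 2 * jl).
Proof. by rewrite /X1 /Jm -!expnD; congr (2 ^ _); lia. Qed.

Lemma param_siegel : 4 * (3 * 2 ^ Jm * (3 * 2 ^ Jm) * X1) <= 2 ^ m.
Proof.
have -> : 4 * (3 * 2 ^ Jm * (3 * 2 ^ Jm) * X1) = 36 * 2 ^ (105 + 3 * jb + 4 * jl).
  rewrite (_ : 2 ^ (105 + 3 * jb + 4 * jl) = 2 ^ Jm * 2 ^ Jm * X1); first exact: arith_siegel.
  by rewrite /Jm /X1 -!expnD; congr (2 ^ _); lia.
apply: leq_trans (_ : 2 ^ 6 * 2 ^ (105 + 3 * jb + 4 * jl) <= _); first by rewrite leq_mul2r orbT.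
by rewrite -expnD leq_exp2l // /m; lia.
Qed.

Lemma be_gt0 : 0 < be. Proof. by rewrite expn_gt0. Qed.
Lemma H_ge : 2 ^ 10 <= H. Proof. by rewrite leq_exp2l //; lia. Qed.

Lemma param_exp : 16 * (2 + 2 * m + 9 * 2 ^ Jm * be + H * (4 * X1 + 1)) + 2 <= 5 * (X1 * 2 ^ Jm).
Proof.
by rewrite param_t0 param_X1; apply: arith_exp; [exact: H_ge|exact: be_gt0|exact: mbe].
Qed.

Lemma param_gain : 128 * (H.+1 * (2 * X1).+2) <= X1 * 2 ^ Jm.
Proof.
by rewrite param_t0 param_X1; apply: arith_gain; [exact: H_ge|exact: be_gt0].
Qed.

Lemma param_2X1 : 2 * X1 <= 2 ^ be.
Proof.
rewrite (_ : 2 * X1 = 2 ^ (6 + jb)); last by rewrite /X1 -expnS.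
by rewrite leq_exp2l //; apply: leq_trans mbe; rewrite /m; lia.
Qed.
Lemma param_2H : 2 * H.+1 <= 2 ^ be.
Proof.
apply: leq_trans (_ : 2 ^ 2 * H <= _).
  have := H_ge; rewrite [2 ^ 2](_ : _ = 4) // [2 ^ 10](_ : _ = 1024) //; move: H => h' h1; lia.
by rewrite /H -expnD leq_exp2l //; apply: leq_trans mbe; rewrite /m; lia.
Qed.
Lemma param_Nle : X1 * 2 ^ Jm <= 2 ^ be.
Proof. by rewrite param_N leq_exp2l //; apply: leq_trans mbe; rewrite /m; lia. Qed.
Lemma param_P : (X1 * 2 ^ Jm).+1 * 2 ^ Jm <= 2 ^ (2 * be).
Proof.
apply: leq_trans (_ : 2 * (X1 * 2 ^ Jm) * 2 ^ Jm <= _).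
  rewrite leq_mul2r; apply/orP; right; have : 0 < X1 * 2 ^ Jm by rewrite muln_gt0 !expn_gt0.
  by move: (X1 * 2 ^ Jm) => x; lia.
rewrite param_N -expnS -expnD leq_exp2l //; apply: leq_trans (_ : m <= _); first by rewrite /m /Jm; lia.
by rewrite (leq_trans mbe) // leq_pmull.
Qed.
(** The threshold is 8 be N with N = X1 t0. The main cost is 2 be N, the number of bits allowed for
    the interpolation constant ((n+1)t)^N. *)
Lemma param_V k : 2 ^ (58 + 3 * jb + 2 * jl) <= k ->
  5 * (X1 * 2 ^ Jm) + be + (be * 2 ^ Jm + be + 2 * be * (X1 * 2 ^ Jm)) + 3 <= k - be.
Proof.
have -> : 2 ^ (58 + 3 * jb + 2 * jl) = 8 * (be * (X1 * 2 ^ Jm)).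
  by rewrite param_N (_ : 8 = 2 ^ 3) // -!expnD; congr (2 ^ _); lia.
rewrite param_X1 param_t0; apply: arith_V; last exact: H_ge.
by apply: leq_trans mbe; rewrite /m; lia.
Qed.
End ParamFacts.

Section BoxNat.
Local Open Scope nat_scope.
Variables (S lam h d k s1 t1 s2 s3 t3 B : nat).
Lemma box_exp : h <= 13 * lam -> s1 < S -> s2 < S * lam -> s3 < S ->
  lam * s1 + 2 * s2 + (h * s3 + h * (S - s3)) <= 16 * (S * lam).
Proof.
move=> h1 h2 h3 h4; rewrite -mulnDr subnKC ?(ltnW h4) //.
have a1 : lam * s1 <= S * lam by rewrite mulnC leq_mul2r ltnW ?orbT.
have a2 : h * S <= 13 * (S * lam) by rewrite [S * lam]mulnC mulnA leq_mul2r h1 orbT.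
by move: (lam * s1) (h * S) (S * lam) a1 a2 h3 => u v w; lia.
Qed.
Lemma box_z1 : S + d * S <= B -> s1 < S -> s3 < S -> s1 + d * s3 <= B.
Proof.
move=> h1 h2 h3; apply: leq_trans h1; rewrite leq_add ?leq_mul2l; lia.
Qed.
Lemma box_z2 : S * lam + k * S <= B -> s2 < S * lam -> s3 < S ->
  (`|s2%:Z - (k * s3)%:Z| <= B%:Z)%R.
Proof.
move=> h1 h2 h3; have h4 : k * s3 <= k * S by rewrite leq_mul2l ltnW ?orbT.
by move: (k * s3) (k * S) (S * lam) h1 h2 h4 => u v w; lia.
Qed.
Lemma box_double : 0 < B -> (2 * B).+2 <= 2 * (2 * B).
Proof. lia. Qed.
Lemma box_slack : s1 + B + s2 + 3 <= k -> B.+2 <= k.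
Proof. lia. Qed.
Lemma box_inj : S <= d -> s1 < S -> t1 < S -> s1 + d * s3 = t1 + d * t3 -> s3 = t3.
Proof.
move=> hSd h1 h2 e; have d0 : 0 < d by lia.
have e3 := congr1 (fun x => x %/ d) e.
by move: e3; rewrite ![_ + d * _]addnC ![d * _]mulnC !divnMDl // !divn_small ?addn0 //; lia.
Qed.
End BoxNat.

Lemma pow2_half (R : realType) a c : (a < c)%N -> 2 ^+ a * 2 ^- c <= 2^-1 :> R.
Proof.
move=> h; rewrite ler_pdivrMr ?exprn_gt0 // -(subnK h) addnS exprS exprD mulKf //.
by rewrite ler_peMl ?exprn_ge0 // exprn_ege1 // ler1n.
Qed.

Lemma ln_prod4 (R : realType) (A B C D : R) (n1 n2 n3 n4 : nat) : 0 < A -> 0 < B -> 0 < C -> 0 < D ->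
  ln (A ^+ n1 * B ^+ n2 * C ^+ n3 * D ^+ n4) = n1%:R * ln A + n2%:R * ln B + n3%:R * ln C + n4%:R * ln D.
Proof.
move=> hA hB hC hD; have := exprn_gt0 n1 hA; have := exprn_gt0 n2 hB.
have := exprn_gt0 n3 hC; have := exprn_gt0 n4 hD => h4 h3 h2 h1.
have h12 := mulr_gt0 h1 h2; have h123 := mulr_gt0 h12 h3.
rewrite lnM ?posrE // lnM ?posrE // lnM ?posrE //.
by rewrite !lnXn // !mulr_natl.
Qed.

(** * The box of exponents attached to a small linear form *)

Section Box.
Variables (R : realType) (b d k q lam h be S : nat) (gp gq : int).
Local Notation al := (1 + s2 R).
Let G : R := gp%:~R + gq%:~R * s2 R.
Let Lam : R := d%:R * ln b%:R - k%:R * ln al - (ln G - ln q%:R).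
Hypotheses (b2 : (2 <= b)%N) (b_le : (b <= 2 ^ lam)%N).
Hypotheses (G1 : 1 <= G) (G_le : G <= 2 ^+ h) (cG_le : `|cj G| <= 2 ^+ h).
Hypotheses (q1 : (1 <= q)%N) (q_le : (q <= 2 ^ h)%N) (h_le : (h <= 13 * lam)%N).
Hypotheses (Sd : (S <= d)%N) (S0 : (0 < S)%N) (lam0 : (0 < lam)%N).
Hypotheses (z1B : (S + d * S <= 2 ^ be)%N) (z2B : (S * lam + k * S <= 2 ^ be)%N).

(** The exponent of alpha runs lam times further than the others, because alpha has bounded size
    while b, G and q may have about lam bits. In the resulting bound 2^(16 S lam), 16 = 1 + 2 +
    13. *)
Let I : finType := ('I_S * 'I_(S * lam) * 'I_S)%type.
Let x1 (s : I) : nat := s.1.1.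
Let x2 (s : I) : nat := s.1.2.
Let x3 (s : I) : nat := s.2.
(** The power of q clears the denominator of (G/q)^x3, which keeps y s in Z[sqrt 2]. It also leaves
    the same S ln q in every logarithm, which becomes the constant [k0] of the descent. *)
Let y (s : I) : R := b%:R ^+ x1 s * al ^+ x2 s * G ^+ x3 s * q%:R ^+ (S - x3 s).
Let z1 (s : I) : int := (x1 s + d * x3 s)%N.
Let z2 (s : I) : int := (x2 s)%:Z - (k * x3 s)%N%:Z.
Let e (s : I) : R := - (x3 s)%:R * Lam.

Let s2_0 : 0 < s2 R. Proof. exact: s2_gt0. Qed.
Let s2_2 : s2 R <= 2. Proof. by have := s2_sq R; have := s2_gt0 R => h1 h2; nra. Qed.
Let s2_1 : 1 <= s2 R. Proof. by have := s2_sq R; have := s2_gt0 R => h1 h2; nra. Qed.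
Let bR : 0 < b%:R :> R. Proof. by rewrite ltr0n; apply: leq_trans b2. Qed.
Let qR : 0 < q%:R :> R. Proof. by rewrite ltr0n. Qed.
Let aR : 0 < al. Proof. exact: addr_gt0. Qed.
Let GR : 0 < G. Proof. exact: lt_le_trans G1. Qed.
Let q0 : q%:R != 0 :> R. Proof. by rewrite gt_eqF. Qed.

Let ZK (x : R) := exists p q : int, x = p%:~R + q%:~R * s2 R.
Let ZKM x x' : ZK x -> ZK x' -> ZK (x * x').
Proof.
move=> [p [r ->]] [p' [r' ->]]; exists (p * p' + 2 * (r * r')), (p * r' + r * p').
rewrite !rmorphD !rmorphM /=; have := s2_sq R; move: (s2 R) => s hs.
by transitivity (p%:~R * p'%:~R + (r%:~R * r'%:~R) * (s * s) + (p%:~R * r'%:~R + r%:~R * p'%:~R) * s); [ring|rewrite hs; ring].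
Qed.
Let ZKX x n : ZK x -> ZK (x ^+ n).
Proof.
move=> h0; elim: n => [|n IH]; first by exists 1, 0; rewrite expr0 mul0r addr0.
by rewrite exprS; apply: ZKM.
Qed.
Let ZKn (n : nat) : ZK n%:R.
Proof. by exists n%:Z, 0; rewrite mul0r addr0. Qed.
Let ZKa : ZK al. Proof. by exists 1, 1; rewrite mul1r. Qed.
Let yZ s : ZK (y s).
Proof. by apply: ZKM; [apply: ZKM; [apply: ZKM|]|]; apply: ZKX => //; [exists gp, gq]. Qed.

Let ZK_inK x : ZK x -> inK x.
Proof. by move=> [p [r ->]]; apply: inKD; [exact: inK_int|apply: inKM; [exact: inK_int|exact: inK_s2]]. Qed.
Let cj_nat (n : nat) : cj (n%:R : R) = n%:R. Proof. exact: (@cj_int R n). Qed.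
Let cj_al : cj al = 1 - s2 R.
Proof. by rewrite cjD ?cj1 ?cj_s2 //; [exact: inK1|exact: inK_s2]. Qed.
Let cj_y s : cj (y s) = b%:R ^+ x1 s * (1 - s2 R) ^+ x2 s * cj G ^+ x3 s * q%:R ^+ (S - x3 s).
Proof.
have kb n : inK (n%:R : R) by exact: (@inK_int R n).
have ka : inK al by apply: ZK_inK.
have kG : inK G by apply: ZK_inK; exists gp, gq.
rewrite /y !cjM ?cjX ?cj_nat ?cj_al //; do ?[by apply: inKX|by apply: inKM; apply: inKX];
by apply: inKM; [apply: inKM; apply: inKX|apply: inKX].
Qed.

Let y_ge1 s : 1 <= y s.
Proof.
have h1 : 1 <= b%:R :> R by rewrite ler1n (leq_trans _ b2).
have h2 : 1 <= q%:R :> R by rewrite ler1n.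
have h3 : 1 <= al by rewrite lerDl ltW.
by rewrite /y; do ?apply: mulr_ege1; apply: exprn_ege1.
Qed.

Let bound s (A C : R) : 0 <= A <= 2 ^+ 2 -> 0 <= C <= 2 ^+ h ->
  b%:R ^+ x1 s * A ^+ x2 s * C ^+ x3 s * q%:R ^+ (S - x3 s) <= 2 ^+ (16 * (S * lam)).
Proof.
move=> /andP [A0 A1] /andP [C0 C1].
apply: le_trans (_ : _ <= (2 ^+ lam) ^+ x1 s * (2 ^+ 2) ^+ x2 s * (2 ^+ h) ^+ x3 s * (2 ^+ h) ^+ (S - x3 s)) _.
  have hb : b%:R <= 2 ^+ lam :> R by rewrite -natrX ler_nat.
  have hq : q%:R <= 2 ^+ h :> R by rewrite -natrX ler_nat.
  have n2 n : 0 <= (2:R) ^+ n by apply: exprn_ge0.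
  by do 3?[apply: ler_pM]; rewrite ?mulr_ge0 ?exprn_ge0 ?(ltW bR) ?(ltW qR) //; apply: lerXn2r;
     rewrite ?nnegrE ?(ltW bR) ?(ltW qR).
rewrite -!exprM -!exprD ler_weXn2l ?ler1n // -addnA.
by apply: box_exp => //; apply: ltn_ord.
Qed.

Let y_le s : y s <= 2 ^+ (16 * (S * lam)).
Proof. by apply: bound; apply/andP; split => //; rewrite ?(ltW aR) ?(ltW GR) // -[2^+2]/(2 * 2); have := s2_0; have := s2_2 => u1 u2; lra. Qed.

Let cy_le s : `|cj (y s)| <= 2 ^+ (16 * (S * lam)).
Proof.
rewrite cj_y !normrM !normrX (ger0_norm (ltW bR)) (ger0_norm (ltW qR)); apply: bound; rewrite normr_ge0 //=.
by rewrite ler_norml -[2^+2]/(2 * 2); have := s2_0; have := s2_2 => u1 u2; apply/andP; split; lra.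
Qed.

Let z1_le s : `|z1 s| <= (2 ^ be)%N%:Z.
Proof.
rewrite ger0_norm // lez_nat; apply: (box_z1 z1B); exact: ltn_ord.
Qed.
Let z2_le s : `|z2 s| <= (2 ^ be)%N%:Z.
Proof. by apply: (box_z2 z2B); exact: ltn_ord. Qed.

Let lnE s : ln (y s) = ln b%:R * (z1 s)%:~R + ln al * (z2 s)%:~R + S%:R * ln q%:R + e s.
Proof.
rewrite /y ln_prod4 // /z1 /z2 /e /Lam.
have -> : (S - x3 s)%:R = S%:R - (x3 s)%:R :> R by rewrite natrB // ltnW // ltn_ord.
rewrite rmorphB /= -!pmulrn !natrD !natrM; ring.
Qed.

Let e_le e0 : `|Lam| <= e0 -> forall s, `|e s| <= S%:R * e0.
Proof.
move=> hL s; rewrite /e normrM normrN normr_nat; apply: ler_pM => //.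
by rewrite ler_nat ltnW // ltn_ord.
Qed.

Let ratioE s s0 : y s / y s0 = b%:R ^ ((x1 s)%:Z - (x1 s0)%:Z) * al ^ ((x2 s)%:Z - (x2 s0)%:Z)
  * (G / q%:R) ^ ((x3 s)%:Z - (x3 s0)%:Z).
Proof.
have hq t : q%:R ^+ (S - x3 t) = q%:R ^+ S / q%:R ^+ x3 t :> R.
  apply: (mulIf (expf_neq0 (x3 t) q0)).
  by rewrite divfK ?(expf_neq0 _ q0) // -exprD subnK // ltnW // ltn_ord.
have v (x : R) (n1 n2 : nat) : 0 < x -> x ^ (n1%:Z - n2%:Z) = x ^+ n1 / x ^+ n2.
  by move=> x0; rewrite expfzDr ?gt_eqF // exprnN.
rewrite /y !hq !v ?divr_gt0 // !expr_div_n; field.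
by rewrite ?expf_neq0 // ?gt_eqF.
Qed.

(** Each ratio is a monomial in b, alpha and G/q, and four exponent vectors in Z^3 are dependent. *)
Let rank3 (s0 : I) (f : nat -> I) : exists n : nat -> int,
  (exists2 i, (i < 4)%N & ~~ (2 %| n i)%Z) /\ \prod_(i < 4) (y (f i) / y s0) ^ (n i) = 1.
Proof.
pose A : 'M[int]_(4, 3) := \matrix_(i, j)
  ((nth 0%N [:: x1 (f i); x2 (f i); x3 (f i)] j)%:Z - (nth 0%N [:: x1 s0; x2 s0; x3 s0] j)%:Z).
have [n [hn hA]] := int_relation A; exists n; split => //.
have key (x : R) (a : 'I_4 -> int) : x != 0 -> \sum_(i < 4) n i * a i = 0 ->
    \prod_(i < 4) x ^ (a i * n i) = 1.
  move=> x0 h0; transitivity (x ^ (\sum_(i < 4) n i * a i)); last by rewrite h0 expr0z.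
  rewrite (big_morph (fun c : int => x ^ c) (id1 := 1) (op1 := *%R)) ?expr0z //; last first.
    by move=> c c'; rewrite expfzDr.
  by apply: eq_bigr => i _; rewrite mulrC.
under eq_bigr => i _ do rewrite ratioE !expfzMl !exprz_exp.
have S3 : \sum_(i < 4) n i * ((x3 (f i))%:Z - (x3 s0)%:Z) = 0.
  by rewrite -[RHS](hA (inord 2)); apply: eq_bigr => i _; rewrite mxE inordK.
have S2 : \sum_(i < 4) n i * ((x2 (f i))%:Z - (x2 s0)%:Z) = 0.
  by rewrite -[RHS](hA (inord 1)); apply: eq_bigr => i _; rewrite mxE inordK.
have S1 : \sum_(i < 4) n i * ((x1 (f i))%:Z - (x1 s0)%:Z) = 0.
  by rewrite -[RHS](hA (inord 0)); apply: eq_bigr => i _; rewrite mxE inordK.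
by rewrite !big_split /= !key ?mulr1 ?invr_eq0 ?(lt0r_neq0 aR) ?(lt0r_neq0 bR) ?(lt0r_neq0 GR).
Qed.

(** Both embeddings are compared: alpha has norm -1, so multiplying the two absolute values removes
    alpha and leaves b^(2 x1). Then b >= 2 gives x1 and alpha > 1 gives x2. *)
Let y_inj s s' : y s = y s' -> x3 s = x3 s' -> s = s'.
Proof.
move=> e1 e3; have e2 := congr1 (@cj R) e1; rewrite !cj_y in e2; rewrite /y e3 in e1 e2.
have G0 : G != 0 by rewrite gt_eqF.
have cG0 : cj G != 0 by rewrite cj_eq0 //; apply: ZK_inK; exists gp, gq.
have a1 := mulIf (expf_neq0 _ G0) (mulIf (expf_neq0 _ q0) e1).
have a2 := mulIf (expf_neq0 _ cG0) (mulIf (expf_neq0 _ q0) e2).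
have nm : al * `|1 - s2 R| = 1.
  rewrite ler0_norm; last by have := s2_1 => u1; lra.
  by have := s2_sq R; move: (s2 R) => r hr; transitivity (r * r - 1); [ring|rewrite hr; ring].
have a3 : b%:R ^+ x1 s = b%:R ^+ x1 s' :> R.
  have a4 := congr1 (fun x => `|x|) a2; rewrite /= !normrM !normrX !(ger0_norm (ltW bR)) in a4.
  have a5 := congr2 (fun u v => u * v) a1 a4; rewrite /= !mulrA in a5.
  have sw t : b%:R ^+ x1 t * al ^+ x2 t * b%:R ^+ x1 t * `|1 - s2 R| ^+ x2 t = (b%:R ^+ x1 t) ^+ 2.
    transitivity ((b%:R ^+ x1 t) ^+ 2 * (al * `|1 - s2 R|) ^+ x2 t); last by rewrite nm expr1n mulr1.
    rewrite exprMn; move: (al ^+ _) (`|_| ^+ _) (b%:R ^+ _) => r1 r2 r3; ring.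
  rewrite !sw in a5; move/eqP: a5; rewrite eqrXn2 ?exprn_ge0 ?(ltW bR) //.
  by move/eqP.
have b3 : x1 s = x1 s'.
  by apply: (ieexprIn bR) a3; rewrite pnatr_eq1; case: (b) b2 => [|[]].
have a4 := a1; rewrite a3 in a4; have a5 := mulfI (expf_neq0 _ (lt0r_neq0 bR)) a4.
have b4 : x2 s = x2 s' by apply: (ieexprIn aR) a5; rewrite gt_eqF // ltrDl.
have p1 : s.1.1 = s'.1.1 := ord_inj b3.
have p2 : s.1.2 = s'.1.2 := ord_inj b4.
have p3 : s.2 = s'.2 := ord_inj e3.
by rewrite (surjective_pairing s) (surjective_pairing s.1) p1 p2 p3 -!surjective_pairing.
Qed.

Let fiber (t : nat) : (S <= t)%N -> forall E : {set I},
  (forall s s', s \in E -> s' \in E -> y s = y s') ->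
  (#|E| <= t)%N /\ {in E &, injective z1}.
Proof.
move=> St E hE; have i3 : {in E &, injective (fun s : I => s.2)}.
  by move=> s s' sE sE' /= e3; apply: y_inj; [exact: hE|rewrite /x3 e3].
split.
  rewrite -(card_in_imset i3); apply: leq_trans (max_card _) _; by rewrite card_ord.
move=> s s' sE sE' /= [] e1; apply: y_inj; first exact: hE.
(* z1 = x1 + d x3 with x1 < S <= d, so x3 is the quotient of z1 by d. *)
by apply: (box_inj Sd _ _ e1); exact: ltn_ord.
Qed.

Lemma box_descent jb jl :
  lam = (2 ^ jl)%N -> be = (2 ^ jb)%N -> S = (2 ^ (37 + jb + jl))%N ->
  (111 + 3 * jb + 4 * jl <= be)%N -> (2 ^ (58 + 3 * jb + 2 * jl) <= k)%N ->
  `|Lam| <= 2 ^- k -> False.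
Proof.
move=> elam ebe eS mbe hk hL.
have mbe' := mbe; rewrite ebe in mbe'.
have Sbe : (S <= 2 ^ be)%N by apply: leq_trans z1B; rewrite leq_addr.
have V := param_V mbe' hk.
have bek : (be <= k)%N.
  by rewrite leqNgt; apply/negP => c; move: V; rewrite -ebe (eqP (ltnW c : k - be == 0)%N) leqn0 addn_eq0 andbF.
(* The form is multiplied by x3 < S <= 2^be, which costs at most be bits; hence V = k - be. *)
have e0_le : 0 <= S%:R * (2:R) ^- k <= 2 ^- (k - be).
  rewrite mulr_ge0 ?invr_ge0 ?exprn_ge0 //=.
  rewrite -{1}(subnK bek) exprD invfM mulrC -mulrA -{2}[2 ^- (k - be)]mulr1.
  rewrite ler_wpM2l ?invr_ge0 ?exprn_ge0 // mulrC ler_pdivrMr ?exprn_gt0 // mul1r.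
  by rewrite -natrX ler_nat.
have cI : (#|I| = 2 ^ (111 + 3 * jb + 4 * jl))%N.
  by rewrite /I !card_prod !card_ord elam eS param_card.
have cI0 : (0 < #|I|)%N by rewrite cI expn_gt0.
have HE : (16 * (S * lam) = 2 ^ (41 + jb + 2 * jl))%N by rewrite elam eS param_H.
have t0E := param_t0 jb jl.
rewrite -?HE in V t0E.
have small := e_le hL.
pose X1' := (2 ^ (5 + jb))%N; pose Jm' := (50 + jb + 2 * jl)%N.
apply: (descent yZ y_ge1 y_le cy_le z1_le z2_le lnE small _ rank3 (fiber (t := 2 ^ Jm') _) (X1 := X1') (Jm := Jm')) => //; rewrite ?/X1' ?/Jm'.
- case/andP: e0_le => h0 h1; apply: le_trans (_ : _ <= 2 ^+ be.+1 * 2 ^- (k - be)) _.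
    apply: ler_pM => //; rewrite -natrX ler_nat expnS.
    apply: leq_trans (_ : 2 * (2 * 2 ^ (5 + jb)) <= _)%N; last by rewrite leq_mul2l ebe (param_2X1 mbe').
    by apply: box_double; rewrite expn_gt0.
  have V' : (be.+2 <= k - be)%N by rewrite ebe; apply: box_slack V.
  exact: pow2_half V'.
- apply: leq_trans (_ : 2 ^ 0 * (16 * (S * lam)) <= _)%N; last by rewrite t0E leq_mul2r leq_exp2l ?orbT.
  by rewrite mul1n; apply: leq_trans (leq_pmulr S lam0) _; rewrite leq_pmull.
- by rewrite expn_gt0.
- by rewrite !muln_gt0 S0 lam0.
- by rewrite cI; exact: (param_siegel mbe').
- rewrite t0E leq_mul2r; apply/orP; right; by [].
- have D : (0 < X1' * 2 ^ Jm')%N by rewrite muln_gt0 !expn_gt0.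
  apply: (num_ok (m := 111 + 3 * jb + 4 * jl) _ e0_le D); rewrite -/X1' -/Jm' ?HE ?ebe.
  + by rewrite cI.
  + exact: (param_exp mbe').
  + exact: (param_gain jb jl).
  + exact: (param_2X1 mbe').
  + exact: (param_2H mbe').
  + exact: (param_Nle mbe').
  + exact: (param_P mbe').
  + exact: V.
Qed.
End Box.

(** * Existence of suitable exponents jb and jl *)

Section Choice.
Local Open Scope nat_scope.

(** The decisive estimate is 3 jb <= K/3 + 5 and 2 jl <= 2K/3 - 64, so 58 + 3 jb + 2 jl <= K - 1.
    This fixes the threshold 95; the final 98 is 95 + 3, as 2^jl can reach 2 mu. *)
Lemma param_lin jb jl K : 95 + 3 * jl < K -> 9 * jb <= K + 15 ->
  (111 + 3 * jb + 4 * jl <= 4 * K) * (39 + jb + 2 * jl + K <= 4 * K) * (58 + 3 * jb + 2 * jl < K)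
  * (37 + jb + 2 * jl < K) * (jl < K).
Proof. by move=> h1 h2; do ?split; lia. Qed.

Lemma nine_mul_le j : 10 <= j -> 9 * j <= 2 ^ (j - 3).
Proof.
elim: j => // j IH; rewrite leq_eqVlt => /predU1P [<- //|h].
have := IH h; have h3 : 3 <= j by lia.
rewrite (subSn h3) expnS; have : 9 <= 2 ^ (j - 3) by apply: leq_trans (IH h); lia.
by move: (2 ^ _) => x; lia.
Qed.

(** For j >= 10, 9 j <= 2^(j-3) and 2^(j-3) < K; smaller j are covered by K > 95. *)
Lemma choose_jb K : 95 < K -> exists2 jb, 4 * K <= 2 ^ jb & 9 * jb <= K + 15.
Proof.
move=> hK; exists (up_log 2 (4 * K)); first by apply: up_logP.
have h1 : 2 ^ (up_log 2 (4 * K)).-1 < 4 * K.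
  have K1 : 1 < 4 * K by lia.
  by have /andP [] := up_log_bounds (isT : 1 < 2) K1.
have h2 : 4 * K <= 2 ^ up_log 2 (4 * K) by apply: up_logP.
move: (up_log 2 (4 * K)) h1 h2 => j h1 h2; have [h|h] := leqP 10 j; last by lia.
apply: leq_trans (nine_mul_le h) _.
have e : 2 ^ j.-1 = 4 * 2 ^ (j - 3) by rewrite (_ : 4 = 2 ^ 2) // -expnD; congr (2 ^ _); lia.
by move: h1; rewrite e ltn_mul2l /= => /ltnW h1; apply: leq_trans h1 _; rewrite leq_addr.
Qed.

Lemma choose_jl mu : 0 < mu -> exists2 jl, mu < 2 ^ jl & 2 ^ jl <= 2 * mu.
Proof.
move=> mu0; exists (trunc_log 2 mu).+1; first by apply: trunc_log_ltn.
by rewrite expnS leq_mul2l trunc_logP.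
Qed.

Lemma pow_cube c j x : 2 ^ j <= 2 * x -> 2 ^ (c + 3 * j) <= 2 ^ (c + 3) * x ^ 3.
Proof.
move=> h; rewrite !(expnD 2 c) -mulnA leq_mul2l; apply/orP; right.
by rewrite [3 * j]mulnC expnM -expnMn leq_exp2r.
Qed.

(** K is the bit length of k. With 2^jb >= 4K, the bound 2^(2^jb) has room for S d and S k, whose
    bit lengths are K plus small terms. *)
Lemma choose_params mu k d : 0 < mu -> 2 ^ 98 * mu ^ 3 <= k -> k <= d * mu.+1 -> d <= 2 * k ->
  exists jb jl, [/\ mu < 2 ^ jl,
    111 + 3 * jb + 4 * jl <= 2 ^ jb, 2 ^ (58 + 3 * jb + 2 * jl) <= k &
    let S := 2 ^ (37 + jb + jl) in [/\ S <= d, S + d * S <= 2 ^ 2 ^ jb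
      & S * 2 ^ jl + k * S <= 2 ^ 2 ^ jb]].
Proof.
move=> mu0 hk kd dk; have [jl j1 j2] := choose_jl mu0.
have k0 : 0 < k by apply: leq_trans hk; rewrite muln_gt0 !expn_gt0 mu0.
pose K := (trunc_log 2 k).+1.
have kK : k < 2 ^ K by apply: trunc_log_ltn.
have Kk j : j < K -> 2 ^ j <= k.
  by move=> h; apply: leq_trans (trunc_logP (isT : 1 < 2) k0); rewrite leq_exp2l.
have hK : 95 + 3 * jl < K.
  by rewrite -(ltn_exp2l _ _ (isT : 1 < 2)); apply: leq_ltn_trans kK; apply: leq_trans (pow_cube 95 j2) hk.
have [jb hb1 hb2] := choose_jb (leq_ltn_trans (leq_addr _ _) hK).
have [[[[l1 l2] l3] l4] l5] := param_lin hK hb2.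
exists jb, jl; split => //; [exact: leq_trans hb1|exact: Kk|].
move=> S; have S0 : 0 < S by rewrite expn_gt0.
have key : S * (4 * k) <= 2 ^ 2 ^ jb.
  apply: leq_trans (_ : 2 ^ (37 + jb + jl) * (2 ^ 2 * 2 ^ K) <= _).
    by rewrite leq_mul2l leq_mul2l (ltnW kK) !orbT.
  rewrite -!expnD leq_exp2l //; apply: leq_trans hb1; apply: leq_trans l2; clear; lia.
split.
- rewrite -(leq_pmul2r (_ : 0 < 2 ^ jl)) ?expn_gt0 // /S -expnD.
  apply: leq_trans (_ : d * mu.+1 <= _); last by rewrite leq_mul2l j1 orbT.
  apply: leq_trans kd; apply: Kk; move: l4; clear; lia.
- apply: leq_trans key; rewrite -mulSn mulnC leq_mul2l; apply/orP; right.
  move: dk k0; clear; lia.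
- apply: leq_trans key; rewrite [k * S]mulnC -mulnDr leq_mul2l; apply/orP; right.
  have := Kk _ l5; move: (2 ^ jl) => x; clear; lia.
Qed.
End Choice.

Theorem baker_bound (R : realType) (b d k q mu : nat) (gp gq : int) :
  let G : R := gp%:~R + gq%:~R * s2 R in
  (0 < mu)%N -> (2 <= b)%N -> (b <= 2 ^ mu.+1)%N ->
  1 <= G -> G <= 2 ^+ (13 * mu) -> `|cj G| <= 2 ^+ (13 * mu) ->
  (0 < q)%N -> (q <= 2 ^ (13 * mu))%N -> (k <= d * mu.+1)%N -> (d <= 2 * k)%N ->
  `|d%:R * ln b%:R - k%:R * ln (1 + s2 R) - (ln G - ln q%:R)| <= 2 ^- k ->
  (k < 2 ^ 98 * mu ^ 3)%N.
Proof.
move=> G mu0 b2 bmu G1 Gle cGle q1 qle kd dk L; rewrite ltnNge; apply/negP => hk.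
have [jb [jl [h1 h2 h3 [h4 h5 h6]]]] := choose_params mu0 hk kd dk.
apply: (box_descent b2 _ G1 Gle cGle q1 qle _ h4 _ _ h5 h6 erefl erefl erefl h2 h3 L).
- by apply: leq_trans bmu _; rewrite leq_exp2l.
- by rewrite leq_mul2l ltnW ?orbT.
- by rewrite expn_gt0.
- by rewrite expn_gt0.
Qed.

End LinearForms.

(** * Pell numbers *)

Module PellIdentities.
Import LinearForms.
Import all_boot all_order all_algebra.
Import ring lra zify.
Set Implicit Arguments. Unset Strict Implicit. Unset Printing Implicit Defensive.
Import Order.TTheory GRing.Theory Num.Theory.
Import reals Rstruct.
Local Open Scope ring_scope.

Lemma pellSS n : (pell n.+2 = 2 * pell n.+1 + pell n)%N. Proof. by []. Qed.
Lemma pell_lucasSS n : (pell_lucas n.+2 = 2 * pell_lucas n.+1 + pell_lucas n)%N. Proof. by []. Qed.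

Lemma nat_ind2 (T : nat -> Prop) : T 0%N -> T 1%N -> (forall n, T n -> T n.+1 -> T n.+2) -> forall n, T n.
Proof.
move=> h0 h1 h n; have [] : T n /\ T n.+1 => [|//].
by elim: n => [|n [a c]]; split => //; exact: h.
Qed.

Section Binet.
Variable R : rcfType.
Local Notation s := (s2 R).
Local Notation al := (1 + s).
Local Notation bt := (1 - s).

Lemma al_sq : al ^+ 2 = 2 * al + 1.
Proof. have := s2_sq R; move: s => r hr; transitivity (1 + 2 * r + r * r); [ring|rewrite hr; ring]. Qed.
Lemma bt_sq : bt ^+ 2 = 2 * bt + 1.
Proof. have := s2_sq R; move: s => r hr; transitivity (1 - 2 * r + r * r); [ring|rewrite hr; ring]. Qed.
Lemma al_bt : al * bt = -1.
Proof. have := s2_sq R; move: s => r hr; transitivity (1 - r * r); [ring|rewrite hr; ring]. Qed.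
Lemma al_btX n : al ^+ n * bt ^+ n = (-1) ^+ odd n.
Proof. by rewrite -exprMn al_bt signr_odd. Qed.

Lemma pell_binet n : 2 * s * (pell n)%:R = al ^+ n - bt ^+ n.
Proof.
elim/nat_ind2: n => [||n h0 h1]; first by rewrite !expr0 mulr0 subrr.
  by rewrite !expr1 (_ : pell 1 = 1%N) //; ring.
rewrite pellSS natrD natrM -[n.+2]addn2 !exprD al_sq bt_sq.
transitivity (2 * (2 * s * (pell n.+1)%:R) + 2 * s * (pell n)%:R); first by ring.
by rewrite h0 h1 !exprSr; ring.
Qed.

Lemma lucas_binet n : (pell_lucas n)%:R = al ^+ n + bt ^+ n.
Proof.
elim/nat_ind2: n => [||n h0 h1]; first by rewrite !expr0.
  by rewrite !expr1 (_ : pell_lucas 1 = 2%N) //; ring.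
rewrite pell_lucasSS natrD natrM -[n.+2]addn2 !exprD al_sq bt_sq h0 h1 !exprSr; ring.
Qed.
End Binet.

Section Identities.
Local Notation R := (Rdefinitions.R : realType).

Let s0 : 2 * s2 R != 0.
Proof. by rewrite mulf_neq0 ?gt_eqF ?s2_gt0. Qed.

Let powE x j : (2 * x + j = x + x + j)%N. Proof. by rewrite mul2n addnn. Qed.

Lemma pell_mul_lucas_R x j :
  (pell x)%:R * (pell_lucas (x + j))%:R = (pell (2 * x + j))%:R - (-1) ^+ odd x * (pell j)%:R :> R.
Proof.
have dist (c u v w : R) : c * (u - v * w) = c * u - v * (c * w) by ring.
apply: (mulfI s0); rewrite mulrA dist !pell_binet lucas_binet powE.
rewrite -al_btX !exprD; ring.
Qed.

Lemma lucas_mul_pell_R x j :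
  (pell_lucas x)%:R * (pell (x + j))%:R = (pell (2 * x + j))%:R + (-1) ^+ odd x * (pell j)%:R :> R.
Proof.
have dist (c u v w : R) : c * (u + v * w) = c * u + v * (c * w) by ring.
apply: (mulfI s0); rewrite mulrCA dist !pell_binet lucas_binet powE.
rewrite -al_btX !exprD; ring.
Qed.

Lemma lucas_mul_lucas_R x j :
  (pell_lucas x)%:R * (pell_lucas (x + j))%:R =
  (pell_lucas (2 * x + j))%:R + (-1) ^+ odd x * (pell_lucas j)%:R :> R.
Proof. by rewrite !lucas_binet powE -al_btX !exprD; ring. Qed.

Lemma lucas_sqr_R x : (pell_lucas x)%:R ^+ 2 = 8 * (pell x)%:R ^+ 2 + 4 * (-1) ^+ odd x :> R.
Proof.
have h : (2 * s2 R * (pell x)%:R) ^+ 2 = 8 * (pell x)%:R ^+ 2.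
  have := s2_sq R; move: (s2 R) (pell x)%:R => r p hr.
  by transitivity (4 * (r * r) * p ^+ 2); [ring|rewrite hr; ring].
by rewrite -h pell_binet lucas_binet -al_btX; ring.
Qed.

Local Open Scope nat_scope.

(** The sign (-1)^x is split by parity and the subtracted term moved across, so that the identities
    can be used in [nat]. *)
Lemma pell_mul_lucas_even x j : ~~ odd x -> pell x * pell_lucas (x + j) + pell j = pell (2 * x + j).
Proof.
move=> hx; apply/eqP; rewrite -(eqr_nat R) natrD natrM pell_mul_lucas_R (negbTE hx) expr0 mul1r.
by rewrite subrK.
Qed.
Lemma pell_mul_lucas_odd x j : odd x -> pell x * pell_lucas (x + j) = pell (2 * x + j) + pell j.
Proof.
move=> hx; apply/eqP; rewrite -(eqr_nat R) natrD natrM pell_mul_lucas_R hx expr1 mulN1r.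
by rewrite opprK.
Qed.
Lemma lucas_mul_pell_even x j : ~~ odd x -> pell_lucas x * pell (x + j) = pell (2 * x + j) + pell j.
Proof.
by move=> hx; apply/eqP; rewrite -(eqr_nat R) natrD natrM lucas_mul_pell_R (negbTE hx) expr0 mul1r.
Qed.
Lemma lucas_mul_pell_odd x j : odd x -> pell_lucas x * pell (x + j) + pell j = pell (2 * x + j).
Proof.
move=> hx; apply/eqP; rewrite -(eqr_nat R) natrD natrM lucas_mul_pell_R hx expr1 mulN1r.
by rewrite subrK.
Qed.
Lemma lucas_mul_lucas_even x j : ~~ odd x ->
  pell_lucas x * pell_lucas (x + j) = pell_lucas (2 * x + j) + pell_lucas j.
Proof.
by move=> hx; apply/eqP; rewrite -(eqr_nat R) natrD natrM lucas_mul_lucas_R (negbTE hx) expr0 mul1r.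
Qed.
Lemma lucas_mul_lucas_odd x j : odd x ->
  pell_lucas x * pell_lucas (x + j) + pell_lucas j = pell_lucas (2 * x + j).
Proof.
move=> hx; apply/eqP; rewrite -(eqr_nat R) natrD natrM lucas_mul_lucas_R hx expr1 mulN1r.
by rewrite subrK.
Qed.
Lemma lucas_sqr x : pell_lucas x ^ 2 = 8 * pell x ^ 2 + 4 \/ pell_lucas x ^ 2 + 4 = 8 * pell x ^ 2.
Proof.
have := lucas_sqr_R x; case: (odd x) => h; [right|left]; apply/eqP;
  rewrite -(eqr_nat R) natrD natrM !natrX h; apply/eqP; ring.
Qed.
End Identities.

(** * Growth and divisibility of Pell and Pell-Lucas numbers *)

Section Growth.
Local Open Scope nat_scope.

Lemma pell_double n : pell (2 * n) = pell n * pell_lucas n.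
Proof.
have [o|e] := boolP (odd n).
  by have := pell_mul_lucas_odd 0 o; rewrite !addn0.
by have := pell_mul_lucas_even 0 e; rewrite !addn0.
Qed.
Lemma pell_gt0 n : 0 < pell n.+1.
Proof. by elim: n => // n h; rewrite pellSS; lia. Qed.
Lemma pell_lucas_gt0 n : 0 < pell_lucas n.
Proof. by elim/nat_ind2: n => // n h h1; rewrite pell_lucasSS; lia. Qed.
Lemma pell_lt n : pell n < pell n.+1.
Proof. by case: n => // n; rewrite pellSS; have := pell_gt0 n; lia. Qed.
Lemma leq_pell : {mono pell : i j / i <= j}.
Proof. by apply: leq_mono => i j; elim: j => // j h; rewrite ltnS leq_eqVlt => /predU1P [->|/h h']; [exact: pell_lt|apply: ltn_trans h' (pell_lt j)]. Qed.
Lemma ltn_pell : {mono pell : i j / i < j}.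
Proof. exact: leqW_mono leq_pell. Qed.
Lemma pell_inj : injective pell.
Proof. exact: incn_inj leq_pell. Qed.
Lemma pell_pow2 n : 2 ^ n * 1 <= pell n.+1.
Proof. by rewrite muln1; elim: n => // n h; rewrite pellSS expnS; lia. Qed.
Lemma pell_addn n j : 2 ^ j * pell n <= pell (n + j).
Proof.
elim: j => [|j h]; first by rewrite mul1n addn0.
rewrite addnS expnS -mulnA; apply: leq_trans (_ : 2 * pell (n + j) <= _); first by rewrite leq_mul2l.
by case: (n + j) => // t; rewrite pellSS leq_addr.
Qed.
Lemma pell_lt_pow4 n : pell n < 4 ^ n.
Proof.
suff: pell n < 4 ^ n /\ pell n.+1 < 4 ^ n.+1 by case.
by elim: n => // n [h1 h2]; split => //; rewrite pellSS expnS; move: h2; rewrite expnS; lia.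
Qed.
Lemma lucas_le_pow4 n : pell_lucas n <= 2 * 4 ^ n.
Proof.
suff: pell_lucas n <= 2 * 4 ^ n /\ pell_lucas n.+1 <= 2 * 4 ^ n.+1 by case.
by elim: n => // n [h1 h2]; split => //; rewrite pell_lucasSS expnS; move: h2; rewrite expnS; lia.
Qed.
Lemma lucas_pell n : pell_lucas n.+1 = 2 * pell n.+1 + 2 * pell n.
Proof. by elim/nat_ind2: n => // n h1 h2; rewrite pell_lucasSS h1 h2 !pellSS; lia. Qed.
(** The correction is there for n = 1, where 2 P_1 = Q_1. *)
Lemma pell_lt_lucas n : 2 * pell n < pell_lucas n + (n <= 1).
Proof. by case: n => // -[//|n]; rewrite lucas_pell; have := pell_gt0 n; lia. Qed.
Lemma lucas_lt n : 0 < n -> pell_lucas n < pell_lucas n.+1.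
Proof. by case: n => // n _; rewrite pell_lucasSS; have := pell_lucas_gt0 n; have := pell_lucas_gt0 n.+1; lia. Qed.
Lemma lucas_ltn i j : 0 < i -> i < j -> pell_lucas i < pell_lucas j.
Proof.
move=> i0; elim: j => // j h; rewrite ltnS leq_eqVlt => /predU1P [<-|ij]; first exact: lucas_lt.
by apply: ltn_trans (h ij) (lucas_lt _); apply: leq_trans ij.
Qed.
Lemma odd_pell n : odd (pell n) = odd n.
Proof. by elim/nat_ind2: n => // n h1 h2; rewrite pellSS oddD oddM h1 /= negbK. Qed.
Lemma half_lucas n : {c | pell_lucas n = 2 * c & odd c}.
Proof.
exists (pell_lucas n)./2.
  by rewrite mul2n -[LHS]odd_double_half; suff -> : odd (pell_lucas n) = false by [];
     elim/nat_ind2: n => // n h1 h2; rewrite pell_lucasSS oddD oddM h1.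
suff: exists2 c, pell_lucas n = 2 * c & odd c.
  by move=> [c -> oc]; rewrite mul2n doubleK.
elim/nat_ind2: n => [||n [c1 e1 o1] [c2 e2 o2]]; try by exists 1.
exists (2 * c2 + c1); first by rewrite pell_lucasSS e1 e2; lia.
by rewrite oddD oddM o1.
Qed.
(** P_(2n) = P_n Q_n and Q_n is twice an odd number, so halving the index removes exactly one factor
    2, and P_e is odd for odd e. *)
Lemma pow2_dvd_pell d e : 2 ^ d %| pell e -> 2 ^ d %| e.
Proof.
elim: d e => [|d IH] e; first by rewrite !dvd1n.
move=> h; have he : ~~ odd e.
  rewrite -odd_pell -dvdn2; apply: dvdn_trans h; by rewrite expnS dvdn_mulr.
rewrite -(even_halfK he) -mul2n expnS dvdn_pmul2l // in h *.
apply: IH; have [c ec oc] := half_lucas e./2.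
move: h; rewrite pell_double ec mulnCA dvdn_pmul2l // Gauss_dvdl //.
by rewrite coprimeXl // coprime2n.
Qed.
(** Dividing the relation between Q_a^2 and 8 P_a^2 by 4 shows that c^2 and 2 P_a^2 differ by 1. *)
Lemma coprime_pell_lucas a c : pell_lucas a = 2 * c -> coprime c (pell a).
Proof.
move=> ec; have := lucas_sqr a; rewrite ec expnMn => h.
have h' : c ^ 2 = 2 * pell a ^ 2 + 1 \/ c ^ 2 + 1 = 2 * pell a ^ 2 by case: h => h; [left|right]; lia.
rewrite /coprime -dvdn1; set g := gcdn _ _.
have g1 : g %| c ^ 2 by rewrite dvdn_exp // dvdn_gcdl.
have g2 : g %| 2 * pell a ^ 2 by rewrite dvdn_mull // dvdn_exp // dvdn_gcdr.
case: h' => h'; first by move: g1; rewrite h' dvdn_addr.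
by move: g2; rewrite -h' dvdn_addr.
Qed.
Lemma lucas_dvd_odd m q : pell_lucas m %| pell_lucas (m * (2 * q).+1).
Proof.
elim: q => [|q IH]; first by rewrite muln0 muln1.
have -> : m * (2 * q.+1).+1 = 2 * m + m * (2 * q).+1 by lia.
have h : pell_lucas m %| pell_lucas m * pell_lucas (m + m * (2 * q).+1) by apply: dvdn_mulr.
have [o|e] := boolP (odd m).
  by rewrite -(lucas_mul_lucas_odd _ o) dvdn_addr.
by move: h; rewrite (lucas_mul_lucas_even _ e) dvdn_addl.
Qed.
End Growth.

End PellIdentities.

Module PellRegimes.
Import LinearForms PellIdentities.
Import all_boot all_order all_algebra.
Import ring lra zify.
Set Implicit Arguments. Unset Strict Implicit. Unset Printing Implicit Defensive.
Import Order.TTheory GRing.Theory Num.Theory.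

(** * Pell numbers modulo Q_m up to sign *)

Section Fold.
Variable m : nat.
Hypothesis m0 : 0 < m.
Let D : int := pell_lucas m.
Let P n : int := pell n.

Definition pm_eq (u v : int) := (D %| (u - v)%R)%Z || (D %| (u + v)%R)%Z.

Lemma pm_trans u v w : pm_eq u v -> pm_eq v w -> pm_eq u w.
Proof.
rewrite /pm_eq; case/orP => h1; case/orP => h2; apply/orP.
- left; have -> : (u - w = (u - v) + (v - w))%R by ring. exact: rpredD.
- right; have -> : (u + w = (u - v) + (v + w))%R by ring. exact: rpredD.
- right; have -> : (u + w = (u + v) - (v - w))%R by ring. exact: rpredB.
- left; have -> : (u - w = (u + v) - (v + w))%R by ring. exact: rpredB.
Qed.
Lemma pm_sym u v : pm_eq u v -> pm_eq v u.
Proof. by rewrite /pm_eq => /orP [] h; apply/orP; [left; rewrite -rpredN opprB|right; rewrite addrC]. Qed.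

Lemma pm_shift x : pm_eq (P (2 * m + x)) (P x).
Proof.
rewrite /pm_eq /P /D; have h : (D %| Posz (pell_lucas m * pell (m + x))%N)%Z by rewrite PoszM dvdz_mulr.
have [o|e] := boolP (odd m).
  by rewrite -(lucas_mul_pell_odd _ o) PoszD addrK h.
by rewrite -PoszD -(lucas_mul_pell_even _ e) h orbT.
Qed.

Lemma pm_reflect x y : x + y = m -> pm_eq (P (m + x)) (P y).
Proof.
move=> e; rewrite /pm_eq /P /D; have h : (D %| Posz (pell x * pell_lucas (x + y))%N)%Z by rewrite e PoszM dvdz_mull.
have -> : m + x = 2 * x + y by lia.
have [o|ev] := boolP (odd x).
  by rewrite -PoszD -(pell_mul_lucas_odd _ o) h orbT.
by rewrite -(pell_mul_lucas_even _ ev) PoszD addrK h.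
Qed.

(** The shift by 2m and the reflection in m preserve P up to sign modulo Q_m, and together they fold
    every index into 0..m; so x is i or -i modulo 2m. *)
Lemma pell_fold x : exists i q, [/\ i <= m, x = 2 * m * q + i \/ x + i = 2 * m * q & pm_eq (P x) (P i)].
Proof.
elim: x {-2}x (leqnn x) => [|x IH] z hz.
  by exists 0, 0; split => //; [left; lia|rewrite /pm_eq (_ : z = 0) ?subrr ?dvdz0 //; lia].
have [zm|mz] := leqP z m.
  by exists z, 0; split => //; [left; lia|rewrite /pm_eq subrr dvdz0].
have [z2|z2] := leqP z (2 * m).
  exists (2 * m - z), 1; split; [lia|right; lia|].
  have := @pm_reflect (z - m) (2 * m - z); rewrite subnKC; last by lia.
  by apply; lia.
have [i [q [im e h]]] := IH (z - 2 * m) ltac:(lia).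
exists i, q.+1; split => //; first by case: e => e; [left|right]; lia.
by apply: pm_trans h; have := pm_shift (z - 2 * m); rewrite subnKC //; lia.
Qed.

Lemma pm_eq_small i j : 1 < m -> i <= m -> j <= m -> pm_eq (P i) (P j) -> i = j.
Proof.
move=> m1 im jm; have hi : pell i <= pell m by rewrite leq_pell.
have hj : pell j <= pell m by rewrite leq_pell.
have := pell_lt_lucas m; rewrite (leqNgt m 1) m1 addn0 => hm.
have small (z : int) : (`|z| < D)%R -> (D %| z)%Z -> z = 0%R.
  move=> zD; case/dvdzP => q e; have [q0|q0] := eqVneq q 0%R; first by rewrite e q0 mul0r.
  have : (1 <= `|q|)%R by move: q0; clear; lia.
  move: zD; rewrite e normrM (_ : `|D| = D)%R // => h1 h2; exfalso.
  by move: h1; rewrite ltNge ler_peMl.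
rewrite /pm_eq /P; case/orP => h.
  apply: pell_inj; apply/eqP; rewrite -eqz_nat -subr_eq0; apply/eqP/small => //.
  by rewrite /D; move: hi hj hm; clear; lia.
have : (P i + P j = 0)%R by apply: small => //; rewrite /P /D; move: hi hj hm; clear; lia.
rewrite /P => h0; have [e1 e2] : pell i = 0 /\ pell j = 0 by move: h0; clear; lia.
by apply: pell_inj; rewrite e1 e2.
Qed.
End Fold.

(** If n and k folded with the same sign, 2m would divide n - k, which lies strictly between m and
    2m. So the signs are opposite, 2m divides n + k, and e is half of n - k. *)
Lemma fold_congr m n k : 1 < m -> (pell n = pell k %[mod pell_lucas m]) ->
  k + m < n -> n < k + 2 * m ->
  exists e j, [/\ n = k + 2 * e, k + e = m * j & m + (n - k - m) = 2 * e].
Proof.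
move=> m1 hmod h1 h2; have m0 := ltnW m1.
have [i [q [im ek hk]]] := pell_fold m0 k.
have [i' [q' [im' en hn]]] := pell_fold m0 n.
have nk : pm_eq m (pell n) (pell k).
  by rewrite /pm_eq; apply/orP; left; rewrite -eqz_mod_dvd !modz_nat hmod.
have := pm_eq_small m1 im im' (pm_trans (pm_sym hk) (pm_trans (pm_sym nk) hn)) => ei.
move: ek en; rewrite -{}ei => ek en {hk hn nk hmod im'}.
case: ek en => [ek|ek] [en|en].
- exfalso; have : q < q' by nia. by nia.
- have eq : q' = q.+1 by nia.
  by exists (m - i), (2 * q).+1; split; nia.
- have eq : q' = q by nia.
  by exists i, (2 * q); split; nia.
- exfalso; have : q < q' by nia. by nia.
Qed.

Lemma sqr_lt_pow2 x : 7 <= x -> x ^ 2 < 2 ^ x.-1.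
Proof.
elim: x => // x IH; rewrite leq_eqVlt => /predU1P [<- //|h].
have e : 2 ^ x.+1.-1 = 2 * 2 ^ x.-1 by case: x h {IH} => // x _; rewrite -expnS.
by have := IH h; rewrite e !expnS !expn0; move: (2 ^ _) => p; clear -h; nia.
Qed.

Lemma digits_small mu d : 2 ^ d.-1 <= mu.+1 * d + 1 -> d <= mu + 7.
Proof.
move=> h; rewrite leqNgt; apply/negP => hd.
have := sqr_lt_pow2 (leq_trans (leq_addl mu 7) (ltnW hd)); rewrite -mulnn => h2; nia.
Qed.

Lemma pell_le_pow2 x y : pell x <= 2 ^ y -> x <= y.+1.
Proof.
case: x => // x h; rewrite ltnS -(leq_exp2l _ _ (isT : 1 < 2)); apply: leq_trans h.
by have := pell_pow2 x; rewrite muln1.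
Qed.

(** * Size estimates, the case of large m and the case k = 0 *)

Section Regime.
Variables (b mu d m n k : nat).
Hypotheses (b2 : 1 < b) (b_le : b < 2 ^ mu.+1) (mu0 : 0 < mu) (d0 : 0 < d).
Hypothesis eqn : pell n = b ^ d * pell_lucas m + pell k.

Lemma expb_le : b ^ d <= 2 ^ (mu.+1 * d).
Proof. by rewrite expnM leq_exp2r // ltnW. Qed.

Section PositiveK.
Hypotheses (k0 : 0 < k) (dlo : b ^ d.-1 <= pell k) (dhi : pell k < b ^ d).

Lemma k_le : k <= mu.+1 * d.
Proof.
case: k k0 dhi => // k' _ h; rewrite -(ltn_exp2l _ _ (isT : 1 < 2)) .
have := leq_ltn_trans (pell_pow2 k') (leq_trans h expb_le); rewrite muln1 ltn_exp2l //.
Qed.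

Lemma d_le : d <= 2 * k.
Proof.
have h : 2 ^ d.-1 < 2 ^ (2 * k).
  apply: leq_ltn_trans (_ : b ^ d.-1 < _); first by case: (d.-1) => // t; rewrite leq_exp2r.
  by rewrite expnM; apply: leq_ltn_trans dlo (pell_lt_pow4 k).
by move: h; rewrite ltn_exp2l //; lia.
Qed.

(** P_k Q_m is P_(k+m) up to a Pell number of index |k - m|; the surplus Q_m from b^d >= P_k + 1,
    with the term P_k, outweighs it. *)
Lemma n_gt : k + m < n.
Proof.
rewrite -ltn_pell eqn; apply: leq_trans (_ : (pell k).+1 * pell_lucas m + pell k <= _); last first.
  by rewrite leq_add2r leq_mul2r dhi orbT.
have hm := pell_lt_lucas m; have hmg := pell_lucas_gt0 m.
have hpk : 0 < pell k by case: k k0 => // k' _; exact: pell_gt0.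
rewrite mulSn; have [km|mk] := leqP k m.
  have hs : pell (m - k) <= pell m by rewrite leq_pell leq_subr.
  have [o|e] := boolP (odd k).
    have := pell_mul_lucas_odd (m - k) o; rewrite subnKC // (_ : 2 * k + (m - k) = k + m); last by lia.
    by move=> ->; lia.
  have := pell_mul_lucas_even (m - k) e; rewrite subnKC // (_ : 2 * k + (m - k) = k + m); last by lia.
  by move=> <-; lia.
have hs : pell (k - m) <= pell k by rewrite leq_pell leq_subr.
have [o|e] := boolP (odd m).
  have := lucas_mul_pell_odd (k - m) o; rewrite subnKC ?(ltnW mk) // (_ : 2 * m + (k - m) = k + m); last by lia.
  by move=> <-; lia.
have := lucas_mul_pell_even (k - m) e; rewrite subnKC ?(ltnW mk) // (_ : 2 * m + (k - m) = k + m); last by lia.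
by rewrite [pell k * _]mulnC => ->; lia.
Qed.

(** P_k Q_m <= 2 P_(k+m) and b^d <= b P_k give P_n < 2^(mu+3) P_(k+m), and each index step from a
    positive index at least doubles P. *)
Lemma n_le : n <= k + m + (mu + 2).
Proof.
rewrite -ltnS -addnS -addnS -ltn_pell; apply: leq_trans (pell_addn _ _); rewrite eqn.
have hpk : 0 < pell k by case: k k0 => // k' _; exact: pell_gt0.
have hb : b ^ d <= b * pell k by rewrite -(prednK d0) expnS leq_mul2l dlo orbT.
have h1 : pell k * pell_lucas m <= 2 * pell (k + m).
  have [km|mk] := leqP k m.
    have hs : pell (m - k) <= pell (k + m) by rewrite leq_pell; lia.
    have [o|e] := boolP (odd k).
      have := pell_mul_lucas_odd (m - k) o; rewrite subnKC // (_ : 2 * k + (m - k) = k + m); last by lia.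
      by move=> ->; lia.
    have := pell_mul_lucas_even (m - k) e; rewrite subnKC // (_ : 2 * k + (m - k) = k + m); last by lia.
    by lia.
  have hs : pell (k - m) <= pell (k + m) by rewrite leq_pell; lia.
  have [o|e] := boolP (odd m).
    have := lucas_mul_pell_odd (k - m) o; rewrite subnKC ?(ltnW mk) // (_ : 2 * m + (k - m) = k + m); last by lia.
    by lia.
  have := lucas_mul_pell_even (k - m) e; rewrite subnKC ?(ltnW mk) // (_ : 2 * m + (k - m) = k + m); last by lia.
  by rewrite [pell k * _]mulnC => ->; lia.
have h2 : b ^ d * pell_lucas m <= b * (2 * pell (k + m)).
  apply: leq_trans (_ : b * pell k * pell_lucas m <= _); first by rewrite leq_mul2r hb orbT.
  by rewrite -mulnA leq_mul2l h1 orbT.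
have h3 : pell k <= pell (k + m) by rewrite leq_pell leq_addr.
have h4 : 0 < pell (k + m) by apply: leq_trans h3.
rewrite (_ : 2 ^ (mu + 3) = 4 * 2 ^ mu.+1); last by rewrite (_ : 4 = 2 ^ 2) // -expnD; congr (2 ^ _); lia.
move: b_le h2; clear -h3 h4; move: (2 ^ mu.+1) (b ^ d * _) => x z; nia.
Qed.

Lemma regime_large : k + (m + m) > n -> n <= 3 * (mu.+1 * (mu + 7)) + 2.
Proof.
move=> nm; have ng := n_gt; have m1 : 1 < m by lia.
have cg : pell n = pell k %[mod pell_lucas m] by rewrite eqn modnMDl.
have [e [j [e1 e2 e3]]] : exists e j, [/\ n = k + 2 * e, k + e = m * j & m + (n - k - m) = 2 * e].
  by apply: fold_congr => //; lia.
have em : e < m by lia.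
have e0 : 0 < e by lia.
have j0 : 0 < j by case: j e2 => //; lia.
have mA : m <= k + e by rewrite e2 leq_pmulr.
have d2 : 2 ^ d.-1 %| 2 ^ d by rewrite dvdn_exp2l // leq_pred.
suff [hd he] : 2 ^ d.-1 <= mu.+1 * d + 1 /\ e <= mu.+1 * d + 1.
  have := digits_small hd; have := k_le; rewrite e1 => hk hd'.
  have : mu.+1 * d <= mu.+1 * (mu + 7) by rewrite leq_mul2l hd' orbT.
  by move: (_ * d) (_ * (_ + 7)) hk he hd; clear; lia.
have [cm qm om] := half_lucas m.
have even_b : ~~ odd (b ^ d) -> 2 ^ d %| b ^ d.
  by move=> hb; rewrite dvdn_exp2r // dvdn2; move: hb; rewrite oddX negb_or => /andP [].
have [oe|ee] := boolP (odd e).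
  have h := lucas_mul_pell_odd k oe; rewrite [2 * e + k]addnC -e1 eqn in h.
  have {}h := addIn h; rewrite [e + k]addnC in h.
  have [ce qe oce] := half_lucas e; rewrite qm qe mulnCA -mulnA in h.
  have {}h : ce * pell (k + e) = b ^ d * cm by move: h; clear; lia.
  (* For odd j, Q_m divides Q_(k+e), so Q_m / 2 is coprime to P_(k+e) and must divide Q_e / 2, which
     is smaller because e < m. *)
  have ej : ~~ odd j.
    apply/negP => oj; have [ca qa _] := half_lucas (k + e).
    have : pell_lucas m %| pell_lucas (k + e).
      by rewrite e2 -(odd_double_half j) oj add1n -mul2n lucas_dvd_odd.
    rewrite qm qa dvdn_pmul2l // => hca.
    have : cm %| ce.
      rewrite -(Gauss_dvdl _ (_ : coprime cm (pell (k + e)))) ?h ?dvdn_mull //.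
      exact: coprime_dvdl hca (coprime_pell_lucas qa).
    move/dvdn_leq => /(_ (odd_gt0 oce)); have := lucas_ltn e0 em; rewrite qm qe; clear; lia.
  have eA : ~~ odd (k + e) by rewrite e2 oddM (negbTE ej) andbF.
  have dA : 2 ^ d %| pell (k + e).
    rewrite -(Gauss_dvdr _ (_ : coprime (2 ^ d) ce)); last by rewrite coprimeXl // coprime2n.
    rewrite h dvdn_mulr //; apply: even_b.
    have : ~~ odd (b ^ d * cm) by rewrite -h oddM odd_pell (negbTE eA) andbF.
    by rewrite oddM om andbT.
  have hA := dvdn_leq (_ : 0 < k + e) (pow2_dvd_pell dA).
  (* From j >= 2 follows 2m <= k + e, and e < m then forces e < k; so 2^d <= k + e < 2k. *)
  have j2 : 1 < j by case: j ej j0 {e2} => [|[]].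
  have mj : m * 2 <= m * j by rewrite leq_mul2l j2 orbT.
  have mk : e < k by move: mj em; rewrite -e2; clear; lia.
  have ke0 : 0 < k + e by rewrite addn_gt0 k0.
  have {hA} := hA ke0; rewrite -{1}(prednK d0) expnS => hA.
  by have := k_le; move: hA mk; move: (2 ^ _) (_ * d); clear; lia.
(* For even e, Q_(k+e) >= Q_m gives P_e <= b^d and thus e = O(mu d). As Q_(k+e) / 2 is odd, all of
   2^d divides P_e. *)
have h := pell_mul_lucas_even k ee; rewrite [2 * e + k]addnC -e1 eqn in h.
have {}h := addIn h; rewrite [e + k]addnC in h.
have he : e <= (mu.+1 * d).+1.
  apply: pell_le_pow2; apply: leq_trans expb_le.
  rewrite -(leq_pmul2r (pell_lucas_gt0 m)) -h leq_mul2l; apply/orP; right.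
  case: (ltngtP m (k + e)) mA => // [hlt|->] _ //.
  by apply: ltnW; apply: lucas_ltn => //; lia.
have [ca qa oa] := half_lucas (k + e).
have {}h : pell e * ca = b ^ d * cm by move: h; rewrite qm qa; clear; lia.
have de : 2 ^ d %| pell e.
  rewrite -(Gauss_dvdl _ (_ : coprime (2 ^ d) ca)); last by rewrite coprimeXl // coprime2n.
  rewrite h dvdn_mulr //; apply: even_b.
  have : ~~ odd (b ^ d * cm) by rewrite -h oddM odd_pell (negbTE ee).
  by rewrite oddM om andbT.
have := dvdn_leq e0 (pow2_dvd_pell de).
have : 2 ^ d.-1 <= 2 ^ d by rewrite leq_exp2l // leq_pred.
by move: he; move: (2 ^ _) (2 ^ d) (_ * d); clear; lia.
Qed.
End PositiveK.

(** If n < 2m, the reflection in m makes Q_m divide P_(2m-n), which is positive and smaller than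
    Q_m. So 2m <= n, while n <= m + mu + 2 by size. *)
Lemma regime_zero : k = 0 -> d = 1 -> n <= 2 * mu + 4.
Proof.
move=> k0 d1; move: eqn; rewrite k0 d1 expn1 addn0 => e.
have mn : m < n.
  rewrite ltnNge -leq_pell e; have := pell_lt_lucas m; have := pell_lucas_gt0 m; nia.
have nm : n <= m + mu + 2.
  have hq : pell_lucas m <= 2 * pell m.+1.
    by case: (m) => // m'; rewrite lucas_pell pellSS; lia.
  rewrite -ltnS -ltn_pell e; apply: leq_trans (_ : 2 ^ mu.+2 * pell m.+1 <= _); last first.
    by apply: leq_trans (pell_addn _ _) _; rewrite leq_pell; lia.
  rewrite (expnS 2 mu.+1); move: b_le hq (pell_gt0 m); clear; move: (2 ^ _) => x; nia.
suff : 2 * m <= n by lia.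
rewrite leqNgt; apply/negP => n2.
have hy : 0 < pell (m - (n - m)) < pell_lucas m.
  have -> : m - (n - m) = (m - (n - m)).-1.+1 by lia.
  rewrite pell_gt0 andTb; have : pell (m - (n - m)).-1.+1 <= pell m by rewrite leq_pell; lia.
  have := pell_lt_lucas m; have := pell_lucas_gt0 m; move: (pell _.+1) (pell m) (pell_lucas m); clear.
  by case: (m <= 1) => x y z; lia.
case/andP: hy => y0 /ltn_geF; rewrite (_ : _ <= _ = true) //; apply: dvdn_leq y0 _.
have dn : pell_lucas m %| pell n by rewrite e dvdn_mull.
have e1 : n - m + (m - (n - m)) = m by lia.
have e2 : 2 * (n - m) + (m - (n - m)) = n by lia.
have [o|ev] := boolP (odd (n - m)).
  have := pell_mul_lucas_odd (m - (n - m)) o; rewrite e1 e2 => h.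
  by rewrite -(dvdn_addr _ dn) -h dvdn_mull.
have := pell_mul_lucas_even (m - (n - m)) ev; rewrite e1 e2 => h.
by move: dn; rewrite -h dvdn_addr // dvdn_mull.
Qed.
End Regime.

End PellRegimes.

(** * Application of the linear form bound *)

Module PellBaker.
Import LinearForms PellIdentities PellRegimes.
Import all_boot all_order all_algebra all_classical all_reals all_analysis.
Import ring lra zify.
Set Implicit Arguments. Unset Strict Implicit. Unset Printing Implicit Defensive.
Import Order.TTheory GRing.Theory Num.Theory numFieldNormedType.Exports.
Local Open Scope ring_scope.

Lemma ln_sub_le (R : realType) (x y : R) : 0 < x -> 0 < y -> ln x - ln y <= (x - y) / y.
Proof.
move=> x0 y0; rewrite -ln_div ?posrE // mulrBl divff ?gt_eqF //.
have h : -1 < x / y - 1 by rewrite ltrBrDr addNr divr_gt0.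
by have := le_ln1Dx h; rewrite addrC subrK.
Qed.

Lemma ln_dist_le (R : realType) (x y z : R) : 0 < z -> z <= x -> z <= y ->
  `|ln x - ln y| <= `|x - y| / z.
Proof.
move=> z0 zx zy; have x0 := lt_le_trans z0 zx; have y0 := lt_le_trans z0 zy.
have key u v : 0 < u -> 0 < v -> z <= v -> ln u - ln v <= `|u - v| / z.
  move=> u0 v0 zv; apply: le_trans (ln_sub_le u0 v0) _.
  apply: le_trans (_ : `|u - v| / v <= _); first by rewrite ler_pM2r ?invr_gt0 // ler_norm.
  by rewrite ler_wpM2l // lef_pV2.
by rewrite ler_norml lerNl opprB {1}distrC !key.
Qed.

Section PellBaker.
Variables (R : realType) (t : nat).
Hypothesis t0 : (0 < t)%N.
Local Notation s := (s2 R).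
Local Notation al := (1 + s).
Local Notation bt := (1 - s).
Let ct : nat := (pell_lucas t)./2.
Let gp : int := (2 * pell t)%N.
Let gq : int := ct%:Z - 1.
Let G : R := gp%:~R + gq%:~R * s.

Let s_ge1 : 1 <= s. Proof. by have := s2_sq R; have := s2_gt0 R => h1 h2; nra. Qed.
Let s_le : s <= 2. Proof. by have := s2_sq R; have := s2_gt0 R => h1 h2; nra. Qed.
Let s_pos : 0 < s. Proof. exact: s2_gt0. Qed.

Lemma al_ge2 : 2 <= al. Proof. have := s_ge1 => h; lra. Qed.
Lemma al_gt0 : 0 < al. Proof. exact: lt_le_trans al_ge2. Qed.
Lemma norm_bt : `|bt| = al^-1.
Proof.
rewrite ler0_norm; last by have := s_ge1 => h; lra.
apply: (mulfI (lt0r_neq0 al_gt0)); rewrite mulrN al_bt opprK divff // gt_eqF //; exact: al_gt0.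
Qed.
Lemma norm_btX k : `|bt| ^+ k <= 2 ^- k.
Proof.
rewrite norm_bt exprVn lef_pV2 ?posrE ?exprn_gt0 ?al_gt0 //.
by apply: lerXn2r; rewrite ?nnegrE ?(ltW al_gt0) //; exact: al_ge2.
Qed.

(** alpha^t = Q_t / 2 + P_t sqrt 2, which explains the integer coordinates [gp] and [gq]. *)
Lemma GE : G = s * (al ^+ t - 1).
Proof.
have [c qc _] := half_lucas t.
have hc : ct = c by rewrite /ct qc mul2n doubleK.
have h1 := pell_binet R t; have h2 := lucas_binet R t; rewrite qc natrM in h2.
rewrite /G /gp /gq hc rmorphB /= -!pmulrn natrM.
have -> : al ^+ t = s * (pell t)%:R + c%:R by move: (al ^+ t) (bt ^+ t) h1 h2 => u v h1 h2; lra.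
have := s2_sq R; move: s (pell t)%:R c%:R => r p w hr; transitivity ((r * r) * p + r * (w - 1)); [rewrite hr; ring|ring].
Qed.
Lemma cjGE : cj G = - s * (bt ^+ t - 1).
Proof.
have ka : inK al by apply: inKD; [exact: inK1|exact: inK_s2].
rewrite GE cjM ?cj_s2 ?cjB ?cjX ?cj1 //; do ?[exact: inK1|exact: inK_s2|exact: inKX].
  by rewrite cjD ?cj1 ?cj_s2 //; [exact: inK1|exact: inK_s2].
by apply: inKB; [exact: inKX|exact: inK1].
Qed.

Lemma G_ge2 : 2 <= G.
Proof.
rewrite GE; have h : al <= al ^+ t.
  rewrite -{1}[al]expr1 ler_weXn2l //; have := al_ge2 => h; lra.
have := s2_sq R; have := s_ge1; move: h; move: (al ^+ t) => u; move: s => r h1 h2 h3; nra.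
Qed.

Lemma G_le : G <= 2 ^+ (2 * t).+1.
Proof.
rewrite GE exprS; apply: ler_pM.
- exact: ltW.
- by rewrite subr_ge0 exprn_ege1 //; have := al_ge2 => h; lra.
- exact: s_le.
- rewrite exprM; apply: le_trans (_ : al ^+ t <= _); first by rewrite gerBl.
  by apply: lerXn2r; rewrite ?nnegrE ?(ltW al_gt0) ?exprn_ge0 // -[2^+2]/(2*2); have := s_le => h; lra.
Qed.

Lemma bt1_le : `|bt ^+ t - 1| <= 2.
Proof.
apply: le_trans (ler_normB _ _) _; rewrite normr1 normrX.
suff : `|bt| ^+ t <= 1 by lra.
by apply: exprn_ile1; rewrite // norm_bt invf_le1 ?al_gt0 //; have := al_ge2 => h; lra.
Qed.

Lemma cjG_le : `|cj G| <= 2 ^+ 2.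
Proof.
rewrite cjGE normrM normrN (ger0_norm (ltW s_pos)) expr2.
by apply: ler_pM; rewrite ?s_le ?bt1_le // ltW.
Qed.

Variables (b d m n k mu : nat).
Hypotheses (mu0 : (0 < mu)%N) (b2 : (2 <= b)%N) (b_le : (b <= 2 ^ mu.+1)%N).
Hypotheses (nE : n = (k + t)%N) (m_le : (m <= mu + 2)%N) (t_le : (t <= 2 * mu + 4)%N).
Hypotheses (k_d : (k <= d * mu.+1)%N) (d_k : (d <= 2 * k)%N) (k2 : (2 <= k)%N).
Hypothesis eqn : (pell n = b ^ d * pell_lucas m + pell k)%N.

(** The equation times 4 says that X is the trace of Y: X - Y is the conjugate of Y, exponentially
    small in k. *)
Let X : R := b%:R ^+ d * (4 * pell_lucas m)%:R.
Let Y : R := al ^+ k * G.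

Lemma XYE : X - Y = - s * (bt ^+ k * (bt ^+ t - 1)).
Proof.
have := congr1 (fun x : nat => 2 * s * x%:R : R) eqn.
rewrite natrD [2 * s * (_ + _)]mulrDr !pell_binet nE !exprD natrM natrX /X /Y GE natrM => h.
move: h; have := s2_sq R; move: (pell_lucas m)%:R (b%:R ^+ d) (al ^+ k) (al ^+ t) (bt ^+ k) (bt ^+ t) => q' B A u C v.
move: s => r hr h; transitivity (r * (2 * r * (B * q')) - A * (r * (u - 1))).
  by congr (_ - _); transitivity (2 * (r * r) * (B * q')); [rewrite hr; ring|ring].
have -> : 2 * r * (B * q') = A * u - C * v - (A - C) by rewrite h addrK.
ring.
Qed.

Lemma XY_le : `|X - Y| <= 4 * `|bt| ^+ k.
Proof.
rewrite XYE !normrM normrN (ger0_norm (ltW s_pos)) normrX.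
rewrite mulrCA [4 * _]mulrC ler_wpM2l ?exprn_ge0 // (_ : 4 = 2 * 2); last by ring.
by apply: ler_pM; rewrite ?bt1_le // ltW.
Qed.

(** X and Y are both at least alpha^k, so their logarithms differ by at most 4 |1 - sqrt 2|^(2k);
    for k >= 2 one of the two k-th powers absorbs the 4. *)
Lemma Lam_le : `|ln X - ln Y| <= 2 ^- k.
Proof.
have ak : 1 <= al ^+ k by apply: exprn_ege1; have := al_ge2 => h; lra.
have Y2 : 2 * al ^+ k <= Y by rewrite mulrC ler_wpM2l ?G_ge2 // (le_trans _ ak).
have b4 : `|bt| ^+ k <= 4^-1.
  apply: le_trans (norm_btX k) _; rewrite -(subnK k2) exprD invfM.
  rewrite (_ : 2 ^+ 2 = 4); last by rewrite -[2 ^+ 2]/(2 * 2); ring.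
  by rewrite ler_piMl // invf_le1 ?exprn_gt0 // exprn_ege1 // ler1n.
have h1 := XY_le; have h2 : al ^+ k <= X.
  have : - (X - Y) <= `|X - Y| by rewrite -normrN ler_norm.
  by lra.
have h3 : al ^+ k <= Y by lra.
apply: le_trans (ln_dist_le (lt_le_trans ltr01 ak) h2 h3) _.
have e : (al ^+ k)^-1 = `|bt| ^+ k by rewrite norm_bt exprVn.
rewrite e; apply: le_trans (_ : 4 * `|bt| ^+ k * `|bt| ^+ k <= _).
  by rewrite ler_wpM2r // exprn_ge0.
have h4 := norm_btX k; have h5 : 0 <= `|bt| ^+ k by apply: exprn_ge0.
by move: h4 h5 b4; move: (`|bt| ^+ k) (2 ^- k) => u v *; nra.
Qed.

Lemma pell_baker : (k < 2 ^ 98 * mu ^ 3)%N.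
Proof.
have G0 : 0 < G by apply: lt_le_trans G_ge2.
have q0 : (0 < 4 * pell_lucas m)%N by rewrite muln_gt0 pell_lucas_gt0.
apply: (@baker_bound R b d k (4 * pell_lucas m) mu gp gq) => //.
- by apply: le_trans G_ge2; rewrite ler1n.
(* 2t + 1 <= 4 mu + 9 <= 13 mu as mu >= 1: the origin of 13. The conjugate and q need only the
   exponents 2 and 2 mu + 7. *)
- apply: le_trans G_le _; rewrite ler_weXn2l ?ler1n //; move: t_le mu0; clear; lia.
- apply: le_trans cjG_le _; rewrite ler_weXn2l ?ler1n //; move: mu0; clear; lia.
- apply: leq_trans (_ : 4 * (2 * 4 ^ m) <= _)%N; first by rewrite leq_mul2l lucas_le_pow4.
  rewrite (_ : 4 * (2 * 4 ^ m) = 2 ^ (3 + 2 * m))%N; last by rewrite expnD expnM mulnA.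
  rewrite leq_exp2l //; move: m_le mu0; clear; lia.
have e : ln X - ln Y = d%:R * ln b%:R - k%:R * ln al - (ln G - ln (4 * pell_lucas m)%:R).
  have bR : 0 < b%:R :> R by rewrite ltr0n (leq_trans _ b2).
  have qR : 0 < (4 * pell_lucas m)%:R :> R by rewrite ltr0n.
  rewrite /X /Y lnM ?posrE ?exprn_gt0 // lnM ?posrE ?exprn_gt0 ?al_gt0 // !lnXn ?al_gt0 //.
  rewrite -[ln b%:R *+ d]mulr_natl -[ln al *+ k]mulr_natl; ring.
by rewrite -e; exact: Lam_le.
Qed.

End PellBaker.

End PellBaker.

(** * The cases combined *)

Module PellBound.
Import LinearForms PellIdentities PellRegimes PellBaker.
Import all_boot all_order all_algebra.
Import ring lra zify.
Set Implicit Arguments. Unset Strict Implicit. Unset Printing Implicit Defensive.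
Import Order.TTheory GRing.Theory Num.Theory.
Import reals Rstruct.

Lemma cube_bound mu x : 0 < mu -> (x <= 3 * (mu.+1 * (mu + 7)) + 2) || (x <= 2 * mu + 6) -> x < 64 * mu ^ 3.
Proof.
move=> mu0; rewrite !expnS expn0 muln1.
have h1 : mu <= mu * mu by rewrite leq_pmull.
have h2 : mu * mu <= mu * (mu * mu) by rewrite leq_pmull.
have -> : mu.+1 * (mu + 7) = mu * mu + 8 * mu + 7 by lia.
by move: (mu * (mu * mu)) (mu * mu) h1 h2 => u v h1 h2; case/orP; lia.
Qed.

Theorem pell_bound b mu m n k : 0 < mu -> 1 < b < 2 ^ mu.+1 ->
  pell n = b ^ ndigits b (pell k) * pell_lucas m + pell k ->
  n < 2 ^ 98 * mu ^ 3 + 64 * mu ^ 3.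
Proof.
move=> mu0 /andP [b2 b_le]; set d := ndigits b (pell k) => eqn.
have d0 : 0 < d by rewrite /d /ndigits addn1.
have small x : (x <= 3 * (mu.+1 * (mu + 7)) + 2) || (x <= 2 * mu + 6) -> x < 2 ^ 98 * mu ^ 3 + 64 * mu ^ 3.
  by move/(cube_bound mu0) => h; apply: leq_trans h _; rewrite leq_addl.
case: (posnP k) => [k0|k0].
  apply: small; apply/orP; right; apply: leq_trans (_ : 2 * mu + 4 <= _); last by rewrite leq_add2l.
  (* The digit convention for 0 enters here: [trunc_log] vanishes at 0, so d = 1. *)
  by apply: (regime_zero b2 b_le mu0 d0 eqn k0); rewrite /d k0 /ndigits /= trunc_log0.
have pk : 0 < pell k by case: (k) k0 => // k' _; exact: pell_gt0.
have dlo : b ^ d.-1 <= pell k by rewrite /d /ndigits addn1 trunc_logP.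
have dhi : pell k < b ^ d by rewrite /d /ndigits addn1 trunc_log_ltn.
have hgt := n_gt b2 b_le mu0 d0 eqn k0 dlo dhi.
have hle := n_le b2 b_le mu0 d0 eqn k0 dlo dhi.
have [nm|nm] := ltnP n (k + (m + m)).
  by apply: small; rewrite (regime_large b2 b_le mu0 d0 eqn k0 dlo dhi nm).
have m_le : m <= mu + 2 by move: nm hle; clear; lia.
have [k2|k2] := leqP k 1.
  by apply: small; apply/orP; right; move: m_le k2 hle; clear; lia.
have nE : n = k + (n - k) by rewrite subnKC // (leq_trans _ (ltnW hgt)) // leq_addr.
have t0 : 0 < n - k by move: hgt; clear; lia.
have t_le : n - k <= 2 * mu + 4 by move: hle m_le; clear; lia.
have kd : k <= d * mu.+1 by rewrite mulnC (k_le b_le d0 k0 dhi).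
have dk := d_le b2 b_le mu0 d0 eqn k0 dlo dhi.
have := @pell_baker (Rdefinitions.R : realType) _ t0 b d m n k mu mu0 b2 (ltnW b_le) nE m_le t_le kd dk k2 eqn.
have : 2 * mu + 4 < 64 * mu ^ 3 by apply: cube_bound => //; apply/orP; right; rewrite leq_add2l.
move: (2 ^ 98 * _) (64 * _) t_le nE; clear; lia.
Qed.

End PellBound.

(** * From the integer part of log2 b to the natural logarithm *)

Module RealBound.
Import ssreflect ssrfun ssrbool eqtype ssrnat prime PellBound.

Lemma INR_expn a j : INR (expn a j) = (INR a ^ j)%R.
Proof. by elim: j => [|j IH]; rewrite ?expn0 // expnS mult_INR IH. Qed.

Lemma pell_bound_ln b m n k : (2 <= b)%coq_nat ->
  pell n = expn b (ndigits b (pell k)) * pell_lucas m + pell k ->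
  (INR n < 47 * 10 ^ 29 * ln (INR b) ^ 3)%R.
Proof.
move=> /leP b2 eqn; pose mu := trunc_log 2 b.
have b0 : 0 < b by apply: ltnW.
have lo : 2 ^ mu <= b by apply: trunc_logP.
have hi : b < 2 ^ mu.+1 by apply: trunc_log_ltn.
have mu0 : 0 < mu by rewrite lt0n; apply/eqP => m0; move: hi; rewrite m0 expn1 ltnNge b2.
have h := pell_bound mu0 (introT andP (conj b2 hi)) eqn.
have {h} hn : (INR n < (2 ^ 98 + 64) * INR mu ^ 3)%R.
  have := lt_INR _ _ (ltP h); rewrite plus_INR (mult_INR (2 ^ 98)) (mult_INR 64) !INR_expn.
  rewrite [INR 2]/= [INR 64](_ : _ = 64%R); last by rewrite INR_IZR_INZ.
  move: (INR mu ^ 3)%R => x; lra.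
apply: (Rlt_le_trans _ _ _ hn).
(* As ln 2 > 1/2, mu^3 <= 8 ln(b)^3, and 8 (2^98 + 64) = 2^101 + 512 is about 2.54 * 10^30, below
   4.7 * 10^30. *)
have hl : (INR mu / 2 <= ln (INR b))%R.
  have e : (ln (INR (2 ^ mu)) = INR mu * ln 2)%R by rewrite INR_expn (_ : INR 2 = 2%R) // ln_pow //; lra.
  apply: (Rle_trans _ (ln (INR (2 ^ mu)))).
    rewrite e; have := ln_lt_2; have := pos_INR mu; nra.
  have p : (0 < INR (2 ^ mu))%R by apply: lt_0_INR; apply/ltP; rewrite expn_gt0.
  have [lt|->] := le_INR _ _ (leP lo); last exact: Rle_refl.
  by left; apply: ln_increasing.
have hp : (0 <= INR mu / 2)%R by have := pos_INR mu; lra.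
have := pow_incr _ _ 3 (conj hp hl).
rewrite /Rdiv Rpow_mult_distr; move: (INR mu ^ 3)%R (ln (INR b) ^ 3)%R (pow_le _ 3 (pos_INR mu)) => x y hx hxy.
lra.
Qed.

Lemma expn_pow a j : expn a j = Nat.pow a j.
Proof. by elim: j => //= j <-; rewrite expnS. Qed.
End RealBound.

Theorem theorem2 (b : nat) (hb : (2 <= b)%nat) (n m k : nat) :
  pell n = (b ^ ndigits b (pell k) * pell_lucas m + pell k)%nat ->
  (INR n < 47 * 10 ^ 29 * (ln (INR b)) ^ 3)%R.
Proof.
rewrite <- RealBound.expn_pow; exact (RealBound.pell_bound_ln b m n k hb).
Qed.
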